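(* Let $\mathcal A$ be an infinite radially symmetric antitree with sphere numbers $\{s_n\}_{n\ge0}$ and edge lengths $\{\ell_n\}_{n\ge0}$ such that $\mathrm{vol}(\mathcal A)=\sum_{n\ge0}s_ns_{n+1}\ell_n=\infty$, and let $\mathbf H$ be its (self-adjoint) Kirchhoff Laplacian. Then the bottom of the spectrum $\lambda_0(\mathbf H)=\inf\sigma(\mathbf H)$ is strictly positive if and only if the following conditions are satisfied: (i) $\ell^*(\mathcal A)=\sup_{n\ge0}\ell_n<\infty$, (ii) $\mathcal L_\mu:=\int_0^{\mathcal L}\frac{dx}{\mu(x)}=\sum_{n\ge0}\frac{\ell_n}{s_ns_{n+1}}<\infty$, and (iii) $$C(\mathcal L):=\sup_{x\in(0,\mathcal L)}\int_0^x\mu(s)\,ds\cdot\int_x^{\mathcal L}\frac{ds}{\mu(s)}<\infty.$$ Moreover, $$\frac1{4C(\mathcal L)}\le\lambda_0(\mathbf H)\le\frac1{C(\mathcal L)}.$$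
   Context: Radially symmetric antitree: let $s_0=1$, $s_n\in\mathbb Z_{\ge1}$ ($n\ge1$) and $\ell_n>0$ ($n\ge0$). The infinite radially symmetric (metric) antitree $\mathcal A$ with sphere numbers $\{s_n\}$ and edge lengths $\{\ell_n\}$ is the rooted metric graph whose vertex set $\mathcal V$ is the disjoint union of finite sets $S_n$, $\#S_n=s_n$ ($S_0=\{o\}$, $o$ the root), in which every vertex of $S_n$ is joined by exactly one edge to every vertex of $S_{n+1}$ for all $n\ge 0$, there are no other edges, and each edge joining $S_n$ with $S_{n+1}$ is identified with an interval of length $\ell_n$. $\mathcal E$ is the edge set. Kirchhoff Laplacian: $L^2(\mathcal A)=\bigoplus_{e\in\mathcal E}L^2(e)$. The operator $\mathbf H_0$ acts edgewise as $f_e\mapsto -f_e''$ on the set of all $f\in L^2(\mathcal A)$ vanishing outside finitely many edges, with $f_e\in H^2(e)$ for every $e\in\mathcal E$, and such that at every vertex $v$: $f$ is continuous at $v$, and $\sum_e f_e'(v)=0$, the sum running over the edges incident to $v$ and $f_e'(v)$ being the derivative at $v$ directed from $v$ into $e$. It is symmetric; the Kirchhoff Laplacian is its closure $\mathbf H=\overline{\mathbf H_0}$, which is self-adjoint when $\mathrm{vol}(\mathcal A)=\infty$. Notation: $t_n=\sum_{j=0}^{n-1}\ell_j$, $\mathcal L=\sum_{n\ge0}\ell_n\in(0,\infty]$, and $\mu(t)=s_ns_{n+1}$ for $t\in[t_n,t_{n+1})$, $n\ge0$. Convention: $1/\infty=0$. *)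

(* Defs.v *)
From HB Require Import structures.
From mathcomp Require Import all_boot all_order all_algebra.
From mathcomp Require Import all_classical all_reals all_analysis.
From mathcomp Require Import complex.
Set Implicit Arguments.
Unset Strict Implicit.
Unset Printing Implicit Defensive.
Import Order.TTheory GRing.Theory Num.Theory.
Import numFieldNormedType.Exports.
Local Open Scope classical_set_scope.
Local Open Scope ring_scope.
Local Open Scope complex_scope.

(* The combinatorial antitree with sphere numbers s.  The vertices of S_n are
   indexed by 'I_(s n); the edge existT _ n (i, j) joins vertex i of S_n with
   vertex j of S_(n.+1).  Edges are oriented away from the root. *)
Section Antitree.
Variable s : nat -> nat.

Definition vertex : Type := {n : nat & 'I_(s n)}.

Definition edge : choiceType := {n : nat & ('I_(s n) * 'I_(s n.+1))%type}.

Definition origin (e : edge) : vertex :=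
  existT (fun n => 'I_(s n)) (tag e) (tagged e).1.

Definition terminus (e : edge) : vertex :=
  existT (fun n => 'I_(s n)) (tag e).+1 (tagged e).2.

End Antitree.

Section Interval.
Variable R : realType.
Implicit Types (a b : R) (u : R -> R[i]).

Definition cmeasurable (D : set R) u : Prop :=
  measurable_fun D (fun x => complex.Re (u x)) /\
  measurable_fun D (fun x => complex.Im (u x)).

Definition cintegral a b u : R[i] :=
  (\int[lebesgue_measure]_(x in `[a, b]) complex.Re (u x)) +i*
  (\int[lebesgue_measure]_(x in `[a, b]) complex.Im (u x)).

Definition normsq_itv a u : \bar R :=
  (\int[lebesgue_measure]_(x in `[0%R, a])
     (complex.Re (u x) ^+ 2 + complex.Im (u x) ^+ 2)%:E)%E.

(* u is the C^1 representative of an element of H^2(0, a), with derivative u1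
   and second weak derivative u2: u and u1 are absolutely continuous on
   [0, a], i.e. indefinite integrals of their derivatives, and u2 is square
   integrable.  Values outside [0, a] are irrelevant, and u2 matters only up to
   null sets. *)
Definition sobolev2 a u u1 u2 : Prop :=
  [/\ cmeasurable `[0, a] u2, (normsq_itv a u2 < +oo)%E,
      forall x : R, x \in `[0, a] -> u1 x = u1 0 + cintegral 0 x u2 &
      forall x : R, x \in `[0, a] -> u x = u 0 + cintegral 0 x u1].

End Interval.

Section KirchhoffLaplacian.
Variables (R : realType) (s : nat -> nat) (l : nat -> R).

Definition elen (e : edge s) : R := l (tag e).

(* A function on the metric antitree: edge e is the interval [0, elen e], with
   0 at origin e and elen e at terminus e.  Elements of L^2 are represented by such
   functions, two of them being identified when l2eq holds; values outside
   [0, elen e] never matter. *)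
Definition gfun : Type := edge s -> R -> R[i].
Implicit Types f g F : gfun.

Definition normsq f : \bar R :=
  \esum_(e in [set: edge s]) normsq_itv (elen e) (f e).

Definition inL2 f : Prop :=
  (forall e, cmeasurable `[0, elen e] (f e)) /\ (normsq f < +oo)%E.

Definition gsub f g : gfun := fun e x => f e x - g e x.

Definition gscale (z : R[i]) f : gfun := fun e x => z * f e x.

Definition l2eq f g : Prop := normsq (gsub f g) = 0%E.

Definition continuous_at_vertex f (v : vertex s) : Prop :=
  exists c : R[i],
    (forall e : edge s, origin e = v -> f e 0 = c) /\
    (forall e : edge s, terminus e = v -> f e (elen e) = c).

(* f1 is the edgewise derivative; at the terminus of an edge the derivative
   directed into the edge is - f1.  The index sets are finite. *)
Definition kirchhoff_at_vertex (f1 : gfun) (v : vertex s) : Prop :=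
  \sum_(e \in [set e : edge s | origin e = v]) f1 e 0 +
  \sum_(e \in [set e : edge s | terminus e = v]) (- f1 e (elen e)) = 0.

(* The graph of the minimal operator H_0. *)
Definition kirchhoff0 f F : Prop :=
  [/\ inL2 f,
      finite_set [set e : edge s | exists2 x : R, x \in `[0, elen e] & f e x != 0] &
      exists f1 f2 : gfun,
        [/\ forall e, sobolev2 (elen e) (f e) (f1 e) (f2 e),
            forall v, continuous_at_vertex f v,
            forall v, kirchhoff_at_vertex f1 v &
            F = (fun e x => - f2 e x)]].

(* Operators on L^2 are given by their graphs; the closure of an operator is
   given by the closure of its graph in L^2 x L^2. *)
Definition op_closure (T : gfun -> gfun -> Prop) f F : Prop :=
  [/\ inL2 f, inL2 F &
      forall eps : R, 0 < eps -> exists f0 F0,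
        [/\ T f0 F0, (normsq (gsub f f0) < eps%:E)%E &
            (normsq (gsub F F0) < eps%:E)%E]].

Definition kirchhoff_laplacian : gfun -> gfun -> Prop := op_closure kirchhoff0.

(* T - z is onto L^2 and has a bounded inverse; the norm estimate contains
   injectivity. *)
Definition resolvent_set (T : gfun -> gfun -> Prop) : set R[i] :=
  [set z | (forall g, inL2 g ->
              exists f F, T f F /\ l2eq (gsub F (gscale z f)) g) /\
           (exists M : R, forall f F, T f F ->
              (normsq f <= (M ^+ 2)%:E * normsq (gsub F (gscale z f)))%E)].

Definition spectrum (T : gfun -> gfun -> Prop) : set R[i] := ~` resolvent_set T.

(* The infimum is over the real points of the spectrum; the spectrum of a
   self-adjoint operator is real. *)
Definition lambda0 : \bar R :=
  ereal_inf [set x%:E | x in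
    [set x : R | spectrum kirchhoff_laplacian x%:C]].

End KirchhoffLaplacian.

Section Weight.
Variables (R : realType) (s : nat -> nat) (l : nat -> R).

Definition tpt (n : nat) : R := \sum_(0 <= j < n) l j.

Definition height : \bar R := (\sum_(0 <= n <oo) (l n)%:E)%E.

(* Equal to s_n s_(n+1) for x in [t_n, t_(n+1)); only its values on
   [0, height) matter. *)
Definition weight (x : R) : R :=
  let n := xget 0%N [set n | tpt n <= x < tpt n.+1] in (s n * s n.+1)%:R.

Definition lstar : \bar R := ereal_sup (range (fun n => (l n)%:E)).

(* The integral of 1 / weight over the interval (x, height). *)
Definition tail_inv_weight (x : R) : \bar R :=
  (\int[lebesgue_measure]_(y in [set y : R | (x < y)%R /\ y%:E < height])
     ((weight y)^-1)%:E)%E.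

Definition Lmu : \bar R := tail_inv_weight 0.

Definition Cheight : \bar R :=
  ereal_sup [set ((\int[lebesgue_measure]_(y in `]0%R, x[) (weight y)%:E) *
                  tail_inv_weight x)%E
            | x in [set x : R | 0 < x /\ (x%:E < height)%E]].

End Weight.

(* Main.v *)
Require Import Defs.
From mathcomp Require Import all_boot all_order all_algebra.
From mathcomp Require Import all_classical all_reals all_analysis.
From mathcomp Require Import measurable_realfun complex ring lra.
Set Implicit Arguments.
Unset Strict Implicit.
Unset Printing Implicit Defensive.
Import Order.TTheory GRing.Theory Num.Theory.
Import numFieldNormedType.Exports.
Local Open Scope classical_set_scope.
Local Open Scope ring_scope.

(** Since the operator and the spectral parameter are real, real and imaginary parts decouple.

    Lower bound.  Let M(x) be the integral of the weight over (0, x) and P(x) that of its inverse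
    over (x, L).  If M P <= C, then W = sqrt(M / (C P)) / 2 solves the Riccati inequality
    W' - W^2 / mu >= mu / (4 C).  The radial function w = - W / mu satisfies Kirchhoff's
    conditions as a flux, so integrating |f'|^2 >= 2 w f f' - w^2 f^2 by parts over the antitree
    gives |f'|^2 >= |f|^2 / (4 C) for all f in the domain of H_0, radial or not.  (M and P are
    shifted by a small constant to avoid the zeros of M and of the truncated P.)

    Self-adjointness.  For k > 0 the system - f'' + k^2 f = h with Kirchhoff's conditions is solved
    by recursion on the sphere sums of the vertex values.  If h is radial beyond some sphere and
    orthogonal to the positive growing radial solution u >= 1 of the homogeneous equation, then
    adding a multiple of u makes f and its flux vanish on a sphere, where f may be cut off.
    Orthogonality is arranged by adding a constant to h on finitely many bundles, at a cost that
    tends to 0 because the volume is infinite; hence H_0 + k^2 has dense range.  A Neumann series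
    and the closedness of H carry this to every real number below the lower bound of the form.

    Upper bound.  The best lower bound m of the form of H_0 lies in the spectrum: were H - m
    boundedly invertible, m could be increased.  Radial test functions whose flux is
    approximately 1 on (x, L) and 0 on (0, x) give m M(x) P(x) <= 1. *)

(** * Calculus on [0, a] *)

(** Only real spectral parameters have to be treated, because [lambda0] is an infimum over real
    points. Two facts give both bounds: below every lower bound of the form, H - lam is boundedly
    invertible, and the best lower bound is not in the resolvent set. Injectivity with an estimate
    is coercivity; the work lies in surjectivity, obtained as approximate solvability with finite
    support followed by a limit. The obstacle is that the domain contains non-radial functions,
    while M and P are radial objects. Instead of decomposing L^2 under the symmetries, every step is
    arranged to tolerate non-radial parts: the Hardy weight acts pointwise on each edge, and
    Kirchhoff's system closes up on the sphere sums. Origin of the 4: for W = kappa sqrt(M / P), the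
    derivative W' is kappa / 2 times mu / sqrt(M P) plus M / (P mu sqrt(M P)). With M P <= C the
    second term absorbs W^2 / mu as soon as kappa <= 1 / (2 sqrt C), and the first is then at least
    kappa mu / (2 sqrt C), which is mu / (4 C) for the largest such kappa. *)

Section Primitives.
Variable R : realType.
Notation mu := (@lebesgue_measure R).
Implicit Types (a x y : R) (u v U V : R -> R).

Definition itg a u : Prop := mu.-integrable `[0, a] (EFin \o u).

Definition rint a u : R := \int[mu]_(x in `[0, a]) u x.

(** Absolute continuity in the form used by [sobolev2]: U is recovered from u by integration, so
    differentiability almost everywhere never has to be discussed. *)
Definition prim a U u : Prop :=
  itg a u /\ forall x, x \in `[0, a] -> U x = U 0 + rint x u.

Lemma measurable_itv0 a : measurable (`[0, a]%classic : set R).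
Proof. exact: measurable_itv. Qed.
Hint Resolve measurable_itv0 : core.

Lemma itgS a x u : x <= a -> itg a u -> itg x u.
Proof.
move=> xa; apply: integrableS => //.
by apply: subset_itvl; rewrite bnd_simp.
Qed.

Lemma itg_measurable a u : itg a u -> measurable_fun `[0, a] u.
Proof. by move/measurable_int => /measurable_EFinP. Qed.

Lemma itgD a u v : itg a u -> itg a v -> itg a (fun x => u x + v x).
Proof.
move=> iu iv; rewrite /itg (_ : _ \o _ = (EFin \o u) \+ (EFin \o v))%E //.
exact: integrableD.
Qed.

Lemma itgN a u : itg a u -> itg a (fun x => - u x).
Proof.
move=> iu; rewrite /itg (_ : _ \o _ = (-%E \o (EFin \o u)))%E //.
exact: integrableN.
Qed.

Lemma itgB a u v : itg a u -> itg a v -> itg a (fun x => u x - v x).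
Proof. by move=> iu iv; apply: itgD => //; exact: itgN. Qed.

Lemma itgZ a (k : R) u : itg a u -> itg a (fun x => k * u x).
Proof.
move=> iu; rewrite /itg (_ : _ \o _ = (fun x => k%:E * (EFin \o u) x))%E //.
exact: integrableZl.
Qed.

Lemma eq_itg a u v : {in `[0, a], u =1 v} -> itg a u -> itg a v.
Proof.
move=> uv; apply: eq_integrable => // x.
by rewrite inE /= => xa; rewrite uv.
Qed.

Lemma mu_itv0_lty a : (mu `[0%R, a] < +oo)%E.
Proof. by rewrite lebesgue_measure_itv /=; case: ifP => // _; rewrite -EFinD ltry. Qed.

Lemma bounded_itg a u K : measurable_fun `[0, a] u ->
  (forall x, x \in `[0, a] -> `|u x| <= K) -> itg a u.
Proof.
move=> mu_ uK; apply: measurable_bounded_integrable => //.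
  exact: mu_itv0_lty.
exists K; split; first exact: num_real.
by move=> M KM x /= xa; exact: le_trans (uK _ xa) (ltW KM).
Qed.

Lemma itg_cst a (k : R) : itg a (fun=> k).
Proof. exact: (@bounded_itg _ _ `|k|). Qed.

Lemma itgMb a u v K : itg a u -> measurable_fun `[0, a] v ->
  (forall x, x \in `[0, a] -> `|v x| <= K) -> itg a (fun x => u x * v x).
Proof.
move=> iu mv vK.
rewrite /itg (_ : _ \o _ = (EFin \o u) \* (EFin \o v))%E //.
apply: integrableMl => //.
exists K; split; first exact: num_real.
by move=> M KM x /= xa; exact: le_trans (vK _ xa) (ltW KM).
Qed.

Lemma rintD a u v : itg a u -> itg a v ->
  rint a (fun x => u x + v x) = rint a u + rint a v.
Proof. by move=> iu iv; exact: RintegralD. Qed.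

Lemma rintB a u v : itg a u -> itg a v ->
  rint a (fun x => u x - v x) = rint a u - rint a v.
Proof. by move=> iu iv; exact: RintegralB. Qed.

Lemma rintZ a (k : R) u : itg a u -> rint a (fun x => k * u x) = k * rint a u.
Proof. by move=> iu; exact: RintegralZl. Qed.

Lemma rintN a u : itg a u -> rint a (fun x => - u x) = - rint a u.
Proof.
move=> iu; rewrite -[RHS]mulN1r -rintZ //.
by apply: eq_Rintegral => x _; rewrite mulN1r.
Qed.

Lemma eq_rint a u v : {in `[0, a], u =1 v} -> rint a u = rint a v.
Proof. by move=> uv; apply: eq_Rintegral => x; rewrite inE /= => xa; rewrite uv. Qed.

Lemma rint0 u : rint 0 u = 0.
Proof. by rewrite /rint set_itv1 Rintegral_set1. Qed.

Lemma rint_cst a (k : R) : 0 <= a -> rint a (fun=> k) = k * a.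
Proof.
move=> a0; rewrite /rint Rintegral_cst //.
congr (_ * _); have E : mu `[0, a] = a%:E; last exact: (congr1 fine E).
rewrite lebesgue_measure_itv /=; case: ifP => [_|]; first by rewrite -EFinD subr0.
by rewrite lte_fin => /negbT; rewrite -leNgt => a0'; have -> : a = 0 by apply/le_anti/andP.
Qed.

Lemma rint_ge0 a u : (forall x, x \in `[0, a] -> 0 <= u x) -> 0 <= rint a u.
Proof. by move=> u0; apply: Rintegral_ge0 => x /=; exact: u0. Qed.

Lemma le_rint a u v : itg a u -> itg a v ->
  (forall x, x \in `[0, a] -> u x <= v x) -> rint a u <= rint a v.
Proof. by move=> iu iv uv; apply: le_Rintegral => // x /=; exact: uv. Qed.

Lemma fine_rint a u : itg a u -> (rint a u)%:E = (\int[mu]_(x in `[0%R, a]) (u x)%:E)%E.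
Proof. by move=> iu; rewrite /rint /Rintegral fineK //; exact: integrable_fin_num. Qed.

Lemma prim_within_continuous a U u : 0 <= a -> prim a U u ->
  {within `[0, a], continuous U}.
Proof.
move=> a0 [iu Uu].
have cont : {within `[0, a], continuous (fun x => U 0 + rint x u)}.
  have -> : (fun x => U 0 + rint x u) = cst (U 0) \+ (fun x => rint x u) by [].
  move=> x; apply: continuousD; first exact: cst_continuous.
  exact: (parameterized_integral_continuous a0 iu).
have E : {in `[0, a]%classic, (fun x => U 0 + rint x u) =1 U}.
  by move=> x; rewrite inE /= => xa; exact/esym/Uu.
exact: subspace_eq_continuous E cont.
Qed.

Lemma continuous_measurable_bounded a U : 0 <= a -> {within `[0, a], continuous U} ->
  measurable_fun `[0, a] U /\ exists K, forall x, x \in `[0, a] -> `|U x| <= K.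
Proof.
move=> a0 cU; split; first exact: subspace_continuous_measurable_fun.
have /compact_bounded[M [_ mrt]] := continuous_compact cU (@segment_compact R 0 a).
exists (`|M| + 1) => x xa; apply: (mrt (`|M| + 1)).
  by rewrite (le_lt_trans (ler_norm M)) // ltrDl.
by exists x.
Qed.

Lemma prim_measurable_bounded a U u : 0 <= a -> prim a U u ->
  measurable_fun `[0, a] U /\ exists K, forall x, x \in `[0, a] -> `|U x| <= K.
Proof.
by move=> a0 pU; apply: continuous_measurable_bounded => //; exact: prim_within_continuous pU.
Qed.

Lemma prim_itg a U u : 0 <= a -> prim a U u -> itg a U.
Proof.
by move=> a0 pU; have [mU [K UK]] := prim_measurable_bounded a0 pU; exact: bounded_itg UK.
Qed.

Lemma primS a x U u : x <= a -> prim a U u -> prim x U u.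
Proof.
move=> xa [iu Uu]; split; first exact: itgS iu.
move=> y; rewrite in_itv /= => /andP[y0 yx]; apply: Uu.
by rewrite in_itv /= y0 (le_trans yx).
Qed.

Lemma primD a U u V v : prim a U u -> prim a V v ->
  prim a (fun x => U x + V x) (fun x => u x + v x).
Proof.
move=> [iu Uu] [iv Vv]; split; first exact: itgD.
move=> x xa; have xa' : x <= a by case/andP: (xa).
rewrite rintD; [|exact: itgS iu|exact: itgS iv].
by rewrite Uu // Vv //; ring.
Qed.

Lemma primZ a (k : R) U u : prim a U u -> prim a (fun x => k * U x) (fun x => k * u x).
Proof.
move=> [iu Uu]; split; first exact: itgZ.
move=> x xa; have xa' : x <= a by case/andP: (xa).
by rewrite rintZ; [rewrite Uu // mulrDr|exact: itgS iu].
Qed.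

Lemma primN a U u : prim a U u -> prim a (fun x => - U x) (fun x => - u x).
Proof.
move=> [iu Uu]; split; first exact: itgN.
move=> x xa; have xa' : x <= a by case/andP: (xa).
by rewrite rintN; [rewrite Uu // opprD|exact: itgS iu].
Qed.

Lemma primB a U u V v : prim a U u -> prim a V v ->
  prim a (fun x => U x - V x) (fun x => u x - v x).
Proof. by move=> pU pV; apply: primD => //; exact: primN. Qed.

Lemma prim_cst a (k : R) : prim a (fun=> k) (fun=> 0).
Proof.
split; first exact: itg_cst.
move=> x; rewrite in_itv /= => /andP[x0 _].
by rewrite rint_cst // mul0r addr0.
Qed.

Lemma prim_id a : prim a id (fun=> 1).
Proof.
split; first exact: itg_cst.
move=> x; rewrite in_itv /= => /andP[x0 _].
by rewrite rint_cst // mul1r add0r.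
Qed.

Lemma eq_prim a U u V v : {in `[0, a], U =1 V} -> {in `[0, a], u =1 v} ->
  prim a U u -> prim a V v.
Proof.
move=> UV uv [iu Uu]; split; first exact: eq_itg iu.
move=> x xa; have /andP[x0 xa'] : 0 <= x <= a := xa.
have a0 : 0 \in `[0, a] by rewrite in_itv /= lexx (le_trans x0 xa').
rewrite -UV // -UV // Uu //; congr (_ + _); apply: eq_rint => y.
rewrite in_itv /= => /andP[y0 yx]; apply: uv.
by rewrite in_itv /= y0 (le_trans yx).
Qed.

Lemma prim_rint a u : itg a u -> prim a (fun x => rint x u) u.
Proof. by move=> iu; split => // x xa; rewrite rint0 add0r. Qed.

End Primitives.
#[global] Hint Resolve measurable_itv0 : core.

(** * Product rule and integration by parts for absolutely continuous functions *)

Section ProductRule.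
Variable R : realType.
Notation mu := (@lebesgue_measure R).
Implicit Types (a x y : R) (u v U V : R -> R).

(* Fubini for u(x)v(y) on the triangle y <= x. *)
Lemma rint_prim_swap a u v : itg a u -> itg a v ->
  rint a (fun x => u x * rint x v) =
  rint a (fun y => v y * (rint a u - rint y u)).
Proof.
move=> iu iv.
have [a0|a0] := leP 0 a; last first.
  by rewrite /rint set_itv_ge ?Rintegral_set0 // bnd_simp -ltNge.
pose D : set R := `[0, a]%classic.
pose ut := u \_ D; pose vt := v \_ D.
have iut : mu.-integrable setT (EFin \o ut).
  by rewrite -restrict_EFin; apply: ((integrable_mkcond (mu := mu) _ (measurable_itv0 a)).1 iu).
have ivt : mu.-integrable setT (EFin \o vt).
  by rewrite -restrict_EFin; apply: ((integrable_mkcond (mu := mu) _ (measurable_itv0 a)).1 iv).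
have mut : measurable_fun setT ut by apply/measurable_EFinP; exact: measurable_int iut.
have mvt : measurable_fun setT vt by apply/measurable_EFinP; exact: measurable_int ivt.
pose K (z : R * R) := ut z.1 * vt z.2 * (if z.2 <= z.1 then 1 else 0).
have mK : measurable_fun setT K.
  apply: measurable_funM; first apply: measurable_funM.
  - exact: measurableT_comp.
  - exact: measurableT_comp.
  - by apply: measurable_fun_ifT => //; exact: measurable_fun_ler.
have iK : (mu \x mu)%E.-integrable setT (EFin \o K).
  apply/integrable12ltyP; first exact/measurable_EFinP.
  (* The indicator of the triangle is at most 1, and the double integral of |u(x)||v(y)| is a
     product of two finite integrals. *)
  apply: (@le_lt_trans _ _ (\int[mu]_x \int[mu]_y (`|ut x| * `|vt y|)%:E)%E).
    apply: ge0_le_integral => //.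
    - by move=> x _; apply: integral_ge0.
    - have m : measurable_fun setT (fun z : R * R => `|(EFin \o K) z|%E).
        by apply: measurableT_comp => //; exact/measurable_EFinP.
      exact: (measurable_fun_fubini_tonelli_F (m2 := mu) _ m).
    - have m : measurable_fun setT (fun z : R * R => (`|ut z.1| * `|vt z.2|)%:E).
        apply/measurable_EFinP/measurable_funM.
          by do 2 apply: measurableT_comp => //.
        by do 2 apply: measurableT_comp => //.
      apply: (measurable_fun_fubini_tonelli_F (m2 := mu) _ m) => z.
      by rewrite lee_fin mulr_ge0.
    - move=> x _; apply: ge0_le_integral => //.
      + apply: measurableT_comp => //; apply/measurable_EFinP.
        exact: (measurableT_comp mK (pair1_measurable x)).
      + apply/measurable_EFinP; apply: measurable_funM => //.
        exact: measurableT_comp.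
      + move=> y _; rewrite lee_fin /K /= !normrM.
        by apply: ler_piMr; [rewrite mulr_ge0|case: ifP; rewrite ?normr1 ?normr0].
  have E x : (\int[mu]_y (`|ut x| * `|vt y|)%:E = `|ut x|%:E * \int[mu]_y `|vt y|%:E)%E.
    rewrite -ge0_integralZl //; last by apply/measurable_EFinP; exact: measurableT_comp.
  under eq_integral do rewrite E.
  have vfin : (\int[mu]_y `|vt y|%:E < +oo)%E by case/integrableP: ivt.
  have vge : (0 <= \int[mu]_y `|vt y|%:E)%E by apply: integral_ge0.
  rewrite ge0_integralZr //; last by apply/measurable_EFinP; exact: measurableT_comp.
  apply: lte_mul_pinfty => //.
  - by apply: integral_ge0.
  - by rewrite ge0_fin_numE; [case/integrableP: iut|apply: integral_ge0].
have := Fubini iK; rewrite /=.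
have EL x : (\int[mu]_y (K (x, y))%:E = ((ut x) * rint x v)%:E)%E.
  have [xD|xD] := boolP (x \in `[0, a]); last first.
    rewrite /K /= /ut patchE ifF; last by rewrite /D mem_setE; exact/negbTE.
    by under eq_integral do rewrite !mul0r; rewrite integral0 mul0r.
  have xa : x <= a by case/andP: xD.
  have x0 : 0 <= x by case/andP: xD.
  rewrite EFinM fine_rint; last exact: itgS iv.
  rewrite -integralZl //; last exact: itgS iv.
  rewrite [RHS]integral_mkcond.
  apply: eq_integral => y _; rewrite /K /= -mulrA EFinM.
  rewrite /vt !patchE /D !mem_setE !in_itv /=.
  case: (leP 0 y) => //= y0; last by rewrite mul0r mule0.
  case: (leP y x) => [yx|xy]; last by rewrite mulr0 mule0.
  by rewrite (le_trans yx xa) mulr1.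
have ER y : (\int[mu]_x (K (x, y))%:E = ((vt y) * (rint a u - rint y u))%:E)%E.
  have [yD|yD] := boolP (y \in `[0, a]); last first.
    rewrite /K /= /vt patchE ifF; last by rewrite /D mem_setE; exact/negbTE.
    by under eq_integral do rewrite mulr0 mul0r; rewrite integral0 mul0r.
  have ya : y <= a by case/andP: yD.
  have y0 : 0 <= y by case/andP: yD.
  have iu' : mu.-integrable `[y, a] (EFin \o u).
    by apply: integrableS iu => //; apply: subset_itvr; rewrite bnd_simp.
  have -> : rint a u - rint y u = \int[mu]_(x in `[y, a]) u x.
    rewrite /rint Rintegral_itvB //; first rewrite Rintegral_itv_obnd_cbnd //.
    by apply: integrableS iu' => //; exact: subset_itv_oc_cc.
  rewrite EFinM /Rintegral fineK; last exact: integrable_fin_num.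
  rewrite -integralZl //.
  rewrite [RHS]integral_mkcond.
  apply: eq_integral => x _; rewrite /K /= (mulrC (ut x)) -mulrA EFinM.
  rewrite /ut !patchE /D !mem_setE !in_itv /=.
  case: (leP y x) => [yx|xy] /=; last by rewrite mulr0 mule0.
  by rewrite (le_trans y0 yx) /= mulr1; case: ifP => // _; rewrite mule0.
under eq_integral do rewrite EL.
under [X in _ = X -> _]eq_integral do rewrite ER.
move=> /(congr1 fine); rewrite /rint.
have restr (w z : R -> R) : (fun x => ((w \_ D) x * z x)%:E) = (EFin \o (fun x => w x * z x)) \_ D.
  by apply/funext => x; rewrite !patchE; case: ifP => //=; rewrite mul0r.
by rewrite !restr -!integral_mkcond.
Qed.

(** Writing U and V as values at 0 plus integrals leaves one nontrivial term, the integral of u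
    against the primitive of v; [rint_prim_swap] turns it into the product of the two integrals
    minus the same term with u and v exchanged. *)
Lemma prim_mul a U u V v : 0 <= a -> prim a U u -> prim a V v ->
  prim a (fun x => U x * V x) (fun x => u x * V x + U x * v x).
Proof.
move=> a0 pU pV.
have [mU [KU bU]] := prim_measurable_bounded a0 pU.
have [mV [KV bV]] := prim_measurable_bounded a0 pV.
have iuV : itg a (fun x => u x * V x) by apply: itgMb bV => //; case: pU.
have iUv : itg a (fun x => U x * v x).
  apply: (@eq_itg _ _ (fun x => v x * U x)); first by move=> x _; rewrite mulrC.
  by apply: itgMb bU => //; case: pV.
split; first exact: itgD.
move=> x xa; have /andP[x0 xa'] : 0 <= x <= a := xa.
have [iu Uu] := primS xa' pU; have [iv Vv] := primS xa' pV.
have xx : x \in `[0, x] by rewrite in_itv /= x0 lexx.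
rewrite rintD; [|exact: itgS iuV|exact: itgS iUv].
have iui : itg x (fun t => u t * rint t v).
  have [m [K b]] := prim_measurable_bounded x0 (prim_rint iv).
  exact: itgMb b.
have ivi : itg x (fun t => v t * rint t u).
  have [m [K b]] := prim_measurable_bounded x0 (prim_rint iu).
  exact: itgMb b.
have -> : rint x (fun t => u t * V t) = V 0 * rint x u + rint x (fun t => u t * rint t v).
  rewrite -rintZ // -rintD //; last exact: itgZ.
  by apply: eq_rint => t tx; rewrite Vv //; ring.
have -> : rint x (fun t => U t * v t) = U 0 * rint x v + rint x (fun t => v t * rint t u).
  rewrite -rintZ // -rintD //; last exact: itgZ.
  by apply: eq_rint => t tx; rewrite Uu //; ring.
rewrite rint_prim_swap //.
have -> : rint x (fun y => v y * (rint x u - rint y u)) =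
          rint x u * rint x v - rint x (fun t => v t * rint t u).
  rewrite -rintZ // -rintB //; last exact: itgZ.
  by apply: eq_rint => t tx; ring.
rewrite Uu // Vv //; ring.
Qed.

Lemma integration_by_parts_prim a U u V v : 0 <= a -> prim a U u -> prim a V v ->
  rint a (fun x => u x * V x) + rint a (fun x => U x * v x) = U a * V a - U 0 * V 0.
Proof.
move=> a0 pU pV.
have [mU [KU bU]] := prim_measurable_bounded a0 pU.
have [mV [KV bV]] := prim_measurable_bounded a0 pV.
rewrite -rintD.
- by have [_ ->] := prim_mul a0 pU pV; [rewrite addrAC subrr add0r|rewrite in_itv /= a0 lexx].
- by apply: itgMb bV => //; case: pU.
- apply: (@eq_itg _ _ (fun x => v x * U x)); first by move=> x _; rewrite mulrC.
  by apply: itgMb bU => //; case: pV.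
Qed.

(** Entry point for explicit functions: the Riccati weight and the hyperbolic functions have
    continuous derivatives, so the fundamental theorem of calculus makes them primitives. *)
Lemma prim_is_derive a (U u : R -> R) :
  (forall x, x \in `[0, a] -> is_derive x 1 U (u x)) ->
  (forall x, x \in `[0, a] -> {for x, continuous u}) -> prim a U u.
Proof.
move=> dU cu.
have cw : {within `[0, a], continuous u}.
  by apply: continuous_in_subspaceT => x; rewrite inE /= => /cu.
have iu : itg a u.
  by apply: continuous_compact_integrable => //; exact: segment_compact.
split => // x xa; have /andP[x0 xa'] : 0 <= x <= a := xa.
move: x0; rewrite le_eqVlt => /predU1P[<-|x0]; first by rewrite rint0 addr0.
have cU y : y \in `[0, a] -> {for y, continuous U}.
  by move=> /dU d; apply: differentiable_continuous; apply/derivable1_diffP; case: d.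
have sub y : y \in `[0, x] -> y \in `[0, a].
  by rewrite !in_itv /= => /andP[-> yx]; exact: le_trans yx xa'.
rewrite /rint /Rintegral (@continuous_FTC2 R u U 0 x x0); last 3 first.
- apply: continuous_subspaceW cw; exact: subset_itvl.
- split.
  + move=> y yx; have : y \in `[0, a] by apply: sub; exact: subset_itv_oo_cc.
    by case/dU.
  + by apply: cvg_at_right_filter; apply: cU; apply: sub; rewrite in_itv /= lexx ltW.
  + by apply: cvg_at_left_filter; apply: cU; apply: sub; rewrite in_itv /= lexx ltW.
- move=> y yx; have : y \in `[0, a] by apply: sub; exact: subset_itv_oo_cc.
  by move/dU => d; rewrite derive1E derive_val.
by rewrite addrC subrK.
Qed.

End ProductRule.

(** * Square-integrable functions on an edge and a Sobolev inequality *)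

Section SquareIntegrable.
Variable R : realType.
Notation mu := (@lebesgue_measure R).
Implicit Types (a x y t : R) (u v w U V : R -> R).

(** Measurability of u is a separate clause because that of u^2 leaves the sign of u
    undetermined. *)
Definition L2 a u : Prop := measurable_fun `[0, a] u /\ itg a (fun x => u x ^+ 2).

Definition ip a u v : R := rint a (fun x => u x * v x).

Lemma le_itg a u v : measurable_fun `[0, a] u ->
  (forall x, x \in `[0, a] -> `|u x| <= v x) -> itg a v -> itg a u.
Proof.
move=> mu_ uv; apply: le_integrable => //; first exact/measurable_EFinP.
by move=> x /= xa; rewrite lee_fin (le_trans (uv _ xa)) // ler_norm.
Qed.

Lemma eq_L2 a u v : {in `[0, a], u =1 v} -> L2 a u -> L2 a v.
Proof.
move=> uv [mu_ iu]; split; last by apply: eq_itg iu => x xa; rewrite uv.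
by apply: eq_measurable_fun mu_ => x; rewrite inE /=; exact: uv.
Qed.

Lemma L2_mul_itg a u v : L2 a u -> L2 a v -> itg a (fun x => u x * v x).
Proof.
move=> [mu_ iu] [mv iv]; apply: le_itg (itgD iu iv); first exact: measurable_funM.
by move=> x _; rewrite ler_norml; apply/andP; split; nra.
Qed.

Lemma bounded_L2 a u K : measurable_fun `[0, a] u ->
  (forall x, x \in `[0, a] -> `|u x| <= K) -> L2 a u.
Proof.
move=> mu_ uK; split=> //; apply: (@bounded_itg _ _ _ (K ^+ 2)).
  by apply: measurable_funX.
by move=> x xa; rewrite normrX lerXn2r ?nnegrE // ?uK // (le_trans _ (uK _ xa)).
Qed.

Lemma L2_itg a u : L2 a u -> itg a u.
Proof.
move=> L2u; have L21 : L2 a (fun=> 1).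
  by apply: (@bounded_L2 _ _ 1) => // x _; rewrite normr1.
by apply: eq_itg (L2_mul_itg L2u L21) => x _; rewrite mulr1.
Qed.

Lemma prim_L2 a U u : 0 <= a -> prim a U u -> L2 a U.
Proof.
by move=> a0 pU; have [mU [K UK]] := prim_measurable_bounded a0 pU; exact: bounded_L2 UK.
Qed.

Lemma L2_cst a (k : R) : L2 a (fun=> k).
Proof. exact: (@bounded_L2 _ _ `|k|). Qed.

Lemma L2Z a (k : R) u : L2 a u -> L2 a (fun x => k * u x).
Proof.
move=> [mu_ iu]; split; first exact: measurable_funM.
by apply: eq_itg (itgZ (k ^+ 2) iu) => x _; rewrite exprMn.
Qed.

Lemma L2D a u v : L2 a u -> L2 a v -> L2 a (fun x => u x + v x).
Proof.
move=> L2u L2v; have [mu_ iu] := L2u; have [mv iv] := L2v.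
split; first exact: measurable_funD.
apply: (@eq_itg _ _ (fun x => (u x ^+ 2 + 2 * (u x * v x)) + v x ^+ 2)).
  by move=> x _; ring.
by apply: itgD => //; apply: itgD => //; apply: itgZ; exact: L2_mul_itg.
Qed.

Lemma L2N a u : L2 a u -> L2 a (fun x => - u x).
Proof. by move=> /(L2Z (-1)); apply: eq_L2 => x _; rewrite mulN1r. Qed.

Lemma L2B a u v : L2 a u -> L2 a v -> L2 a (fun x => u x - v x).
Proof. by move=> L2u L2v; apply: L2D => //; exact: L2N. Qed.

Lemma ipC a u v : ip a u v = ip a v u.
Proof. by apply: eq_rint => x _; rewrite mulrC. Qed.

Lemma eq_ip a u v w z : {in `[0, a], u =1 v} -> {in `[0, a], w =1 z} -> ip a u w = ip a v z.
Proof. by move=> uv wz; apply: eq_rint => x xa; rewrite uv // wz. Qed.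

Lemma ipDl a u v w : L2 a u -> L2 a v -> L2 a w ->
  ip a (fun x => u x + v x) w = ip a u w + ip a v w.
Proof.
move=> L2u L2v L2w; rewrite /ip -rintD; try exact: L2_mul_itg.
by apply: eq_rint => x _; rewrite mulrDl.
Qed.

Lemma ipZl a (k : R) u v : L2 a u -> L2 a v -> ip a (fun x => k * u x) v = k * ip a u v.
Proof.
move=> L2u L2v; rewrite /ip -rintZ; last exact: L2_mul_itg.
by apply: eq_rint => x _; rewrite mulrA.
Qed.

Lemma ipNl a u v : L2 a u -> L2 a v -> ip a (fun x => - u x) v = - ip a u v.
Proof.
move=> L2u L2v; rewrite -[RHS]mulN1r -ipZl //.
by apply: eq_ip => // x _; rewrite mulN1r.
Qed.

Lemma ip_ge0 a u : 0 <= ip a u u.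
Proof. by apply: rint_ge0 => x _; rewrite -expr2 sqr_ge0. Qed.

Lemma ip0l a u v : {in `[0, a], forall x, u x = 0} -> ip a u v = 0.
Proof.
move=> u0; rewrite /ip (@eq_rint _ _ _ (fun=> 0)); last by move=> x xa; rewrite u0 // mul0r.
have [a0|a0] := leP 0 a; first by rewrite rint_cst // mul0r.
by rewrite /rint set_itv_ge ?Rintegral_set0 // bnd_simp -ltNge.
Qed.

Lemma le_ip_comb a u v w (k l : R) : L2 a u -> L2 a v -> L2 a w ->
  (forall x, x \in `[0, a] -> u x ^+ 2 <= k * v x ^+ 2 + l * w x ^+ 2) ->
  ip a u u <= k * ip a v v + l * ip a w w.
Proof.
move=> L2u L2v L2w uvw.
have iv := L2_mul_itg L2v L2v; have iw := L2_mul_itg L2w L2w.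
rewrite /ip -rintZ // -[X in _ + X]rintZ // -rintD; [|exact: itgZ..].
apply: le_rint; [exact: L2_mul_itg|by apply: itgD; exact: itgZ|].
by move=> x xa; rewrite -!expr2; exact: uvw.
Qed.

(** The two sides differ pointwise by (u - t v)^2 / t. The free parameter t is what later keeps the
    factor of the Neumann series below 1. *)
Lemma ip_young a t u v : 0 < t -> L2 a u -> L2 a v ->
  ip a (fun x => u x + v x) (fun x => u x + v x) <=
  (1 + t^-1) * ip a u u + (1 + t) * ip a v v.
Proof.
move=> t0 L2u L2v; apply: le_ip_comb => //; first exact: L2D.
move=> x _; rewrite -subr_ge0.
rewrite [leRHS](_ : _ = t^-1 * (u x - t * v x) ^+ 2); last by field; exact: lt0r_neq0.
by rewrite mulr_ge0 ?sqr_ge0 // invr_ge0 ltW.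
Qed.

Lemma ip_amgm a t u v : 0 < t -> L2 a u -> L2 a v ->
  2 * ip a u v <= t * ip a u u + t^-1 * ip a v v.
Proof.
move=> t0 L2u L2v.
have iuu := L2_mul_itg L2u L2u; have ivv := L2_mul_itg L2v L2v.
have iuv := L2_mul_itg L2u L2v.
rewrite /ip -!rintZ // -rintD; [|exact: itgZ..].
apply: le_rint; [exact: itgZ|by apply: itgD; exact: itgZ|].
move=> x _; rewrite -subr_ge0.
rewrite [leRHS](_ : _ = t^-1 * (t * u x - v x) ^+ 2); last by field; exact: lt0r_neq0.
by rewrite mulr_ge0 ?sqr_ge0 // invr_ge0 ltW.
Qed.

(** Cauchy-Schwarz against the constant 1, read off from the integral of (|u| - r / a)^2, where r /
    a is the mean of |u|. *)
Lemma sqr_rint_le a u : 0 < a -> L2 a u -> rint a (fun x => `|u x|) ^+ 2 <= a * ip a u u.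
Proof.
move=> a0 L2u; pose v x := `|u x|.
have L2v : L2 a v.
  have [mu_ iu] := L2u; split; first exact: measurableT_comp.
  by apply: eq_itg iu => x _; rewrite /v real_normK // num_real.
set r := rint a _; have iuu := L2_mul_itg L2u L2u; have iv := L2_itg L2v.
have : 0 <= rint a (fun x => (u x * u x + (- 2 * (r / a)) * v x) + (r / a) ^+ 2).
  apply: rint_ge0 => x _.
  have -> : u x * u x = v x ^+ 2 by rewrite /v real_normK ?expr2 // num_real.
  by rewrite [leRHS](_ : _ = (v x - r / a) ^+ 2) ?sqr_ge0 //; ring.
rewrite rintD ?rint_cst ?(ltW a0) //; [|by apply: itgD => //; exact: itgZ|exact: itg_cst].
rewrite rintD //; last exact: itgZ.
rewrite rintZ // -/r -/(ip a u u).
rewrite [X in 0 <= X -> _](_ : _ = ip a u u - r ^+ 2 / a); last by field; exact: lt0r_neq0.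
by rewrite subr_ge0 ler_pdivrMr // mulrC.
Qed.

(** U deviates from U(0) by at most the integral of |u|, so U(x)^2 is controlled by U(y)^2 for every
    y; averaging over y and [sqr_rint_le] yield the two parts of the constant. This later turns
    convergence in the form norm into uniform convergence on each edge. *)
Lemma sobolev_bound a U u x : 0 < a -> prim a U u -> L2 a u -> x \in `[0, a] ->
  U x ^+ 2 <= (2 / a + 8 * a) * (ip a U U + ip a u u).
Proof.
move=> a0 pU L2u xa; have [iu Uu] := pU.
set A := rint a (fun x => `|u x|).
have A0 : 0 <= A by apply: rint_ge0.
have incr y : y \in `[0, a] -> `|U y - U 0| <= A.
  move=> ya; have /andP[y0 ya'] : 0 <= y <= a := ya.
  rewrite Uu // addrAC subrr add0r.
  apply: le_trans (le_normr_Rintegral _ _) _ => //; first exact: itgS iu.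
  rewrite /A /rint -lee_fin !fine_rint; last 2 first.
    exact: integrable_norm.
    by apply: integrable_norm; exact: itgS iu.
  apply: ge0_subset_integral => //=; last by apply: subset_itvl; rewrite bnd_simp.
  by apply/measurable_EFinP; apply: measurableT_comp => //; exact: itg_measurable.
have L2U : L2 a U by exact: prim_L2 (ltW a0) pU.
have key y : y \in `[0, a] -> U x ^+ 2 <= 2 * (U y * U y) + 8 * A ^+ 2.
  move=> ya; have := incr _ xa; have := incr _ ya.
  rewrite !ler_norml => /andP[h1 h2] /andP[h3 h4].
  have : (U x - U y) ^+ 2 <= (2 * A) ^+ 2.
    by rewrite -ler_sqrt ?sqr_ge0 // !sqrtr_sqr ler_norml ger0_norm ?mulr_ge0 //; lra.
  move: (sqr_ge0 (U x - U y - U y)); clear; nra.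
have : U x ^+ 2 * a <= 2 * ip a U U + 8 * A ^+ 2 * a.
  have -> : U x ^+ 2 * a = rint a (fun=> U x ^+ 2) by rewrite rint_cst // ltW.
  have iUU := L2_mul_itg L2U L2U.
  have -> : 2 * ip a U U + 8 * A ^+ 2 * a = rint a (fun y => 2 * (U y * U y) + 8 * A ^+ 2).
    rewrite rintD; [|exact: itgZ|exact: itg_cst].
    by rewrite rintZ // rint_cst // ltW.
  apply: le_rint; [exact: itg_cst| |by move=> y; exact: key].
  by apply: itgD (itg_cst _ _); apply: itgZ; exact: L2_mul_itg.
have := sqr_rint_le a0 L2u; rewrite -/A => hA.
have iU0 := ip_ge0 a U; have iu0 := ip_ge0 a u.
move=> h; rewrite -(ler_pM2r a0).
have -> : (2 / a + 8 * a) * (ip a U U + ip a u u) * a =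
  2 * ip a U U + 8 * a * (a * ip a u u) + (2 * ip a u u + 8 * a * a * ip a U U).
  by field; exact: lt0r_neq0.
apply: le_trans h _; rewrite -addrA lerD2l -[leLHS]addr0; apply: lerD; first by nra.
by rewrite addr_ge0 ?mulr_ge0 // ltW.
Qed.

End SquareIntegrable.

(** * Sums over the bundles of the antitree *)

Section EdgeSums.
Variables (s : nat -> nat).

Definition mk n (i : 'I_(s n)) (j : 'I_(s n.+1)) : edge s :=
  existT (fun n => ('I_(s n) * 'I_(s n.+1))%type) n (i, j).

Definition bundle n : seq (edge s) :=
  [seq existT (fun n => ('I_(s n) * 'I_(s n.+1))%type) n p
     | p <- enum {: ('I_(s n) * 'I_(s n.+1))%type}].

Definition edges N : seq (edge s) := flatten [seq bundle n | n <- iota 0 N].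

Lemma edgesS N : edges N.+1 = edges N ++ bundle N.
Proof. by rewrite /edges -addn1 iotaD map_cat flatten_cat /= cats0. Qed.

Lemma mem_bundle n (e : edge s) : (e \in bundle n) = (tag e == n).
Proof.
apply/mapP/eqP => [[p _ ->] //|]; case: e => m p /= E.
by case: n / E; exists p => //; rewrite mem_enum.
Qed.

Lemma mem_edges N (e : edge s) : (e \in edges N) = (tag e < N)%N.
Proof.
apply/flatten_mapP/idP => [[n]|eN]; first by rewrite mem_iota mem_bundle /= => nN /eqP ->.
by exists (tag e); rewrite ?mem_iota // mem_bundle.
Qed.

Lemma bundle_uniq n : uniq (bundle n).
Proof.
rewrite map_inj_uniq; first exact: enum_uniq.
by move=> p q /eqP; rewrite eq_Tagged /= => /eqP.
Qed.

Lemma edges_uniq N : uniq (edges N).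
Proof.
elim: N => [//|N IH]; rewrite edgesS cat_uniq IH bundle_uniq andbT /=.
apply/hasPn => e; rewrite mem_bundle => /eqP eN.
by rewrite mem_edges eN ltnn.
Qed.

Lemma sum_bundle (V : nmodType) n (F : edge s -> V) :
  \sum_(e <- bundle n) F e = \sum_(i < s n) \sum_(j < s n.+1) F (mk i j).
Proof.
rewrite /bundle big_map pair_big big_enum /=.
by apply: eq_bigr => -[i j].
Qed.

Lemma sum_edgesS (V : nmodType) N (F : edge s -> V) :
  \sum_(e <- edges N.+1) F e =
  \sum_(e <- edges N) F e + \sum_(i < s N) \sum_(j < s N.+1) F (mk i j).
Proof. by rewrite edgesS big_cat sum_bundle. Qed.

Lemma sum_edges0 (V : nmodType) (F : edge s -> V) : \sum_(e <- edges 0) F e = 0.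
Proof. by rewrite big_nil. Qed.

Lemma eq_sum_edges (V : nmodType) N (F G : edge s -> V) :
  (forall e, (tag e < N)%N -> F e = G e) ->
  \sum_(e <- edges N) F e = \sum_(e <- edges N) G e.
Proof.
by move=> FG; rewrite big_seq [RHS]big_seq; apply: eq_bigr => e; rewrite mem_edges; exact: FG.
Qed.

Lemma sum_edges_widen (V : nmodType) N M (F : edge s -> V) : (N <= M)%N ->
  (forall e, (N <= tag e)%N -> F e = 0) ->
  \sum_(e <- edges M) F e = \sum_(e <- edges N) F e.
Proof.
move=> /subnK <-; elim: (M - N)%N => [//|k IH] F0.
rewrite addSn sum_edgesS IH // [X in _ + X]big1 ?addr0 // => i _; rewrite big1 // => j _.
by apply: F0; exact: leq_addl.
Qed.

Lemma sum_edges_esum (R : realType) (a : edge s -> \bar R) N :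
  (forall e, 0 <= a e)%E -> (\sum_(e <- edges N) a e <= \esum_(e in [set: edge s]) a e)%E.
Proof.
move=> a0; apply: esum_ge; exists [set` edges N]; first by split.
by rewrite -fsbig_seq //; exact: edges_uniq.
Qed.

(** A finite set of edges lies in the first N bundles for some N, so the partial sums over bundles
    exhaust the unordered sum. *)
Lemma esum_edges_le (R : realType) (a : edge s -> \bar R) (c : \bar R) :
  (forall e, 0 <= a e)%E -> (forall N, \sum_(e <- edges N) a e <= c)%E ->
  (\esum_(e in [set: edge s]) a e <= c)%E.
Proof.
move=> a0 ac; apply: ge_ereal_sup => _ [X [Xfin _] <-].
have [r Xr] := (finite_seqP X).1 Xfin.
pose N := (\max_(e <- r) (tag e).+1)%N.
apply: le_trans (ac N); rewrite [leRHS]fsbig_seq; last exact: edges_uniq.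
apply: lee_fsum_nneg_subset => //.
rewrite Xr; apply/subsetP => e /= er; rewrite mem_edges.
exact: (@leq_bigmax_seq _ _ xpredT (fun e : edge s => (tag e).+1)).
Qed.

Lemma le_sum_edges (R : numDomainType) N (F G : edge s -> R) :
  (forall e, (tag e < N)%N -> F e <= G e) ->
  \sum_(e <- edges N) F e <= \sum_(e <- edges N) G e.
Proof.
by move=> FG; rewrite big_seq [leRHS]big_seq; apply: ler_sum => e; rewrite mem_edges; exact: FG.
Qed.

Lemma sum_edges_mono (R : numDomainType) N M (F : edge s -> R) : (N <= M)%N ->
  (forall e, 0 <= F e) -> \sum_(e <- edges N) F e <= \sum_(e <- edges M) F e.
Proof.
move=> /subnK <- F0; elim: (M - N)%N => [//|k IH].
apply: le_trans IH _; rewrite addSn sum_edgesS lerDl.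
by do 2 (apply: sumr_ge0 => ? _).
Qed.

Lemma vertex_inj n (i j : 'I_(s n)) :
  existT (fun n => 'I_(s n)) n i = existT (fun n => 'I_(s n)) n j -> i = j.
Proof. by move=> /eqP; rewrite eq_Tagged /= => /eqP. Qed.

Lemma mk_injr n (i : 'I_(s n)) : injective (@mk n i).
Proof.
move=> j k /eqP.
by rewrite eq_Tagged /= => /eqP [].
Qed.

Lemma mk_injl n (j : 'I_(s n.+1)) : injective (@mk n ^~ j).
Proof.
move=> i k /eqP.
by rewrite eq_Tagged /= => /eqP [].
Qed.

Lemma fsum_setT (V : nmodType) (T : finType) (F : T -> V) :
  \sum_(t \in [set: T]) F t = \sum_t F t.
Proof.
rewrite (fsbigE (enum T)) ?enum_uniq //.
  by rewrite big_enum_cond; apply: eq_bigl => t; rewrite mem_setT inE.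
by move=> t _; rewrite mem_enum.
Qed.

Lemma sum_origin (V : nmodType) n (i : 'I_(s n)) (F : edge s -> V) :
  \sum_(e \in [set e : edge s | origin e = existT (fun n => 'I_(s n)) n i]) F e =
  \sum_j F (mk i j).
Proof.
rewrite -fsum_setT (reindex_fsbig (@mk n i) setT) //; split=> //.
- by move=> j k _ _; exact: mk_injr.
- move=> [m [i' j']] /= E.
  have nm : m = n by have := congr1 tag E.
  by subst m; exists j' => //; move/vertex_inj: E => /= <-.
Qed.

Lemma sum_terminus (V : nmodType) n (j : 'I_(s n.+1)) (F : edge s -> V) :
  \sum_(e \in [set e : edge s | terminus e = existT (fun n => 'I_(s n)) n.+1 j]) F e =
  \sum_i F (mk i j).
Proof.
rewrite -fsum_setT (reindex_fsbig (@mk n ^~ j) setT) //; split=> //.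
- by move=> i k _ _; exact: mk_injl.
- move=> [m [i' j']] /= E.
  have nm : m = n by have [] := congr1 tag E.
  by subst m; exists i' => //; move/vertex_inj: E => /= <-.
Qed.

Lemma sum_terminus0 (V : nmodType) (i : 'I_(s 0)) (F : edge s -> V) :
  \sum_(e \in [set e : edge s | terminus e = existT (fun n => 'I_(s n)) 0%N i]) F e = 0.
Proof. by apply: fsbig1 => e /= E; have := congr1 tag E. Qed.

End EdgeSums.

(** * Real functions on the antitree *)

Section RealKirchhoff.
Variables (R : realType) (s : nat -> nat) (l : nat -> R).
Hypothesis s_gt0 : forall n, (0 < s n)%N.
Hypothesis l_gt0 : forall n, 0 < l n.
Implicit Types (f g h F G : edge s -> R -> R) (e : edge s) (N M n : nat).

Local Notation len e := (l (tag e)).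

Lemma len_ge0 e : 0 <= len e. Proof. exact: ltW. Qed.
Hint Resolve len_ge0 : core.

Definition L2loc f : Prop := forall e, L2 (len e) (f e).

Definition sip N f g : R := \sum_(e <- edges s N) ip (len e) (f e) (g e).

(** No edge ends at the root, so Kirchhoff's condition there says that the outflux vanishes. All
    derivatives point away from the root; the sign of the derivative directed inwards at a terminus
    is accounted for by equating outflux and influx. *)
Definition influx f1 n : 'I_(s n) -> R :=
  match n with
  | 0%N => fun=> 0
  | m.+1 => fun j => \sum_(i < s m) f1 (mk i j) (l m)
  end.

Definition outflux f1 n (i : 'I_(s n)) : R := \sum_(j < s n.+1) f1 (mk i j) 0.

Definition kirchhoff f1 : Prop := forall n (i : 'I_(s n)), outflux f1 i = influx f1 i.

Definition vertex_values f (v : forall n, 'I_(s n) -> R) : Prop :=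
  forall n (i : 'I_(s n)) (j : 'I_(s n.+1)),
    f (mk i j) 0 = v n i /\ f (mk i j) (l n) = v n.+1 j.

Definition H2loc f f1 f2 : Prop := forall e,
  [/\ prim (len e) (f e) (f1 e), prim (len e) (f1 e) (f2 e) & L2 (len e) (f2 e)].

(* The real and the imaginary parts of the functions in the domain of H_0, with support in the
   first N bundles; f1 and f2 stand for f' and f''. *)
Definition rdom N f f1 f2 : Prop :=
  [/\ H2loc f f1 f2, exists v, vertex_values f v, kirchhoff f1 &
      forall e x, (N <= tag e)%N -> x \in `[0, len e] -> f e x = 0].

(** The boundary terms of the edges are regrouped by vertices. The family f1 is arbitrary so that it
    can be a derivative or the radial Hardy weight; in the latter case g is the square of a
    function. *)
Lemma sum_flux N (f1 g : edge s -> R -> R) v : vertex_values g v ->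
  \sum_(e <- edges s N) (f1 e (len e) * g e (len e) - f1 e 0 * g e 0) =
  \sum_(j < s N) influx f1 j * v N j -
  \sum_(0 <= n < N) \sum_(i < s n) (outflux f1 i - influx f1 i) * v n i.
Proof.
move=> gv; elim: N => [|N IH].
  by rewrite sum_edges0 big_nil [X in X - _]big1 ?subr0 // => j _; rewrite mul0r.
rewrite sum_edgesS IH big_nat_recr //=.
under [X in _ + X]eq_bigr => i _ do under eq_bigr => j _ do
  rewrite (gv _ i j).1 (gv _ i j).2.
under [X in _ + X]eq_bigr => i _ do rewrite sumrB -mulr_suml.
rewrite sumrB exchange_big /=.
under [X in _ + (X - _)]eq_bigr => j _ do rewrite -mulr_suml.
under [X in _ = _ - (_ + X)]eq_bigr => i _ do rewrite mulrBl.
by rewrite sumrB /outflux; ring.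
Qed.

Lemma sum_flux0 N (f1 g : edge s -> R -> R) v : kirchhoff f1 -> vertex_values g v ->
  \sum_(e <- edges s N) (f1 e (len e) * g e (len e) - f1 e 0 * g e 0) =
  \sum_(j < s N) influx f1 j * v N j.
Proof.
move=> kf gv; rewrite (sum_flux _ _ gv) [X in _ - X]big1 ?subr0 // => n _.
by rewrite big1 // => i _; rewrite kf subrr mul0r.
Qed.

Lemma vertex_values0 N g v : vertex_values g v ->
  (forall e x, (N <= tag e)%N -> x \in `[0, len e] -> g e x = 0) ->
  forall j, v N j = 0.
Proof.
move=> gv g0 j; have /= <- := (gv _ j (Ordinal (s_gt0 N.+1))).1.
by apply: g0 => //=; rewrite in_itv /= lexx ltW.
Qed.

Lemma H2loc_L2 f f1 f2 : H2loc f f1 f2 -> [/\ L2loc f, L2loc f1 & L2loc f2].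
Proof.
move=> Hf; split => e; have [p p1 L] := Hf e => //.
- exact: prim_L2 p.
- exact: prim_L2 p1.
Qed.

Lemma sum_by_parts N f f1 f2 g g1 g2 : H2loc f f1 f2 -> H2loc g g1 g2 ->
  sip N f2 g + sip N f1 g1 =
  \sum_(e <- edges s N) (f1 e (len e) * g e (len e) - f1 e 0 * g e 0).
Proof.
move=> Hf Hg; rewrite -big_split /=; apply: eq_bigr => e _.
have [_ p1 _] := Hf e; have [q _ _] := Hg e.
exact: integration_by_parts_prim.
Qed.

Lemma sipC N f g : sip N f g = sip N g f.
Proof. by apply: eq_bigr => e _; rewrite ipC. Qed.

Lemma sip_ge0 N f : 0 <= sip N f f.
Proof. by apply: sumr_ge0 => e _; exact: ip_ge0. Qed.

Lemma sipDl N f g h : L2loc f -> L2loc g -> L2loc h ->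
  sip N (fun e x => f e x + g e x) h = sip N f h + sip N g h.
Proof. by move=> Lf Lg Lh; rewrite -big_split /=; apply: eq_bigr => e _; rewrite ipDl. Qed.

Lemma sipZl N (k : R) f h : L2loc f -> L2loc h ->
  sip N (fun e x => k * f e x) h = k * sip N f h.
Proof. by move=> Lf Lh; rewrite mulr_sumr; apply: eq_bigr => e _; rewrite ipZl. Qed.

Lemma sipNl N f h : L2loc f -> L2loc h -> sip N (fun e x => - f e x) h = - sip N f h.
Proof.
move=> Lf Lh; rewrite -sumrN; apply: eq_bigr => e _; exact: ipNl.
Qed.

Lemma eq_sip N f g h h' : (forall e x, (tag e < N)%N -> x \in `[0, len e] -> f e x = g e x) ->
  (forall e x, (tag e < N)%N -> x \in `[0, len e] -> h e x = h' e x) ->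
  sip N f h = sip N g h'.
Proof. by move=> fg hh'; apply: eq_sum_edges => e eN; apply: eq_ip => x; auto. Qed.

Lemma L2locD f g : L2loc f -> L2loc g -> L2loc (fun e x => f e x + g e x).
Proof. by move=> Lf Lg e; exact: L2D. Qed.

Lemma L2locB f g : L2loc f -> L2loc g -> L2loc (fun e x => f e x - g e x).
Proof. by move=> Lf Lg e; exact: L2B. Qed.

Lemma L2locN f : L2loc f -> L2loc (fun e x => - f e x).
Proof. by move=> Lf e; exact: L2N. Qed.

Lemma L2locZ (k : R) f : L2loc f -> L2loc (fun e x => k * f e x).
Proof. by move=> Lf e; exact: L2Z. Qed.

Lemma le_sip_comb N f g h (k k' : R) : L2loc f -> L2loc g -> L2loc h ->
  (forall e x, x \in `[0, len e] -> f e x ^+ 2 <= k * g e x ^+ 2 + k' * h e x ^+ 2) ->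
  sip N f f <= k * sip N g g + k' * sip N h h.
Proof.
move=> Lf Lg Lh fgh; rewrite !mulr_sumr -big_split /=; apply: ler_sum => e _.
by apply: le_ip_comb => // x; exact: fgh.
Qed.

Lemma sip_young N t f g : 0 < t -> L2loc f -> L2loc g ->
  sip N (fun e x => f e x + g e x) (fun e x => f e x + g e x) <=
  (1 + t^-1) * sip N f f + (1 + t) * sip N g g.
Proof.
move=> t0 Lf Lg; rewrite !mulr_sumr -big_split /=; apply: ler_sum => e _.
exact: ip_young.
Qed.

Lemma sip_amgm N t f g : 0 < t -> L2loc f -> L2loc g ->
  2 * sip N f g <= t * sip N f f + t^-1 * sip N g g.
Proof.
move=> t0 Lf Lg; rewrite !mulr_sumr -big_split /=; apply: ler_sum => e _.
exact: ip_amgm.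
Qed.

Lemma sip_supp N M f g : (N <= M)%N ->
  (forall e x, (N <= tag e)%N -> x \in `[0, len e] -> g e x = 0) ->
  sip M f g = sip N f g.
Proof.
move=> NM g0; apply: sum_edges_widen => // e Ne.
by rewrite ipC ip0l // => x; exact: g0.
Qed.

Lemma sip_mono N M f : (N <= M)%N -> sip N f f <= sip M f f.
Proof. by move=> NM; apply: sum_edges_mono => // e; exact: ip_ge0. Qed.

Lemma rdom_widen N M f f1 f2 : (N <= M)%N -> rdom N f f1 f2 -> rdom M f f1 f2.
Proof.
move=> NM [Hf fv kf f0]; split => // e x Me; apply: f0; exact: leq_trans Me.
Qed.

Lemma rdom_form N f f1 f2 g g1 g2 : rdom N f f1 f2 -> rdom N g g1 g2 ->
  sip N f2 g = - sip N f1 g1.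
Proof.
move=> [Hf _ kf _] [Hg [v gv] _ g0]; apply/eqP; rewrite -addr_eq0 (sum_by_parts _ Hf Hg).
rewrite (sum_flux0 _ kf gv) big1 // => j _.
by rewrite (vertex_values0 gv g0) mulr0.
Qed.

Lemma influxD f1 g1 (k : R) n (i : 'I_(s n)) :
  influx (fun e x => f1 e x + k * g1 e x) i = influx f1 i + k * influx g1 i.
Proof.
case: n i => [|n] i /=; first by rewrite mulr0 addr0.
by rewrite big_split /= mulr_sumr.
Qed.

Lemma outfluxD f1 g1 (k : R) n (i : 'I_(s n)) :
  outflux (fun e x => f1 e x + k * g1 e x) i = outflux f1 i + k * outflux g1 i.
Proof. by rewrite /outflux big_split /= mulr_sumr. Qed.

Lemma H2locD (k : R) f f1 f2 g g1 g2 : H2loc f f1 f2 -> H2loc g g1 g2 ->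
  H2loc (fun e x => f e x + k * g e x) (fun e x => f1 e x + k * g1 e x)
        (fun e x => f2 e x + k * g2 e x).
Proof.
move=> Hf Hg e; have [p p1 p2] := Hf e; have [q q1 q2] := Hg e.
by split; [apply: primD => //; exact: primZ..|apply: L2D => //; exact: L2Z].
Qed.

Lemma vertex_valuesD (k : R) f g v w : vertex_values f v -> vertex_values g w ->
  vertex_values (fun e x => f e x + k * g e x) (fun n i => v n i + k * w n i).
Proof.
by move=> fv gw n i j; have [-> ->] := fv n i j; have [-> ->] := gw n i j.
Qed.

Lemma kirchhoffD (k : R) f1 g1 : kirchhoff f1 -> kirchhoff g1 ->
  kirchhoff (fun e x => f1 e x + k * g1 e x).
Proof. by move=> kf kg n i; rewrite outfluxD influxD kf kg. Qed.

Lemma rdomD (k : R) N f f1 f2 g g1 g2 : rdom N f f1 f2 -> rdom N g g1 g2 ->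
  rdom N (fun e x => f e x + k * g e x) (fun e x => f1 e x + k * g1 e x)
         (fun e x => f2 e x + k * g2 e x).
Proof.
move=> [Hf [v fv] kf f0] [Hg [w gw] kg g0]; split.
- exact: H2locD.
- by exists (fun n i => v n i + k * w n i); exact: vertex_valuesD.
- exact: kirchhoffD.
- by move=> e x Ne xe; rewrite f0 // g0 // mulr0 addr0.
Qed.

Definition form_bound (c : R) : Prop := forall N f f1 f2, rdom N f f1 f2 ->
  c * sip N f f <= sip N f1 f1.

Lemma form_bound0 : form_bound 0.
Proof. by move=> N f f1 f2 _; rewrite mul0r sip_ge0. Qed.

Definition residual (lam : R) f f2 : edge s -> R -> R := fun e x => - f2 e x - lam * f e x.

Lemma rdom_residual lam N f f1 f2 : rdom N f f1 f2 ->
  sip N (residual lam f f2) f = sip N f1 f1 - lam * sip N f f.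
Proof.
move=> Df; have [/H2loc_L2 [Lf Lf1 Lf2] _ _ _] := Df.
rewrite /residual sipDl //; [|exact: L2locN|by apply: L2locN; exact: L2locZ].
rewrite sipNl // sipNl ?sipZl //; last exact: L2locZ.
by rewrite (rdom_form Df Df) opprK.
Qed.

Lemma L2loc_residual lam f f1 f2 : H2loc f f1 f2 -> L2loc (residual lam f f2).
Proof.
by move=> /H2loc_L2 [Lf Lf1 Lf2]; apply: L2locB; [exact: L2locN|exact: L2locZ].
Qed.

(** Coercivity: the product of (H - lam) f with f is at least (c - lam) |f|^2, and the weighted
    AM-GM inequality with weight c - lam absorbs half of it. *)
Lemma apriori c lam N f f1 f2 : form_bound c -> lam < c -> rdom N f f1 f2 ->
  (c - lam) ^+ 2 * sip N f f <= sip N (residual lam f f2) (residual lam f f2).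
Proof.
move=> fb lc Df; have d0 : 0 < c - lam by rewrite subr_gt0.
have [Hf _ _ _] := Df; have [Lf Lf1 Lf2] := H2loc_L2 Hf.
have LG := L2loc_residual lam Hf.
have := sip_amgm N d0 Lf LG; rewrite sipC (rdom_residual _ Df).
have := fb _ _ _ _ Df; set a := sip N f f; set b := sip N f1 f1; set r := sip N _ _.
move=> h1 h2.
have h3 : (c - lam) * a <= (c - lam)^-1 * r by lra.
rewrite -(ler_pM2l d0) in h3; rewrite mulrA -expr2 in h3.
by apply: le_trans h3 _; rewrite mulrA divff ?mul1r // gt_eqF.
Qed.

(** Control of f' is needed besides that of f because pointwise estimates pass through
    [sobolev_bound]. *)
Lemma apriori1 c lam N f f1 f2 : form_bound c -> lam < c -> rdom N f f1 f2 ->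
  sip N f1 f1 <= (1 + (1 + `|lam|) / (c - lam) ^+ 2) *
                 sip N (residual lam f f2) (residual lam f f2).
Proof.
move=> fb lc Df; have d0 : 0 < c - lam by rewrite subr_gt0.
have [Hf _ _ _] := Df; have [Lf Lf1 Lf2] := H2loc_L2 Hf.
have LG := L2loc_residual lam Hf.
have := sip_amgm N ltr01 Lf LG; rewrite sipC (rdom_residual _ Df) invr1 !mul1r.
have := apriori fb lc Df; set a := sip N f f; set b := sip N f1 f1; set r := sip N _ _.
have a0 : 0 <= a by exact: sip_ge0.
have b0 : 0 <= b by exact: sip_ge0.
have r0 : 0 <= r by exact: sip_ge0.
move=> h1 h2.
have h4 : lam * a <= `|lam| * a by apply: ler_wpM2r => //; exact: ler_norm.
have h3 : a <= r / (c - lam) ^+ 2 by rewrite ler_pdivlMr ?exprn_gt0 // mulrC.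
have h5 : (1 + `|lam|) * a <= (1 + `|lam|) * (r / (c - lam) ^+ 2) by rewrite ler_wpM2l ?addr_ge0.
have -> : (1 + (1 + `|lam|) / (c - lam) ^+ 2) * r = r + (1 + `|lam|) * (r / (c - lam) ^+ 2).
  by rewrite mulrDl mul1r mulrAC -mulrA.
lra.
Qed.

(** Bounding all partial sums by a real number keeps the estimates away from extended reals;
    [normsq_leP] translates back. *)
Definition normsq_le f (c : R) : Prop := L2loc f /\ forall N, sip N f f <= c.

End RealKirchhoff.

(** * The lower bound *)

Section Hardy.
Variable R : realType.

(* Riccati form of Hardy's inequality: [w = - a / (2 r m b)] with [a^2 = al + m y] and
   [b^2 = be - y / m] satisfies [- w' - w^2 >= 1 / (4 r^2)] as long as [a b <= r]. *)
Lemma hardy_edge (a al be m r : R) (f f1 f2 : R -> R)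
    (w := fun y => - (Num.sqrt (al + m * y) / (2 * r * m * Num.sqrt (be - y / m)))) :
  0 < a -> 0 < m -> 0 < r -> 0 < al -> 0 < be - a / m ->
  (forall y, y \in `[0, a] -> (al + m * y) * (be - y / m) <= r ^+ 2) ->
  prim a f f1 -> prim a f1 f2 ->
  (4 * r ^+ 2)^-1 * ip a f f + (w a * f a ^+ 2 - w 0 * f 0 ^+ 2) <= ip a f1 f1.
Proof.
move=> a0 m0 r0 al0 be0 ABr pf pf1.
have A0 y : y \in `[0, a] -> 0 < al + m * y.
  by rewrite in_itv /= => /andP[y0 _]; rewrite ltr_wpDr ?mulr_ge0 // ltW.
have B0 y : y \in `[0, a] -> 0 < be - y / m.
  rewrite in_itv /= => /andP[_ ya]; apply: lt_le_trans be0 _.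
  by rewrite lerD2l lerN2 ler_pM2r ?invr_gt0.
pose sa y := Num.sqrt (al + m * y); pose sb y := Num.sqrt (be - y / m).
pose w1 y := - (2 * r * m)^-1 * (m / (2 * sa y * sb y) + sa y / (2 * m * sb y ^+ 3)).
have sa0 y : y \in `[0, a] -> 0 < sa y by move=> /A0; rewrite sqrtr_gt0.
have sb0 y : y \in `[0, a] -> 0 < sb y by move=> /B0; rewrite sqrtr_gt0.
have dsa y : y \in `[0, a] -> is_derive y 1 sa (m / (2 * sa y)).
  move=> ya; have := A0 _ ya => Ay.
  have dA : is_derive y 1 (fun y => al + m * y) m.
    have d := is_deriveD (is_derive_cst al y 1) (is_deriveZ m (is_derive_id y 1)).
    by apply: is_derive_eq d _; rewrite add0r /GRing.scale /= mulr1.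
  have d := @is_derive1_comp R Num.sqrt (fun y => al + m * y) y _ m (is_derive1_sqrt Ay) dA.
  by apply: is_derive_eq d _; rewrite mulrC.
have dsb y : y \in `[0, a] -> is_derive y 1 sb (- (2 * m * sb y)^-1).
  move=> ya; have := B0 _ ya => By.
  have dB : is_derive y 1 (fun y => be - y / m) (- m^-1).
    have d := is_deriveD (is_derive_cst be y 1) (is_deriveZ (- m^-1) (is_derive_id y 1)).
    have -> : (fun y => be - y / m) = cst be + - m^-1 \*: id.
      by apply/funext => z; rewrite !fctE -[RHS]/(be + - m^-1 * z) mulNr mulrC.
    by apply: is_derive_eq d _; rewrite add0r; exact: mulr1.
  have d := @is_derive1_comp R Num.sqrt (fun y => be - y / m) y _ _ (is_derive1_sqrt By) dB.
  by apply: is_derive_eq d _; rewrite -/(sb y); field; rewrite !gt_eqF // sb0.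
have csa y : y \in `[0, a] -> {for y, continuous sa}.
  by move=> /dsa d; apply: differentiable_continuous; apply/derivable1_diffP; case: d.
have csb y : y \in `[0, a] -> {for y, continuous sb}.
  by move=> /dsb d; apply: differentiable_continuous; apply/derivable1_diffP; case: d.
have pw : prim a w w1.
  apply: prim_is_derive => y ya.
    have sbn : sb y != 0 by rewrite gt_eqF // sb0.
    have san : sa y != 0 by rewrite gt_eqF // sa0.
    have := dsa _ ya => day; have := dsb _ ya => dby.
    have dv := is_deriveV sbn dby.
    have := is_deriveZ (- (2 * r * m)^-1) (is_deriveM day dv).
    have -> : - (2 * r * m)^-1 \*: (sa * (fun y => (sb y)^-1)) = w.
      apply/funext => z; rewrite /w -/(sa z) -/(sb z).
      rewrite -[LHS]/(- (2 * r * m)^-1 * (sa z * (sb z)^-1)).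
      by rewrite [in RHS]invfM mulNr mulrCA.
    move=> /is_derive_eq; apply.
    rewrite /w1 -[LHS]/(- (2 * r * m)^-1 *
      (sa y * (- (sb y) ^- 2 * - (2 * m * sb y)^-1) + (sb y)^-1 * (m / (2 * sa y)))).
    field.
    by rewrite san sbn !gt_eqF.
  apply: continuousM; first exact: cst_continuous.
  apply: continuousD.
    apply: continuousM; first exact: cst_continuous.
    apply: continuousV; first by rewrite !mulf_neq0 // gt_eqF ?sa0 ?sb0.
    apply: continuousM; last exact: csb.
    by apply: continuousM; [exact: cst_continuous|exact: csa].
  apply: continuousM; first exact: csa.
  apply: continuousV; first by rewrite !mulf_neq0 ?expf_neq0 // gt_eqF ?sb0.
  apply: continuousM; first exact: cst_continuous.
  apply: (@continuous_comp _ _ _ sb (fun z => z ^+ 3)); first exact: csb.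
  exact: exprn_continuous.
have a0' := ltW a0.
have pff := prim_mul a0' pf pf.
have pwff := prim_mul a0' pw pff.
have [iw Ew] := pwff.
have L2f := prim_L2 a0' pf; have L2f1 := prim_L2 a0' pf1.
have aa : a \in `[0, a] by rewrite in_itv /= lexx a0'.
have Ew' := Ew _ aa; have iff := L2_mul_itg L2f L2f.
have -> : w a * f a ^+ 2 - w 0 * f 0 ^+ 2 =
    rint a (fun x => w1 x * (f x * f x) + w x * (f1 x * f x + f x * f1 x)).
  by rewrite !expr2 Ew' addrAC subrr add0r.
rewrite /ip -rintZ // -rintD //; last exact: itgZ.
apply: le_rint; [apply: itgD => //; apply: itgZ; exact: L2_mul_itg|exact: L2_mul_itg|].
move=> y ya.
(* One term of - w' dominates 1 / (4 r^2) and the other dominates w^2, both because [sa y * sb y] is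
   at most r; hence the common factor r - [sa y * sb y] below. *)
have key : (4 * r ^+ 2)^-1 + w1 y + w y ^+ 2 <= 0.
  have say := sa0 _ ya; have sby := sb0 _ ya.
  have sab : sa y * sb y <= r.
    rewrite /sa /sb -sqrtrM; last exact/ltW/A0.
    by rewrite -[leRHS](ger0_norm (ltW r0)) -sqrtr_sqr ler_wsqrtr // ABr.
  have -> : (4 * r ^+ 2)^-1 + w1 y + w y ^+ 2 =
    - ((r - sa y * sb y) * ((4 * r ^+ 2 * sa y * sb y)^-1 +
        sa y / (4 * r ^+ 2 * m ^+ 2 * sb y ^+ 3))).
    rewrite /w1 /w -/(sa y) -/(sb y); field.
    by rewrite !gt_eqF.
  rewrite oppr_le0 mulr_ge0 ?subr_ge0 // addr_ge0 //.
    by rewrite invr_ge0 !mulr_ge0 ?sqr_ge0 // ltW.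
  by rewrite divr_ge0 ?mulr_ge0 ?sqr_ge0 ?exprn_ge0 // ltW.
have h := ler_wpM2r (sqr_ge0 (f y)) key; rewrite mul0r in h.
have h2 := sqr_ge0 (f1 y - w y * f y).
have -> : f1 y * f1 y = ((4 * r ^+ 2)^-1 * (f y * f y) +
  (w1 y * (f y * f y) + w y * (f1 y * f y + f y * f1 y))) +
  ((f1 y - w y * f y) ^+ 2 - ((4 * r ^+ 2)^-1 + w1 y + w y ^+ 2) * f y ^+ 2) by ring.
by rewrite lerDl subr_ge0; apply: le_trans h _.
Qed.

End Hardy.

Section HardyAntitree.
Variables (R : realType) (s : nat -> nat) (l : nat -> R).
Hypothesis s_gt0 : forall n, (0 < s n)%N.
Hypothesis l_gt0 : forall n, 0 < l n.
Implicit Types f g h F G : edge s -> R -> R.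

Local Notation len e := (l (tag e)).

(** Both the number of edges in the n-th bundle and the value of the weight on it. *)
Definition sphere_prod n : R := (s n * s n.+1)%:R.

(** The integral of the weight over (0, t_n), which is also the total length of the first n
    bundles. *)
Definition vol_below n : R := \sum_(0 <= k < n) sphere_prod k * l k.

(** The integral of the inverse weight over (t_n, t_K): bundles of parallel edges, connected in
    series. *)
Definition resistance n K : R := \sum_(n <= k < K) l k / sphere_prod k.

(* The products of [Cheight], at the point t_n + y and with the tail integral cut at t_K. *)
Definition weight_bound (C : R) : Prop := forall n K y, (n < K)%N -> 0 <= y <= l n ->
  (vol_below n + sphere_prod n * y) * (resistance n K - y / sphere_prod n) <= C.

Lemma sphere_prod_gt0 n : 0 < sphere_prod n.
Proof. by rewrite ltr0n muln_gt0 !s_gt0. Qed.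
Hint Resolve sphere_prod_gt0 : core.

Lemma vol_belowS n : vol_below n.+1 = vol_below n + sphere_prod n * l n.
Proof. by rewrite /vol_below big_nat_recr. Qed.

Lemma vol_below_ge0 n : 0 <= vol_below n.
Proof. by apply: sumr_ge0 => k _; rewrite mulr_ge0 // ltW. Qed.

Lemma vol_below_mono n m : (n <= m)%N -> vol_below n <= vol_below m.
Proof.
move=> /subnK <-; elim: (m - n)%N => [//|k IH].
by apply: le_trans IH _; rewrite addSn vol_belowS lerDl mulr_ge0 // ltW.
Qed.

Lemma resistance_ltn n K : (n < K)%N ->
  resistance n K = l n / sphere_prod n + resistance n.+1 K.
Proof. by move=> nK; rewrite /resistance big_ltn. Qed.

Lemma resistance_ge0 n K : 0 <= resistance n K.
Proof. by apply: sumr_ge0 => k _; rewrite divr_ge0 // ltW. Qed.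

Lemma resistance_mono n m K : (n <= m)%N -> (m <= K)%N -> resistance m K <= resistance n K.
Proof.
move=> nm mK; rewrite [leRHS](big_cat_nat nm mK) /= lerDr.
by apply: sumr_ge0 => k _; rewrite divr_ge0 // ltW.
Qed.

(** The tail is cut at S_N, where f vanishes. Since (M + eps)(P + eps) = M P + eps (M + P + eps),
    the shift raises C by at most eps times the constant in the statement. *)
Lemma hardy_eps C N f (f1 f2 : edge s -> R -> R) (eps : R) : weight_bound C -> 0 < C -> 0 < eps -> eps <= 1 ->
  rdom l N f f1 f2 ->
  (4 * (C + eps * (vol_below N + resistance 0 N + 1)))^-1 * sip l N f f <= sip l N f1 f1.
Proof.
move=> CB C0 e0 e1 [Hf [v fv] _ f0].
set T := vol_below N + resistance 0 N + 1.
have T0 : 0 < T by rewrite ltr_pwDr // addr_ge0 // ?vol_below_ge0 ?resistance_ge0.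
pose r := Num.sqrt (C + eps * T).
have r0 : 0 < r by rewrite sqrtr_gt0 addr_gt0 // mulr_gt0.
have r2 : r ^+ 2 = C + eps * T by rewrite sqr_sqrtr // ltW // addr_gt0 // mulr_gt0.
pose al n := vol_below n + eps; pose be n := resistance n N + eps.
have al0 n : 0 < al n by rewrite ltr_wpDl // vol_below_ge0.
have be0 n : 0 < be n by rewrite ltr_wpDl // resistance_ge0.
have beS n : (n < N)%N -> be n - l n / sphere_prod n = be n.+1.
  by move=> nN; rewrite /be resistance_ltn //; ring.
pose w (e : edge s) y := - (Num.sqrt (al (tag e) + sphere_prod (tag e) * y) /
  (2 * r * sphere_prod (tag e) * Num.sqrt (be (tag e) - y / sphere_prod (tag e)))).
have hedge (e : edge s) : (tag e < N)%N ->
  (4 * r ^+ 2)^-1 * ip (len e) (f e) (f e) +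
    (w e (len e) * f e (len e) ^+ 2 - w e 0 * f e 0 ^+ 2) <= ip (len e) (f1 e) (f1 e).
  move=> eN; have [pf pf1 _] := Hf e; apply: hardy_edge pf pf1 => //.
    by rewrite beS.
  move=> y; rewrite in_itv /= => /andP[y0 yl]; set n := tag e.
  have h := CB n N y eN; rewrite y0 yl in h; have {}h := h isT.
  have sp := sphere_prod_gt0 n.
  have h1 : vol_below n + sphere_prod n * y <= vol_below N.
    apply: le_trans (vol_below_mono eN); rewrite vol_belowS lerD2l.
    by rewrite ler_pM2l.
  have h2 : resistance n N - y / sphere_prod n <= resistance 0 N.
    apply: le_trans (resistance_mono (leq0n n) (ltnW eN)).
    by rewrite gerDl oppr_le0 divr_ge0 // ltW.
  rewrite r2 /al /be /T.
  have -> : (vol_below n + eps + sphere_prod n * y) * (resistance n N + eps - y / sphere_prod n) =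
    (vol_below n + sphere_prod n * y) * (resistance n N - y / sphere_prod n) +
    eps * ((vol_below n + sphere_prod n * y) + (resistance n N - y / sphere_prod n) + eps) by ring.
  by rewrite lerD // ler_pM2l // !lerD.
have gv : vertex_values l (fun e x => f e x ^+ 2) (fun n i => v n i ^+ 2).
  by move=> n i j; have [-> ->] := fv n i j.
have flux := sum_flux N w gv.
rewrite -r2 /sip mulr_sumr.
have : \sum_(e <- edges s N) ((4 * r ^+ 2)^-1 * ip (len e) (f e) (f e) +
    (w e (len e) * f e (len e) ^+ 2 - w e 0 * f e 0 ^+ 2)) <=
   \sum_(e <- edges s N) ip (len e) (f1 e) (f1 e).
  by apply: le_sum_edges => e; exact: hedge.
rewrite big_split /= flux [X in _ + (X - _)]big1 => [|j _]; last first.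
  by rewrite (vertex_values0 s_gt0 l_gt0 fv f0) expr0n mulr0.
apply: le_trans; rewrite sub0r lerDl oppr_ge0.
rewrite big_nat; apply: sumr_le0 => n /andP[_ nN]; apply: sumr_le0 => i _.
apply: mulr_le0_ge0; last exact: sqr_ge0.
rewrite subr_le0; case: n nN i => [|n] nN i.
  (* The shifted weight does not vanish at the root, but its outflux there is nonpositive, which is
     the favourable sign. *)
  apply: sumr_le0 => j _; rewrite oppr_le0 divr_ge0 ?sqrtr_ge0 //.
  by rewrite !mulr_ge0 ?sqrtr_ge0 // ltW.
(* On S_(n+1) both fluxes equal - sqrt(al / be) / (2 r s_(n+1)), evaluated at n+1: division by the
   sphere product makes the radial weight satisfy Kirchhoff's condition. *)
rewrite /outflux /= /w /= !sumr_const !card_ord mulr0 addr0 mul0r subr0.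
rewrite (beS n (ltnW nN)) -addrA (addrC eps) addrA -vol_belowS -/(al n.+1).
rewrite /sphere_prod !natrM -[leLHS]mulr_natl -[leRHS]mulr_natl.
have sn k : (s k)%:R != 0 :> R by rewrite pnatr_eq0 -lt0n.
have sb : Num.sqrt (be n.+1) != 0 by rewrite sqrtr_eq0 -ltNge.
rewrite le_eqVlt; apply/orP; left; apply/eqP; field.
by rewrite sb !sn gt_eqF.
Qed.

Lemma hardy_antitree C : weight_bound C -> 0 < C -> form_bound s l (4 * C)^-1.
Proof.
move=> CB C0 N f f1 f2 Df.
have C40 : 0 < 4 * C by rewrite mulr_gt0.
rewrite ler_pdivrMl //; apply/ler_addgt0Pr => d d0.
set T := vol_below N + resistance 0 N + 1.
have T0 : 0 < T by rewrite ltr_pwDr // addr_ge0 // ?vol_below_ge0 ?resistance_ge0.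
set b := sip l N f1 f1; have b0 : 0 <= b by exact: sip_ge0.
(* The error left by [hardy_eps] is 4 eps T b, and this choice makes it at most d; b + 1 avoids
   division by 0. *)
pose eps := Num.min 1 (d / (4 * T * (b + 1))).
have den0 : 0 < 4 * T * (b + 1) by rewrite !mulr_gt0 // ltr_pwDr.
have e0 : 0 < eps by rewrite lt_min ltr01 divr_gt0.
have e1 : eps <= 1 by rewrite ge_min lexx.
have := hardy_eps CB C0 e0 e1 Df; rewrite -/T -/b ler_pdivrMl; last first.
  by rewrite mulr_gt0 // addr_gt0 // mulr_gt0.
move=> h; apply: le_trans h _.
rewrite mulrDr mulrDl lerD2l.
have : eps <= d / (4 * T * (b + 1)) by rewrite ge_min lexx orbT.
rewrite ler_pdivlMr // => h2; apply: le_trans h2.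
rewrite [leLHS](_ : _ = eps * (4 * T * b)); last by ring.
by rewrite ler_pM2l // ler_pM2l ?mulr_gt0 // lerDl.
Qed.

End HardyAntitree.

(** * Density of the range of H_0 + k^2 *)

Section Hyperbolic.
Variable R : realType.
Variable k : R.
Hypothesis k_gt0 : 0 < k.
Implicit Types (a x : R) (g : R -> R).

Definition ch x : R := (expR (k * x) + expR (- k * x)) / 2.
(** This is sinh(k x) / k, so that [ch] and [sh] solve G'' = k^2 G with Cauchy data (1, 0) and (0,
    1). *)
Definition sh x : R := (expR (k * x) - expR (- k * x)) / (2 * k).

Lemma is_derive_expRM (c x : R) : is_derive x 1 (fun y => expR (c * y)) (c * expR (c * x)).
Proof.
have d := is_deriveZ c (is_derive_id x (1 : R)).
have := @is_derive1_comp R expR (fun y => c * y) x _ _ (is_derive_expR _) d.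
by move=> /is_derive_eq; apply; rewrite mulrC; congr (_ * _); exact: mulr1.
Qed.

Lemma is_derive_ch x : is_derive x 1 ch (k ^+ 2 * sh x).
Proof.
have := is_deriveZ (2^-1) (is_deriveD (is_derive_expRM k x) (is_derive_expRM (- k) x)).
have -> : 2^-1 \*: ((fun y => expR (k * y)) + (fun y => expR (- k * y))) = ch.
  by apply/funext => y; rewrite /ch [RHS]mulrC.
move=> /is_derive_eq; apply.
rewrite -[LHS]/(2^-1 * (k * expR (k * x) + - k * expR (- k * x))) /sh; field.
by rewrite gt_eqF.
Qed.

Lemma is_derive_sh x : is_derive x 1 sh (ch x).
Proof.
have := is_deriveZ ((2 * k)^-1) (is_deriveB (is_derive_expRM k x) (is_derive_expRM (- k) x)).
have -> : (2 * k)^-1 \*: ((fun y => expR (k * y)) - (fun y => expR (- k * y))) = sh.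
  by apply/funext => y; rewrite /sh [RHS]mulrC.
move=> /is_derive_eq; apply.
rewrite -[LHS]/((2 * k)^-1 * (k * expR (k * x) - - k * expR (- k * x))) /ch; field.
by rewrite gt_eqF.
Qed.

Lemma prim_ch a : prim a ch (fun x => k ^+ 2 * sh x).
Proof.
apply: prim_is_derive => x _; first exact: is_derive_ch.
apply: continuousM; first exact: cst_continuous.
by have d := is_derive_sh x; apply: differentiable_continuous; apply/derivable1_diffP; case: d.
Qed.

Lemma prim_sh a : prim a sh ch.
Proof.
apply: prim_is_derive => x _; first exact: is_derive_sh.
by have d := is_derive_ch x; apply: differentiable_continuous; apply/derivable1_diffP; case: d.
Qed.

Lemma ch0 : ch 0 = 1.
Proof. by rewrite /ch !mulr0 expR0; field. Qed.

Lemma sh0 : sh 0 = 0.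
Proof. by rewrite /sh !mulr0 expR0 subrr mul0r. Qed.

Lemma expRkNk x : expR (k * x) * expR (- k * x) = 1.
Proof. by rewrite -expRD mulNr subrr expR0. Qed.

Lemma chsh x : ch x ^+ 2 - k ^+ 2 * sh x ^+ 2 = 1.
Proof.
rewrite -[RHS](expRkNk x) /ch /sh; field; by rewrite gt_eqF.
Qed.

Lemma ch_ge1 x : 1 <= ch x.
Proof.
rewrite /ch ler_pdivlMr // mul1r.
have := expRkNk x; have := expR_gt0 (k * x); have := expR_gt0 (- k * x).
set p := expR (k * x); set q := expR (- k * x) => q0 p0 pq.
have := sqr_ge0 (p - q); have : 0 < p + q by rewrite addr_gt0.
nra.
Qed.

Lemma sh_gt0 x : 0 < x -> 0 < sh x.
Proof.
move=> x0; rewrite /sh divr_gt0 ?mulr_gt0 // subr_gt0 ltr_expR mulNr.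
have : 0 < k * x by rewrite mulr_gt0.
lra.
Qed.

Lemma sh_ge0 x : 0 <= x -> 0 <= sh x.
Proof. by rewrite le_eqVlt => /predU1P[<-|/sh_gt0/ltW //]; rewrite sh0. Qed.

(* Variation of constants: [voc g] solves G'' = k^2 G + g with vanishing Cauchy data at 0. *)
Definition voc g x : R :=
  sh x * rint x (fun y => ch y * g y) - ch x * rint x (fun y => sh y * g y).

Definition voc1 g x : R :=
  ch x * rint x (fun y => ch y * g y) - k ^+ 2 * (sh x * rint x (fun y => sh y * g y)).

Lemma itg_mul_prim a U u g : 0 <= a -> prim a U u -> L2 a g -> itg a (fun x => U x * g x).
Proof. by move=> a0 pU Lg; apply: L2_mul_itg => //; exact: prim_L2 pU. Qed.

Lemma prim_voc a g : 0 <= a -> L2 a g -> prim a (voc g) (voc1 g).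
Proof.
move=> a0 Lg.
have pA := prim_rint (itg_mul_prim a0 (prim_ch a) Lg).
have pB := prim_rint (itg_mul_prim a0 (prim_sh a) Lg).
have := primB (prim_mul a0 (prim_sh a) pA) (prim_mul a0 (prim_ch a) pB).
by apply: eq_prim => x _ //; rewrite /voc1; ring.
Qed.

Lemma prim_voc1 a g : 0 <= a -> L2 a g -> prim a (voc1 g) (fun x => k ^+ 2 * voc g x + g x).
Proof.
move=> a0 Lg.
have pA := prim_rint (itg_mul_prim a0 (prim_ch a) Lg).
have pB := prim_rint (itg_mul_prim a0 (prim_sh a) Lg).
have := primB (prim_mul a0 (prim_ch a) pA) (primZ (k ^+ 2) (prim_mul a0 (prim_sh a) pB)).
(* The coefficient of g is the Wronskian of [ch] and [sh], equal to 1 by [chsh]. *)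
apply: eq_prim => x _ //; rewrite /voc -[X in _ = _ + X]mul1r -(chsh x); ring.
Qed.

Lemma voc0 g : voc g 0 = 0.
Proof. by rewrite /voc !rint0; ring. Qed.

Lemma voc10 g : voc1 g 0 = 0.
Proof. by rewrite /voc1 !rint0; ring. Qed.

End Hyperbolic.

(** * Recursive solution of Kirchhoff's system and the growing radial solution *)

Section SolveKirchhoff.
Variables (R : realType) (s : nat -> nat) (l : nat -> R).
Hypothesis s0 : s 0%N = 1%N.
Hypothesis s_gt0 : forall n, (0 < s n)%N.
Hypothesis l_gt0 : forall n, 0 < l n.
Variable k : R.
Hypothesis k_gt0 : 0 < k.
Implicit Types f g h : edge s -> R -> R.

Local Notation len e := (l (tag e)).
Local Notation chl n := (ch k (l n)).
Local Notation shl n := (sh k (l n)).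

Lemma shl_gt0 n : 0 < shl n. Proof. exact: sh_gt0. Qed.

Lemma shl_neq0 n : shl n != 0. Proof. by rewrite gt_eqF // shl_gt0. Qed.

(** The coefficient of a vertex value on S_(n+1) in its own Kirchhoff equation: s_n incoming and
    s_(n+2) outgoing edges each contribute a quotient ch / sh. Being positive, it can be divided
    by. *)
Definition bal n : R := (s n)%:R * (chl n / shl n) + (s n.+2)%:R * (chl n.+1 / shl n.+1).

Lemma bal_gt0 n : 0 < bal n.
Proof.
have h m : 0 < chl m / shl m.
  by rewrite divr_gt0 ?shl_gt0 // (lt_le_trans ltr01) // ch_ge1.
by rewrite addr_gt0 // mulr_gt0 // ltr0n.
Qed.

Section Solve.
Variable g : edge s -> R -> R.

(** The part of outflux minus influx at a vertex of S_(n+1) that is due to the inhomogeneity g on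
    the adjacent edges. *)
Definition source n (j : 'I_(s n.+1)) : R :=
  (\sum_m voc k (g (mk j m)) (l n.+1)) / shl n.+1 -
  \sum_i (chl n * voc k (g (mk i j)) (l n) / shl n - voc1 k (g (mk i j)) (l n)).

(* Sums of the vertex values over the spheres.  Kirchhoff's condition at a vertex of S_(n+1)
   involves the vertex value and the sums over S_n and S_(n+2) only, because all edges of a
   bundle have the same length; this makes the system solvable by recursion. *)
Fixpoint sphere_sums n : R * R :=
  match n with
  | 0%N => (0, - \sum_(i < s 0) \sum_(j < s 1) voc k (g (mk i j)) (l 0%N))
  | m.+1 => let: (a, b) := sphere_sums m in
    (b, shl m.+1 * ((b * bal m - \sum_(j < s m.+1) source j) / (s m.+1)%:R - a / shl m))
  end.

Definition sphere_sum n : R := (sphere_sums n).1.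

Lemma sphere_sumS n : (sphere_sums n).2 = sphere_sum n.+1.
Proof. by rewrite /sphere_sum /=; case: (sphere_sums n). Qed.

Lemma sphere_sumSS n : sphere_sum n.+2 =
  shl n.+1 * ((sphere_sum n.+1 * bal n - \sum_(j < s n.+1) source j) / (s n.+1)%:R
              - sphere_sum n / shl n).
Proof.
rewrite -(sphere_sumS n) -(sphere_sumS n.+1) [LHS]/= /sphere_sum.
by case: (sphere_sums n).
Qed.

(** The root value is normalised to 0; the freedom given up is restored later by adding a multiple
    of [rad]. On S_(n+1) the formula is Kirchhoff's equation solved for the vertex value. *)
Definition vval n : 'I_(s n) -> R :=
  match n with
  | 0%N => fun=> 0
  | m.+1 => fun j => (sphere_sum m.+2 / shl m.+1 + sphere_sum m / shl m + source j) / bal m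
  end.

Arguments vval : simpl never.

(** Consistency of the recursion: the step of [sphere_sums] is the sum of the Kirchhoff equations
    over a sphere, so the values computed from the sums add up to them again. *)
Lemma sum_vval n : \sum_(i < s n) vval i = sphere_sum n.
Proof.
case: n => [|n]; rewrite /vval /=; first by rewrite big1.
rewrite -mulr_suml big_split /= sumr_const card_ord sphere_sumSS -[X in (X + _) / _]mulr_natl.
field; rewrite !shl_neq0 pnatr_eq0 -lt0n s_gt0 /= gt_eqF //.
exact: bal_gt0.
Qed.

(** The derivative at the origin of the edge for which [sol] takes the prescribed vertex value at
    the terminus. *)
Definition slope (e : edge s) : R :=
  (vval (tagged e).2 - vval (tagged e).1 * chl (tag e) + voc k (g e) (len e)) / shl (tag e).

Definition sol (e : edge s) x : R :=
  vval (tagged e).1 * ch k x + slope e * sh k x - voc k (g e) x.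

Definition sol1 (e : edge s) x : R :=
  vval (tagged e).1 * (k ^+ 2 * sh k x) + slope e * ch k x - voc1 k (g e) x.

Definition sol2 (e : edge s) x : R := k ^+ 2 * sol e x - g e x.

Lemma sol_vertex : vertex_values l sol vval.
Proof.
move=> n i j; rewrite /sol /= ch0 sh0 // voc0; split; first by ring.
by rewrite /slope /=; field; exact: shl_neq0.
Qed.

Lemma sol_H2loc : L2loc l g -> H2loc l sol sol1 sol2.
Proof.
move=> Lg e; have le0 := ltW (l_gt0 (tag e)).
have pc := prim_ch k_gt0 (len e); have ps := prim_sh k_gt0 (len e).
have p : prim (len e) (sol e) (sol1 e).
  have pv := prim_voc k_gt0 le0 (Lg e).
  exact: primB (primD (primZ (vval (tagged e).1) pc) (primZ (slope e) ps)) pv.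
split=> //.
- have pv := prim_voc1 k_gt0 le0 (Lg e).
  have := primB (primD (primZ (vval (tagged e).1) (primZ (k ^+ 2) ps))
    (primZ (slope e) pc)) pv.
  by apply: eq_prim => x _ //; rewrite /sol2 /sol; ring.
- by apply: L2B => //; apply: L2Z; exact: prim_L2 p.
Qed.

Lemma outflux_sol n (i : 'I_(s n)) : outflux sol1 i =
  (sphere_sum n.+1 - (s n.+1)%:R * (vval i * chl n)
   + \sum_j voc k (g (mk i j)) (l n)) / shl n.
Proof.
rewrite /outflux -sum_vval mulr_natl -[X in _ *+ X]card_ord -sumr_const -sumrB -big_split /=.
rewrite mulr_suml; apply: eq_bigr => j _.
by rewrite /sol1 /slope /= ch0 sh0 // voc10 /=; ring.
Qed.

Lemma influx_sol n (j : 'I_(s n.+1)) : influx l sol1 j =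
  - (sphere_sum n / shl n) + (s n)%:R * (chl n / shl n * vval j) +
  \sum_i (chl n * voc k (g (mk i j)) (l n) / shl n - voc1 k (g (mk i j)) (l n)).
Proof.
rewrite /= -sum_vval [X in X + _]addrC mulr_natl -[X in _ *+ X]card_ord -sumr_const.
rewrite mulr_suml -sumrB -big_split /=.
apply: eq_bigr => i _; rewrite /sol1 /slope /=.
have -> : vval i * (k ^+ 2 * shl n) = vval i * (chl n ^+ 2 - 1) / shl n.
  by rewrite -(chsh k_gt0 (l n)); field; exact: shl_neq0.
field; exact: shl_neq0.
Qed.

Lemma sol_kirchhoff : kirchhoff l sol1.
Proof.
case=> [|n] i.
  rewrite outflux_sol /= [vval i]/(0 : R) mul0r mulr0 subr0.
  suff -> : sphere_sum 1 + \sum_j voc k (g (mk i j)) (l 0%N) = 0 by rewrite mul0r.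
  rewrite -(sphere_sumS 0) /= (big_pred1 i) ?addNr // => i'; apply/esym/eqP/val_inj.
  have h : forall m (a b : 'I_m), m = 1%N -> val a = val b.
    by move=> m a b E; subst m; rewrite !ord1.
  exact: h.
rewrite outflux_sol influx_sol.
have Ev : vval i * bal n = sphere_sum n.+2 / shl n.+1 + sphere_sum n / shl n + source i.
  by rewrite /vval mulfVK // gt_eqF // bal_gt0.
apply/eqP; rewrite -subr_eq0; apply/eqP.
transitivity ((sphere_sum n.+2 / shl n.+1 + sphere_sum n / shl n + source i) - vval i * bal n).
  by rewrite /source /bal; field; rewrite !shl_neq0.
by rewrite Ev subrr.
Qed.

Definition radial n : Prop := forall e e' : edge s, tag e = n -> tag e' = n -> g e = g e'.

Lemma source_radial n (j j' : 'I_(s n.+1)) : radial n -> radial n.+1 -> source j = source j'.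
Proof.
move=> r0 r1; rewrite /source; congr (_ / _ - _).
  by apply: eq_bigr => i _; rewrite (r1 (mk j i) (mk j' i)).
by apply: eq_bigr => i _; rewrite (r0 (mk i j) (mk i j')).
Qed.

(** Radiality of g on the two bundles adjacent to S_(n+1) is enough: whatever happened nearer to the
    root enters only through sphere sums, which are the same for all vertices of the sphere. *)
Lemma vval_radial n (j j' : 'I_(s n.+1)) : radial n -> radial n.+1 -> vval j = vval j'.
Proof. by move=> r0 r1; rewrite /vval (source_radial j j'). Qed.

Lemma outflux_radial n (j j' : 'I_(s n.+1)) : radial n -> radial n.+1 ->
  outflux sol1 j = outflux sol1 j'.
Proof.
move=> r0 r1; rewrite !outflux_sol (vval_radial j j') //; congr ((_ + _) / _).
by apply: eq_bigr => i _; rewrite (r1 (mk j i) (mk j' i)).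
Qed.

End Solve.

Local Notation mun := (sphere_prod R s).

(** Transfer of the pair (u, mu u') across one bundle. The total flux mu u', not u', is continuous
    across a sphere by Kirchhoff's condition; at the root it is 0. *)
Fixpoint rad_data n : R * R :=
  match n with
  | 0%N => (1, 0)
  | m.+1 => let: (a, p) := rad_data m in
    (a * chl m + p / mun m * shl m, mun m * (a * (k ^+ 2 * shl m)) + p * chl m)
  end.

Definition rad_val n : R := (rad_data n).1.
Definition rad_flux n : R := (rad_data n).2.

Definition rad (e : edge s) x : R :=
  rad_val (tag e) * ch k x + rad_flux (tag e) / mun (tag e) * sh k x.

Definition rad1 (e : edge s) x : R :=
  rad_val (tag e) * (k ^+ 2 * sh k x) + rad_flux (tag e) / mun (tag e) * ch k x.

Lemma rad_valS n : rad_val n.+1 = rad_val n * chl n + rad_flux n / mun n * shl n.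
Proof. by rewrite /rad_val /rad_flux /=; case: (rad_data n). Qed.

Lemma rad_fluxS n : rad_flux n.+1 = mun n * (rad_val n * (k ^+ 2 * shl n)) + rad_flux n * chl n.
Proof. by rewrite /rad_val /rad_flux /=; case: (rad_data n). Qed.

Lemma rad_ge n : 1 <= rad_val n /\ 0 <= rad_flux n.
Proof.
elim: n => [|n [a1 p0]]; first by rewrite /rad_val /rad_flux /=.
have c1 := ch_ge1 k (l n); have s1 := shl_gt0 n; have m0 := sphere_prod_gt0 R s_gt0 n.
rewrite rad_valS rad_fluxS; split.
  rewrite -[leLHS]addr0; apply: lerD.
    exact: mulr_ege1.
  by apply: mulr_ge0; [apply: divr_ge0 => //; exact: ltW|exact: ltW].
have a0 := le_trans ler01 a1; have c0 := le_trans ler01 c1.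
apply: addr_ge0; last exact: mulr_ge0.
apply: mulr_ge0; first exact: ltW.
by apply: mulr_ge0 => //; apply: mulr_ge0; [exact: sqr_ge0|exact: ltW].
Qed.

Lemma rad_ge1 (e : edge s) x : x \in `[0, len e] -> 1 <= rad e x.
Proof.
rewrite in_itv /= => /andP[x0 _]; have [a1 p0] := rad_ge (tag e).
have m0 := sphere_prod_gt0 R s_gt0 (tag e).
rewrite -[leLHS]addr0; apply: lerD.
  by rewrite mulr_ege1 // ch_ge1.
by apply: mulr_ge0; [apply: divr_ge0 => //; exact: ltW|exact: sh_ge0].
Qed.

Lemma rad_H2loc : H2loc l rad rad1 (fun e x => k ^+ 2 * rad e x).
Proof.
move=> e; have le0 := ltW (l_gt0 (tag e)).
have pc := prim_ch k_gt0 (len e); have ps := prim_sh k_gt0 (len e).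
have p := primD (primZ (rad_val (tag e)) pc) (primZ (rad_flux (tag e) / mun (tag e)) ps).
split=> //.
- have := primD (primZ (rad_val (tag e)) (primZ (k ^+ 2) ps))
    (primZ (rad_flux (tag e) / mun (tag e)) pc).
  by apply: eq_prim => x _ //; rewrite /rad; ring.
- by apply: L2Z; exact: prim_L2 p.
Qed.

Lemma rad_vertex : vertex_values l rad (fun n _ => rad_val n).
Proof.
move=> n i j; rewrite /rad /= ch0 sh0 // rad_valS; split => //.
by rewrite mulr0 addr0 mulr1.
Qed.

Lemma rad_kirchhoff : kirchhoff l rad1.
Proof.
have sn m : (s m)%:R != 0 :> R by rewrite pnatr_eq0 -lt0n.
have out n (i : 'I_(s n)) : outflux rad1 i = rad_flux n / (s n)%:R.
  rewrite /outflux /rad1 /= sumr_const card_ord ch0 sh0 // -[LHS]mulr_natl.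
  by rewrite /sphere_prod natrM; field; rewrite !sn.
move=> [|n] i; rewrite out /=; first by rewrite /rad_flux /= mul0r.
rewrite /rad1 /= sumr_const card_ord -[RHS]mulr_natl rad_fluxS.
by rewrite /sphere_prod natrM; field; rewrite !sn.
Qed.

End SolveKirchhoff.

Lemma sqrB_le2 (R : realDomainType) (x y : R) : (x - y) ^+ 2 <= 2 * x ^+ 2 + 2 * y ^+ 2.
Proof.
rewrite -subr_ge0 [leRHS](_ : _ = (x + y) ^+ 2) ?sqr_ge0 //; ring.
Qed.

(** * Approximate solvability at - k^2 *)

Section Density.
Variables (R : realType) (s : nat -> nat) (l : nat -> R).
Hypothesis s0 : s 0%N = 1%N.
Hypothesis s_gt0 : forall n, (0 < s n)%N.
Hypothesis l_gt0 : forall n, 0 < l n.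
Hypothesis vol_infty : forall A : R, exists N, A <= vol_below s l N.
Implicit Types f g h : edge s -> R -> R.

Local Notation len e := (l (tag e)).
Let len0 (e : edge s) : 0 <= len e. Proof. exact: ltW. Qed.

Lemma sum_edges_if (V : nmodType) (N' N : nat) (F G : edge s -> V) : (N' <= N)%N ->
  \sum_(e <- edges s N) (if (tag e < N')%N then F e else G e) =
  \sum_(e <- edges s N') F e + \sum_(e <- edges s N) (if (tag e < N')%N then 0 else G e).
Proof.
move=> NN.
transitivity (\sum_(e <- edges s N) ((if (tag e < N')%N then F e else 0) +
                                    (if (tag e < N')%N then 0 else G e))).
  by apply: eq_bigr => e _; case: ifP; rewrite ?addr0 ?add0r.
rewrite big_split; congr (_ + _) => /=.
rewrite (sum_edges_widen NN); last by move=> e; rewrite leqNgt => /negbTE ->.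
by apply: eq_sum_edges => e ->.
Qed.

Definition tail_from N' g : edge s -> R -> R :=
  fun e => if (tag e < N')%N then fun=> 0 else g e.

Lemma ip_cst0 a (u : R -> R) : ip a (fun=> 0) u = 0.
Proof. exact: ip0l. Qed.

Lemma L2loc_tail N' g : L2loc l g -> L2loc l (tail_from N' g).
Proof. by move=> Lg e; rewrite /tail_from; case: ifP => _; [exact: L2_cst|exact: Lg]. Qed.

(** The partial sums of the norm increase to a finite supremum, so one of them comes within d of it
    and the remaining bundles carry at most d. *)
Lemma tail_small g c d : normsq_le l g c -> 0 < d ->
  exists N', forall M, sip l M (tail_from N' g) (tail_from N' g) <= d.
Proof.
move=> [Lg gc] d0.
have hs : has_sup (range (fun N => sip l N g g)).
  split; first by exists (sip l 0 g g), 0%N.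
  by exists c => _ [N _ <-].
have [_ [N' _ <-] hN'] := sup_adherent d0 hs.
exists N' => M.
have tE (e : edge s) : ip (len e) (tail_from N' g e) (tail_from N' g e) =
    if (tag e < N')%N then 0 else ip (len e) (g e) (g e).
  by rewrite /tail_from; case: ifP => _ //; exact: ip_cst0.
pose K := maxn M N'.
apply: (@le_trans _ _ (sip l K (tail_from N' g) (tail_from N' g))).
  by apply: sip_mono => //; exact: leq_maxl.
have NK : (N' <= K)%N by exact: leq_maxr.
have := sum_edges_if (fun e => ip (len e) (g e) (g e)) (fun e => ip (len e) (g e) (g e)) NK.
under eq_bigr => e _ do rewrite if_same.
rewrite -/(sip l K g g) -/(sip l N' g g) => E.
have -> : sip l K (tail_from N' g) (tail_from N' g) = sip l K g g - sip l N' g g.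
  by rewrite E addrAC subrr add0r; apply: eq_bigr => e _; rewrite tE.
have hK : sip l K g g <= sup (range (fun N => sip l N g g)).
  by apply: ub_le_sup; [case: hs|exists K].
lra.
Qed.

Lemma sum_len N : \sum_(e <- edges s N) len e = vol_below s l N.
Proof.
elim: N => [|N IH]; first by rewrite sum_edges0 /vol_below big_nil.
rewrite sum_edgesS vol_belowS IH /=; congr (_ + _).
under eq_bigr do rewrite sumr_const card_ord.
by rewrite sumr_const card_ord -mulrnA -[LHS]mulr_natl mulnC.
Qed.

Section Negative.
Variable k : R.
Hypothesis k_gt0 : 0 < k.

Local Notation u := (rad (s := s) l k).

(* [g] is modified by a constant [c] on the bundles N', ..., N - 1 so that it becomes orthogonal
   to the growing radial solution; the solution of Kirchhoff's system can then be cut off at S_N.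
   Since the volume is infinite, [c] costs arbitrarily little. *)
Lemma dense_range_neg g c0 eps : normsq_le l g c0 -> 0 < eps ->
  exists N f f1 f2, rdom l N f f1 f2 /\ forall M,
    sip l M (fun e x => residual (- k ^+ 2) f f2 e x - g e x)
            (fun e x => residual (- k ^+ 2) f f2 e x - g e x) <= eps.
Proof.
move=> gc eps0; have [Lg _] := gc.
pose d := eps / 4; have d0 : 0 < d by rewrite divr_gt0.
have [N' hN'] := tail_small gc d0.
have [Lu Lu1 _] := H2loc_L2 l_gt0 (rad_H2loc (s := s) l_gt0 k_gt0).
pose I0 := sip l N' g u.
(* The volume V of the modified bundles is made so large that c^2 V <= I0^2 / V <= d for the
   constant c = - I0 / U chosen below, where U >= V; the summand 1 keeps V positive. *)
have [N1 hN1] := vol_infty (vol_below s l N' + (I0 ^+ 2 / d + 1)).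
(* With N a successor larger than N', both bundles adjacent to S_N carry a radial right-hand side,
   as [vval_radial] requires. *)
pose N := N1.+1; have hN := le_trans hN1 (vol_below_mono s l_gt0 (leqnSn N1)).
pose V := vol_below s l N - vol_below s l N'.
have hV : I0 ^+ 2 / d + 1 <= V by rewrite /V; lra.
have V0 : 0 < V by apply: lt_le_trans hV; rewrite ltr_pwDr // divr_ge0 ?sqr_ge0 // ltW.
have NN : (N' < N)%N.
  rewrite ltnNge; apply/negP => NN.
  have := vol_below_mono s l_gt0 NN; move: V0; rewrite /V; lra.
have VE : \sum_(e <- edges s N) (if (tag e < N')%N then 0 else len e) = V.
  have := sum_edges_if (fun e : edge s => len e) (fun e => len e) (ltnW NN).
  under eq_bigr => e _ do rewrite if_same.
  by rewrite !sum_len /V => ->; rewrite addrAC subrr add0r.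
pose U := \sum_(e <- edges s N) (if (tag e < N')%N then 0 else ip (len e) (fun=> 1) (u e)).
have VU : V <= U.
  rewrite -VE; apply: ler_sum => e _; case: ifP => // _.
  rewrite -[leLHS]mul1r -rint_cst // /ip; apply: le_rint; [exact: itg_cst| |].
    by apply: L2_mul_itg => //; exact: L2_cst.
  by move=> x xe; rewrite mul1r; exact: rad_ge1.
have U0 : 0 < U := lt_le_trans V0 VU.
pose c := - I0 / U.
pose h : edge s -> R -> R := fun e => if (tag e < N')%N then g e else fun=> c.
have Lh : L2loc l h by move=> e; rewrite /h; case: ifP => _; [exact: Lg|exact: L2_cst].
have hu : sip l N h u = 0.
  have -> : sip l N h u = \sum_(e <- edges s N) (if (tag e < N')%N then ip (len e) (g e) (u e)
      else c * ip (len e) (fun=> 1) (u e)).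
    apply: eq_bigr => e _; rewrite /h; case: ifP => // _.
    by rewrite -ipZl //; [apply: eq_ip => // x _; rewrite mulr1|exact: L2_cst].
  rewrite (sum_edges_if _ _ (ltnW NN)) -/(sip l N' g u) -/I0.
  rewrite [X in _ + X](_ : _ = c * U); first by rewrite /c divfK ?gt_eqF // subrr.
  by rewrite mulr_sumr; apply: eq_bigr => e _; case: ifP => _ //; rewrite mulr0.
have rh n : (N' <= n)%N -> radial h n.
  by move=> N'n e e' en e'n; rewrite /h en e'n ltnNge N'n.
have rN1 : radial h N1 by apply: rh; rewrite -ltnS.
have rN : radial h N1.+1 by apply: rh; rewrite ltnW.
have Hsol := sol_H2loc l_gt0 k_gt0 Lh.
have Hu := rad_H2loc (s := s) l_gt0 k_gt0.
have sv := sol_vertex l_gt0 k_gt0 h; have uv := rad_vertex (s := s) l k.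
have ks := sol_kirchhoff s0 s_gt0 l_gt0 k_gt0 h.
have ku := rad_kirchhoff l s_gt0 k.
pose j0 : 'I_(s N1.+1) := Ordinal (s_gt0 N1.+1).
have [aN _] := rad_ge s_gt0 l_gt0 k_gt0 N1.+1.
have aN0 : rad_val s l k N1.+1 != 0 by rewrite gt_eqF // (lt_le_trans ltr01).
(* This multiple of the radial solution cancels the vertex value at one vertex of S_N, hence at all
   of them, since these values agree. *)
pose al := - vval l k h j0 / rad_val s l k N1.+1.
pose F e x := sol l k h e x + al * u e x.
pose F1 e x := sol1 l k h e x + al * rad1 l k e x.
pose F2 e x := sol2 l k h e x + al * (k ^+ 2 * u e x).
pose w n (i : 'I_(s n)) := vval l k h i + al * rad_val s l k n.
have HF : H2loc l F F1 F2 by exact: H2locD.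
have Fw : vertex_values l F w by exact: vertex_valuesD.
have kF : kirchhoff l F1 by exact: kirchhoffD.
have wN (j : 'I_(s N)) : w N j = 0.
  by rewrite /w /N (vval_radial l k j j0 rN1 rN) /al divfK // subrr.
have wN' n (nE : N = n) : forall j : 'I_(s n), w n j = 0 by case: n / nE; exact: wN.
(* Green's identity for F and u on the first N bundles: as h is orthogonal to u and F vanishes on
   S_N, the influxes of F into S_N sum to 0; they are all equal, so each is 0. *)
have inN (j : 'I_(s N)) : influx l F1 j = 0.
  have b1 := sum_by_parts l_gt0 N HF Hu.
  have b2 := sum_by_parts l_gt0 N Hu HF.
  rewrite (sum_flux0 _ kF uv) in b1; rewrite (sum_flux0 _ ku Fw) in b2.
  rewrite big1 in b2; last by move=> i _; rewrite wN mulr0.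
  have [LF LF1 LF2] := H2loc_L2 l_gt0 HF.
  have E2 : sip l N F2 u = sip l N (fun e x => k ^+ 2 * u e x) F.
    have -> : sip l N F2 u = sip l N (fun e x => k ^+ 2 * F e x + - h e x) u.
      by apply: eq_sip => // e x _ _; rewrite /F2 /F /sol2; ring.
    rewrite sipDl //; [|exact: L2locZ|exact: L2locN].
    rewrite sipNl // hu oppr0 addr0 sipZl // sipZl // sipC //.
  rewrite E2 (sipC l N F1) b2 in b1.
  move/esym: b1; rewrite -mulr_suml => /eqP; rewrite mulf_eq0 (negbTE aN0) orbF.
  have cst (i : 'I_(s N)) : influx l F1 i = influx l F1 j.
    rewrite -!kF /F1 !outfluxD (outflux_radial s_gt0 l_gt0 k_gt0 i j rN1 rN).
    by congr (_ + _ * _).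
  under eq_bigr => i _ do rewrite cst.
  rewrite sumr_const card_ord -mulr_natl mulf_eq0 pnatr_eq0 => /orP[/eqP sz|/eqP //].
  by have := s_gt0 N1.+1; rewrite sz.
pose cut (f : edge s -> R -> R) : edge s -> R -> R :=
  fun e => if (tag e < N)%N then f e else fun=> 0.
exists N, (cut F), (cut F1), (cut F2).
have rd : rdom l N (cut F) (cut F1) (cut F2).
  split.
  - move=> e; rewrite /cut; case: ifP => _; first exact: HF.
    by split; [exact: prim_cst|exact: prim_cst|exact: L2_cst].
  - exists (fun n i => if (n < N)%N then w n i else 0) => n i j; rewrite /cut /=.
    have [e1 e2] := Fw n i j; have [nN|nN] := ltnP n N; last first.
      by rewrite ltnNge (leq_trans nN).
    split=> //; rewrite e2; case: ltnP => // Nn.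
    have nE : N = n.+1 by apply/eqP; rewrite eqn_leq nN Nn.
    exact: wN'.
  - have out n (i : 'I_(s n)) : outflux (cut F1) i = if (n < N)%N then outflux F1 i else 0.
      by rewrite /outflux /cut /=; case: ltnP => // _; rewrite big1.
    (* The sphere S_N still receives the flux of bundle N - 1, while its outflux has been cut; this
       is the case where [inN] is needed. *)
    have inf n (i : 'I_(s n)) : influx l (cut F1) i = if (n < N.+1)%N then influx l F1 i else 0.
      case: n i => [|n] i /=; first by [].
      by rewrite /cut /= ltnS; case: ltnP => // _; rewrite big1.
    move=> n i; rewrite out inf kF ltnS; case: (ltngtP n N) => // nN.
    have inN' m (mE : N = m) : forall j : 'I_(s m), influx l F1 j = 0 by case: m / mE; exact: inN.
    by rewrite inN'.
  - by move=> e x; rewrite leqNgt /cut => /negbTE ->.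
split=> // M.
(* The residual minus g vanishes below N', is c - g on the bundles N', ..., N - 1 and is - g
   afterwards. Hence it is controlled by [cf] and the tail of g, each of square norm at most d = eps
   / 4 and each counted twice. *)
pose cf : edge s -> R -> R := fun e => if (N' <= tag e < N)%N then fun=> c else fun=> 0.
have Lcf : L2loc l cf by move=> e; rewrite /cf; case: ifP => _; exact: L2_cst.
have LD : L2loc l (fun e x => residual (- k ^+ 2) (cut F) (cut F2) e x - g e x).
  apply: L2locB => //; case: rd => HH _ _ _; exact: (L2loc_residual l_gt0 _ HH).
have := le_sip_comb M (k := 2) (k' := 2) LD Lcf (L2loc_tail N' Lg).
move=> /(_ _) /le_trans; apply.
  move=> e x xe; rewrite /residual /cut /cf /tail_from.
  case: (ltnP (tag e) N) => eN; last first.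
    have N'e := leq_trans (ltnW NN) eN.
    rewrite andbF ltnNge N'e /=.
    by rewrite [X in X ^+ 2 <= _](_ : _ = 0 - g e x) ?sqrB_le2 //; ring.
  rewrite andbT /F2 /sol2 -/(F e x).
  have -> : - (k ^+ 2 * sol l k h e x - h e x + al * (k ^+ 2 * u e x)) - - k ^+ 2 * F e x - g e x =
     h e x - g e x by rewrite /F; ring.
  rewrite /h; case: (ltnP (tag e) N') => _; first by rewrite subrr expr0n mulr0 addr0.
  exact: sqrB_le2.
have cfV : sip l M cf cf <= c ^+ 2 * V.
  apply: (@le_trans _ _ (sip l (maxn M N) cf cf)).
    by apply: sip_mono => //; exact: leq_maxl.
  rewrite (@sip_supp _ _ _ N) ?leq_maxr //; last first.
    by move=> e x Ne _; rewrite /cf [(tag e < N)%N]ltnNge Ne andbF.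
  rewrite -VE mulr_sumr; apply: le_sum_edges => e eN.
  rewrite /cf eN andbT ltnNge; case: ifP => _; last by rewrite ip_cst0 mulr0.
  by rewrite /ip rint_cst // expr2.
have cV : c ^+ 2 * V <= d.
  have h1 : I0 ^+ 2 <= V * d.
    rewrite -ler_pdivrMr //; lra.
  have h2 : V ^+ 2 <= U ^+ 2 by rewrite lerXn2r ?nnegrE // ltW.
  rewrite /c expr_div_n sqrrN mulrAC ler_pdivrMr ?exprn_gt0 //.
  apply: (@le_trans _ _ (V * d * V)); first by rewrite ler_pM2r.
  by rewrite mulrAC -expr2 mulrC ler_pM2l.
have := hN' M; rewrite /d in cV d0 *; lra.
Qed.

End Negative.
End Density.

(** * Neumann series up to the lower bound of the form *)

Section Resolvent.
Variables (R : realType) (s : nat -> nat) (l : nat -> R).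
Hypothesis s0 : s 0%N = 1%N.
Hypothesis s_gt0 : forall n, (0 < s n)%N.
Hypothesis l_gt0 : forall n, 0 < l n.
Hypothesis vol_infty : forall A : R, exists N, A <= vol_below s l N.
Variables (b lam : R).
Hypothesis fb : form_bound s l b.
Hypothesis lamb : lam < b.
Implicit Types f g h : edge s -> R -> R.

Local Notation len e := (l (tag e)).
Let len0 (e : edge s) : 0 <= len e. Proof. exact: ltW. Qed.

Definition defect g f f2 : edge s -> R -> R := fun e x => g e x - residual lam f f2 e x.

Lemma L2loc_defect N g f f1 f2 : L2loc l g -> rdom l N f f1 f2 -> L2loc l (defect g f f2).
Proof. by move=> Lg [HH _ _ _]; apply: L2locB => //; exact: (L2loc_residual l_gt0 _ HH). Qed.

(* One step of the Neumann series that moves the spectral parameter from [- k^2] to [lam]. *)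
Lemma defect_step : exists2 rho : R, 0 <= rho < 1 & forall g c, 0 < c -> normsq_le l g c ->
  exists N f f1 f2, rdom l N f f1 f2 /\ normsq_le l (defect g f f2) (rho * c).
Proof.
pose k := 1 + `|lam|; have k1 : 1 <= k by rewrite lerDl.
have k0 : 0 < k by exact: lt_le_trans ltr01 k1.
pose lam1 := - k ^+ 2.
have ll : lam1 < lam.
  have h1 : `|lam| < k by rewrite /k ltrDr.
  have h2 : k <= k ^+ 2 by rewrite expr2 ler_peMl // ltW.
  have := ler_norm (- lam); rewrite normrN /lam1; lra.
pose d1 := b - lam1; have d10 : 0 < d1 by rewrite subr_gt0 (lt_trans ll).
(* By [apriori] at lam1, q bounds the effect of (lam - lam1) times the inverse of H - lam1; it is
   below 1 because lam < b. *)
pose q := (lam - lam1) / d1.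
have q0 : 0 < q by rewrite divr_gt0 // subr_gt0.
have q1 : q < 1 by rewrite ltr_pdivrMr // mul1r ltrD2r.
(* Young's parameter with (1 + t) q = (1 + q) / 2, still below 1. It is spent twice, on the residual
   at lam1 and on the new defect, which produces the factor q2^2. *)
pose t := (1 - q) / (2 * q); have t0 : 0 < t by rewrite divr_gt0 ?subr_gt0 // mulr_gt0.
pose q2 := (1 + q) / 2.
have tq : (1 + t) * q = q2 by rewrite /t /q2; field; exact: lt0r_neq0.
have q20 : 0 <= q2 by rewrite /q2; lra.
have q21 : q2 ^+ 2 < 1 by rewrite expr_lt1 // /q2; lra.
pose rho := (1 + q2 ^+ 2) / 2.
pose K := (1 + t^-1) * (1 + (1 + t) * q ^+ 2).
have K0 : 0 < K.
  have t' : 0 <= t^-1 by rewrite invr_ge0 ltW.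
  have tq' : 0 <= (1 + t) * q ^+ 2 by rewrite mulr_ge0 ?sqr_ge0 // addr_ge0 // ltW.
  by rewrite /K; apply: mulr_gt0; rewrite ltr_pwDl.
(* The accuracy asked of the approximate solution, such that the total factor eta K + q2^2 is
   exactly rho. *)
pose eta := (rho - q2 ^+ 2) / K.
have eta0 : 0 < eta by rewrite divr_gt0 // /rho; lra.
exists rho; first by rewrite /rho; have := sqr_ge0 q2; lra.
move=> g c c0 gc; have [Lg gN] := gc.
have [N [f [f1 [f2 [Df hM]]]]] :=
  dense_range_neg s0 s_gt0 l_gt0 vol_infty k0 gc (mulr_gt0 eta0 c0).
exists N, f, f1, f2; split => //; split; first exact: L2loc_defect Df.
move=> M; have [HH _ _ f0] := Df; have [Lf Lf1 Lf2] := H2loc_L2 l_gt0 HH.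
have LG := L2loc_residual l_gt0 lam1 HH.
set r1 := residual lam1 f f2 in LG.
have LrG : L2loc l (fun e x => r1 e x - g e x) by exact: L2locB.
have hr : sip l N r1 r1 <= (1 + t^-1) * (eta * c) + (1 + t) * c.
  have := sip_young N t0 LrG Lg.
  have -> : sip l N (fun e x => r1 e x - g e x + g e x) (fun e x => r1 e x - g e x + g e x) =
     sip l N r1 r1 by apply: eq_sip => e x _ _; rewrite subrK.
  move=> h; apply: le_trans h _; apply: lerD; rewrite ler_wpM2l //.
  - by rewrite addr_ge0 // invr_ge0 ltW.

  - by rewrite addr_ge0 // ltW.
have hf : sip l M f f <= d1^-1 ^+ 2 * sip l N r1 r1.
  apply: (@le_trans _ _ (sip l N f f)).
    have [NM|/ltnW MN] := leqP N M; last exact: sip_mono.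
    by rewrite (@sip_supp _ _ _ N).
  have := apriori s_gt0 l_gt0 fb (lt_trans ll lamb) Df; rewrite -/d1 -/r1 => h.
  by rewrite exprVn ler_pdivlMl // exprn_gt0.
have L1 : L2loc l (fun e x => - (r1 e x - g e x)) by exact: L2locN.
have L2f : L2loc l (fun e x => (lam - lam1) * f e x) by exact: L2locZ.
have := sip_young M t0 L1 L2f.
have -> : sip l M (fun e x => - (r1 e x - g e x) + (lam - lam1) * f e x)
                (fun e x => - (r1 e x - g e x) + (lam - lam1) * f e x) =
          sip l M (defect g f f2) (defect g f f2).
  by apply: eq_sip => e x _ _; rewrite /defect /r1 /residual; ring.
move=> h; apply: le_trans h _.
have h1 : sip l M (fun e x => - (r1 e x - g e x)) (fun e x => - (r1 e x - g e x)) <= eta * c.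
  by apply: le_trans (hM M); rewrite sipNl // sipC sipNl // opprK.
have h2 : sip l M (fun e x => (lam - lam1) * f e x) (fun e x => (lam - lam1) * f e x) <=
    q ^+ 2 * ((1 + t^-1) * (eta * c) + (1 + t) * c).
  rewrite sipZl // sipC sipZl // mulrA -expr2.
  have -> : q ^+ 2 = (lam - lam1) ^+ 2 * d1^-1 ^+ 2 by rewrite -exprMn.
  rewrite -mulrA ler_wpM2l ?sqr_ge0 //; apply: le_trans hf _.
  by rewrite ler_wpM2l ?sqr_ge0.
have ti : 0 <= 1 + t^-1 by rewrite addr_ge0 // invr_ge0 ltW.
have tp : 0 <= 1 + t by rewrite addr_ge0 // ltW.
apply: le_trans (lerD (ler_wpM2l ti h1) (ler_wpM2l tp h2)) _.
have -> : (1 + t^-1) * (eta * c) + (1 + t) * (q ^+ 2 * ((1 + t^-1) * (eta * c) + (1 + t) * c)) =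
  (eta * K + ((1 + t) * q) ^+ 2) * c by rewrite /K; ring.
rewrite tq /eta divfK ?gt_eqF // subrK; exact: lexx.
Qed.

Lemma defectD g f f2 h h2 :
  defect g (fun e x => f e x + 1 * h e x) (fun e x => f2 e x + 1 * h2 e x) =
  defect (defect g f f2) h h2.
Proof. by apply/funext => e; apply/funext => x; rewrite /defect /residual; ring. Qed.

(** Each step solves approximately for the current defect; by [defectD] the corrections add up, and
    the defect decays geometrically. *)
Lemma dense_range g c eps : normsq_le l g c -> 0 < eps ->
  exists N f f1 f2, rdom l N f f1 f2 /\ normsq_le l (defect g f f2) eps.
Proof.
move=> [Lg gc] eps0; have [rho /andP[rho0 rho1] step] := defect_step.
pose c1 := `|c| + 1; have c10 : 0 < c1 by rewrite ltr_pwDr.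
have gc1 : normsq_le l g c1.
  by split => // N; apply: le_trans (gc N) _; rewrite /c1; have := ler_norm c; lra.
have [rz|rnz] := eqVneq rho 0.
  have [N [f [f1 [f2 [Df h]]]]] := step _ _ c10 gc1.
  exists N, f, f1, f2; split => //; case: h => Ld hd; split=> // M.
  by apply: le_trans (hd M) _; rewrite rz mul0r ltW.
have rho_gt0 : 0 < rho by rewrite lt_def rnz.
have iter n : exists N f f1 f2, rdom l N f f1 f2 /\ normsq_le l (defect g f f2) (rho ^+ n.+1 * c1).
  elim: n => [|n [N [f [f1 [f2 [Df h]]]]]]; first by rewrite expr1; exact: step.
  have c20 : 0 < rho ^+ n.+1 * c1 by rewrite mulr_gt0 // exprn_gt0.
  have [N' [f' [f1' [f2' [Df' h']]]]] := step _ _ c20 h.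
  exists (maxn N N').
  exists (fun e x => f e x + 1 * f' e x), (fun e x => f1 e x + 1 * f1' e x),
    (fun e x => f2 e x + 1 * f2' e x); split.
    apply: rdomD => //; first by apply: rdom_widen Df; exact: leq_maxl.
    by apply: rdom_widen Df'; exact: leq_maxr.
  by rewrite defectD exprS -mulrA.
have cv : rho ^+ n @[n --> \oo] --> 0 by apply: cvg_expr; rewrite ger0_norm.
have e1 : 0 < eps / c1 by rewrite divr_gt0.
move/cvgrPdist_lt: cv => /(_ _ e1) [n _ hn].
have [N [f [f1 [f2 [Df [Ld hd]]]]]] := iter n.
exists N, f, f1, f2; split => //; split=> // M; apply: le_trans (hd M) _.
have := hn n.+1 (leqnSn n); rewrite /= sub0r normrN ger0_norm ?exprn_ge0 // => h.
by rewrite -ler_pdivlMr // ltW.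
Qed.

End Resolvent.

Lemma ler_add_invn (R : archiFieldType) (x y z : R) :
  (forall j : nat, x <= y + z / j.+1%:R) -> x <= y.
Proof.
move=> h; rewrite leNgt; apply/negP => yx.
have d0 : 0 < x - y by rewrite subr_gt0.
have [z0|z0] := leP z 0.
  have := h 0%N; rewrite divr1; lra.
have [n hn] : exists n : nat, z / (x - y) < n.+1%:R.
  exists (Num.bound (z / (x - y))); apply: lt_trans (archi_boundP _) _.
    by rewrite divr_ge0 // ltW.
  by rewrite ltr_nat.
have := h n; rewrite -lerBlDl ler_pdivlMr // => h2.
move: hn; rewrite ltr_pdivrMr // mulrC => hn.
by have := lt_le_trans hn h2; rewrite ltxx.
Qed.

(** * Limits of approximate solutions *)

Section Closedness.
Variables (R : realType) (s : nat -> nat) (l : nat -> R).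
Hypothesis s_gt0 : forall n, (0 < s n)%N.
Hypothesis l_gt0 : forall n, 0 < l n.
Variables (b lam : R).
Hypothesis fb : form_bound s l b.
Hypothesis lamb : lam < b.
Implicit Types f g h : edge s -> R -> R.

Local Notation len e := (l (tag e)).
Let len0 (e : edge s) : 0 <= len e. Proof. exact: ltW. Qed.

Lemma ip_le_sip N f (e : edge s) : (tag e < N)%N -> ip (len e) (f e) (f e) <= sip l N f f.
Proof.
move=> eN; rewrite /sip (bigD1_seq e) ?mem_edges ?edges_uniq //= lerDl.
by apply: sumr_ge0 => e' _; exact: ip_ge0.
Qed.

(** Coercivity bounds f and f' on the edge by the residual, and the Sobolev inequality bounds point
    values by these, with a constant depending on the edge only. *)
Lemma rdom_sup_bound N f f1 f2 (e : edge s) x : rdom l N f f1 f2 -> x \in `[0, len e] ->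
  f e x ^+ 2 <= (2 / len e + 8 * len e) *
    ((((b - lam) ^+ 2)^-1 + (1 + (1 + `|lam|) / (b - lam) ^+ 2)) *
      sip l N (residual lam f f2) (residual lam f f2)).
Proof.
move=> Df xe; have [HH _ _ f0] := Df; have [p p1 _] := HH e.
have le0 : 0 < len e by [].
have d0 : 0 < (b - lam) ^+ 2 by rewrite exprn_gt0 // subr_gt0.
have K0 : 0 <= 2 / len e + 8 * len e by rewrite addr_ge0 ?divr_ge0 ?mulr_ge0.
have [eN|Ne] := ltnP (tag e) N; last first.
  rewrite f0 // expr0n mulr_ge0 // mulr_ge0 ?sip_ge0 //.
  by rewrite addr_ge0 ?addr_ge0 ?divr_ge0 ?addr_ge0 // ?invr_ge0 // ltW.
apply: le_trans (sobolev_bound le0 p (prim_L2 (len0 e) p1) xe) _.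
rewrite ler_wpM2l // mulrDl lerD //.
  apply: le_trans (ip_le_sip f eN) _; rewrite ler_pdivlMl //.
  exact: (apriori s_gt0 l_gt0 fb lamb Df).
by apply: le_trans (ip_le_sip f1 eN) _; exact: (apriori1 s_gt0 l_gt0 fb lamb Df).
Qed.

(** The limit is built pointwise: by [rdom_sup_bound] the sequence is uniformly Cauchy on each edge,
    so the limit is measurable and square integrable there. The global rate comes from [apriori]
    applied to differences of approximants. *)
Lemma limit_in_closure g (N : nat -> nat) (f f1 f2 : nat -> edge s -> R -> R) : L2loc l g ->
  (forall n, rdom l (N n) (f n) (f1 n) (f2 n) /\
             normsq_le l (defect lam g (f n) (f2 n)) n.+1%:R^-1) ->
  exists h A, L2loc l h /\ forall n, normsq_le l (fun e x => h e x - f n e x) (A / n.+1%:R).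
Proof.
move=> Lg Hf.
have Lf n : L2loc l (f n) by case: (Hf n) => -[/(H2loc_L2 l_gt0) []].
have d0 : 0 < (b - lam) ^+ 2 by rewrite exprn_gt0 // subr_gt0.
pose K (e : edge s) := (2 / len e + 8 * len e) *
  (((b - lam) ^+ 2)^-1 + (1 + (1 + `|lam|) / (b - lam) ^+ 2)).
have K0 e : 0 <= K e.
  rewrite /K; apply: mulr_ge0; first by rewrite addr_ge0 ?divr_ge0 ?mulr_ge0.
  by rewrite addr_ge0 ?addr_ge0 ?divr_ge0 ?addr_ge0 // ?invr_ge0 // ltW.
have diff j k : let M := maxn (N j) (N k) in
    rdom l M (fun e x => f j e x + -1 * f k e x) (fun e x => f1 j e x + -1 * f1 k e x)
      (fun e x => f2 j e x + -1 * f2 k e x) /\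
    let r := residual lam (fun e x => f j e x + -1 * f k e x)
                         (fun e x => f2 j e x + -1 * f2 k e x) in
    sip l M r r <= 2 / j.+1%:R + 2 / k.+1%:R.
  move=> M; have [Dj [Lj hj]] := Hf j; have [Dk [Lk hk]] := Hf k.
  have D : rdom l M (fun e x => f j e x + -1 * f k e x) (fun e x => f1 j e x + -1 * f1 k e x)
      (fun e x => f2 j e x + -1 * f2 k e x).
    apply: rdomD; first by apply: rdom_widen Dj; exact: leq_maxl.
    by apply: rdom_widen Dk; exact: leq_maxr.
  split => // r; have Lr : L2loc l r by case: D => HH _ _ _; exact: (L2loc_residual l_gt0 _ HH).
  have := le_sip_comb M (k := 2) (k' := 2) Lr Lj Lk.
  move=> /(_ _) /le_trans; apply.
    move=> e x _; rewrite addrC.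
    rewrite [X in X ^+ 2 <= _](_ : _ = defect lam g (f k) (f2 k) e x -
      defect lam g (f j) (f2 j) e x) ?sqrB_le2 //.
    by rewrite /r /defect /residual; ring.
  by rewrite lerD // ler_pM2l.
have ptw j k (e : edge s) x : x \in `[0, len e] ->
    (f j e x - f k e x) ^+ 2 <= K e * (2 / j.+1%:R + 2 / k.+1%:R).
  move=> xe; have [D hr] := diff j k.
  have := rdom_sup_bound D xe; rewrite mulN1r mulrA -/(K e) => h.
  by apply: le_trans h _; rewrite ler_wpM2l.
have ptw' j k (e : edge s) x : (k <= j)%N -> x \in `[0, len e] ->
    (f j e x - f k e x) ^+ 2 <= K e * 4 / k.+1%:R.
  move=> kj xe; apply: le_trans (ptw j k e x xe) _.
  rewrite -mulrA ler_wpM2l // [leRHS](_ : _ = 2 / k.+1%:R + 2 / k.+1%:R); last by field.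
  by rewrite lerD2r ler_pM2l // lef_pV2 ?posrE ?ltr0n // ler_nat ltnS.
have cv (e : edge s) x : x \in `[0, len e] -> cvgn (fun j => f j e x).
  move=> xe; apply: cauchy_cvg; apply: cauchy_exP => d dp.
  have [k hk] : exists k : nat, K e * 4 / d ^+ 2 < k.+1%:R.
    exists (Num.bound (K e * 4 / d ^+ 2)); apply: lt_trans (archi_boundP _) _.
      by apply: divr_ge0; [apply: mulr_ge0|exact: sqr_ge0].
    by rewrite ltr_nat.
  exists (f k e x); exists k => // j /= kj; rewrite /ball /= distrC.
  have h := ptw' j k e x kj xe.
  rewrite -(ger0_norm (ltW dp)) -!sqrtr_sqr ltr_sqrt; last by rewrite exprn_gt0.
  apply: le_lt_trans h _; rewrite ltr_pdivrMr ?ltr0n // [ltRHS]mulrC.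
  by rewrite -ltr_pdivrMr // exprn_gt0.
pose h (e : edge s) x := limn (fun j => f j e x).
have lim_ptw k (e : edge s) x : x \in `[0, len e] -> (h e x - f k e x) ^+ 2 <= K e * 4 / k.+1%:R.
  move=> xe.
  have c : (f j e x - f k e x) ^+ 2 @[j --> \oo] --> (h e x - f k e x) ^+ 2.
    have c1 : f j e x - f k e x @[j --> \oo] --> h e x - f k e x.
      by apply: cvgB; [exact: cv|exact: cvg_cst].
    by rewrite expr2; under eq_fun do rewrite expr2; exact: cvgM.
  apply: (cvgr_to_le c); by exists k => // j /= kj; exact: ptw'.
have Lhf k : L2loc l (fun e x => h e x - f k e x).
  move=> e.
  have mh : measurable_fun `[0, len e] (h e).
    apply: (@measurable_fun_cvg _ _ _ _ (fun j => f j e)); first by move=> j; case: (Lf j e).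
    by move=> x /= xe; exact: cv.
  apply: (@bounded_L2 _ _ _ (Num.sqrt (K e * 4 / k.+1%:R))).
    by apply: measurable_funB => //; case: (Lf k e).
  by move=> x xe; rewrite -sqrtr_sqr ler_wsqrtr // lim_ptw.
exists h, (4 / (b - lam) ^+ 2); split.
  move=> e; apply: eq_L2 (L2D (Lhf 0%N e) (Lf 0%N e)) => x _.
  by rewrite subrK.
move=> k; split=> // M.
pose Y := \sum_(e <- edges s M) 2 * (len e * (K e * 4)).
(* Fatou by hand: an auxiliary index j tends to infinity. The constant Y depends on the number M of
   bundles, but it multiplies 1 / (j + 1) and disappears from the final bound. *)
apply: (@ler_add_invn _ _ _ (4 / (b - lam) ^+ 2 + Y)) => j.
have Lfd : L2loc l (fun e x => f j e x - f k e x) by exact: L2locB.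
have := le_sip_comb M (k := 2) (k' := 2) (Lhf k) Lfd (Lhf j).
move=> /(_ _) /le_trans; apply.
  move=> e x _.
  rewrite [X in X ^+ 2 <= _](_ : _ = (f j e x - f k e x) - (- (h e x - f j e x))); last by ring.
  by rewrite -[X in _ + 2 * X]sqrrN sqrB_le2.
have E1 : sip l M (fun e x => f j e x - f k e x) (fun e x => f j e x - f k e x) <=
    ((b - lam) ^+ 2)^-1 * (2 / j.+1%:R + 2 / k.+1%:R).
  have [D hr] := diff j k; have := apriori s_gt0 l_gt0 fb lamb D.
  set w := (fun e x => _ + _); set P := maxn _ _.
  have -> : sip l M (fun e x => f j e x - f k e x) (fun e x => f j e x - f k e x) = sip l M w w.
    by apply: eq_sip => e x _ _; rewrite /w mulN1r.
  move=> ha; have [_ _ _ w0] := D.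
  apply: (@le_trans _ _ (sip l P w w)).
    have [PM|/ltnW MP] := leqP P M; last exact: sip_mono.
    by rewrite (@sip_supp _ _ _ P).
  by rewrite ler_pdivlMl //; apply: le_trans ha _.
have E2 : 2 * sip l M (fun e x => h e x - f j e x) (fun e x => h e x - f j e x) <= Y / j.+1%:R.
  rewrite /sip /Y mulr_sumr mulr_suml; apply: ler_sum => e _.
  rewrite [leRHS](_ : _ = 2 * rint (len e) (fun=> K e * 4 / j.+1%:R)); last first.
    by rewrite rint_cst //; ring.
  rewrite ler_pM2l // /ip.
  apply: le_rint; [exact: (L2_mul_itg (Lhf j e) (Lhf j e))|exact: itg_cst|].
  by move=> x xe; rewrite -expr2 lim_ptw.
apply: le_trans (lerD (ler_wpM2l _ E1) E2) _ => //.
rewrite [leLHS](_ : _ = 4 / (b - lam) ^+ 2 / k.+1%:R + (4 / (b - lam) ^+ 2 + Y) / j.+1%:R) //.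
field; rewrite !nat1r !pnatr_eq0 /= subr_eq0 andbT.
by rewrite neq_lt lamb orbT.
Qed.

End Closedness.

(** * The Kirchhoff Laplacian and its spectrum *)

Section ComplexGlue.
Variables (R : realType) (s : nat -> nat) (l : nat -> R).
Hypothesis s_gt0 : forall n, (0 < s n)%N.
Hypothesis l_gt0 : forall n, 0 < l n.
Notation mu := (@lebesgue_measure R).
Implicit Types (f g h F : gfun R s).

Local Notation len e := (l (tag e)).
Let len0 (e : edge s) : 0 <= len e. Proof. exact: ltW. Qed.

Definition re f : edge s -> R -> R := fun e x => complex.Re (f e x).
Definition im f : edge s -> R -> R := fun e x => complex.Im (f e x).
Definition cplx (u v : edge s -> R -> R) : gfun R s := fun e x => Complex (u e x) (v e x).

Lemma re_cplx u v : re (cplx u v) = u. Proof. by []. Qed.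
Lemma im_cplx u v : im (cplx u v) = v. Proof. by []. Qed.
Lemma re_sum (I : Type) (r : seq I) (P : pred I) (u : I -> R[i]) :
  complex.Re (\sum_(i <- r | P i) u i) = \sum_(i <- r | P i) complex.Re (u i).
Proof. by apply: (big_morph (@complex.Re R)) => // -[a b] [c d]. Qed.

Lemma im_sum (I : Type) (r : seq I) (P : pred I) (u : I -> R[i]) :
  complex.Im (\sum_(i <- r | P i) u i) = \sum_(i <- r | P i) complex.Im (u i).
Proof. by apply: (big_morph (@complex.Im R)) => // -[a b] [c d]. Qed.

Lemma normsq_itv_L2 a (u : R -> R[i]) :
  L2 a (fun x => complex.Re (u x)) -> L2 a (fun x => complex.Im (u x)) ->
  normsq_itv a u = (ip a (fun x => complex.Re (u x)) (fun x => complex.Re (u x)) +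
                    ip a (fun x => complex.Im (u x)) (fun x => complex.Im (u x)))%:E.
Proof.
move=> L1 L2'; rewrite /ip -rintD; [|exact: L2_mul_itg..].
rewrite fine_rint; last by apply: itgD; exact: L2_mul_itg.
by apply: eq_integral => x _; rewrite -!expr2.
Qed.

Lemma L2_normsq_itv a (u : R -> R[i]) :
  cmeasurable `[0, a] u /\ (normsq_itv a u < +oo)%E <->
  L2 a (fun x => complex.Re (u x)) /\ L2 a (fun x => complex.Im (u x)).
Proof.
split=> [[[m1 m2] fin]|[L1 L2']]; last first.
  split; last by rewrite normsq_itv_L2 // ltry.
  by split; [case: L1|case: L2'].
have i : itg a (fun x => complex.Re (u x) ^+ 2 + complex.Im (u x) ^+ 2).
  apply/integrableP; split.
    by apply/measurable_EFinP; apply: measurable_funD; exact: measurable_funX.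
  apply: le_lt_trans fin; rewrite le_eqVlt; apply/orP; left; apply/eqP.
  by apply: eq_integral => x _; rewrite /= ger0_norm // addr_ge0 // sqr_ge0.
split; split => //.
- apply: le_itg i; first exact: measurable_funX.
  by move=> x _; rewrite ger0_norm ?sqr_ge0 // lerDl sqr_ge0.
- apply: le_itg i; first exact: measurable_funX.
  by move=> x _; rewrite ger0_norm ?sqr_ge0 // lerDr sqr_ge0.
Qed.

Lemma normsq_itv_ge0 a (u : R -> R[i]) : (0 <= normsq_itv a u)%E.
Proof. by apply: integral_ge0 => x _; rewrite lee_fin addr_ge0 // sqr_ge0. Qed.

Lemma sum_normsq_itv f N : L2loc l (re f) -> L2loc l (im f) ->
  (\sum_(e <- edges s N) normsq_itv (len e) (f e))%E =
  (sip l N (re f) (re f) + sip l N (im f) (im f))%:E.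
Proof.
move=> L1 L2'; rewrite /sip -big_split /= -sumEFin; apply: eq_bigr => e _.
by rewrite normsq_itv_L2; [|exact: L1|exact: L2'].
Qed.

(** The passage from the unordered extended-real sum to real partial sums over bundles, with real
    and imaginary parts decoupled. *)
Lemma normsq_leP f (c : R) : L2loc l (re f) -> L2loc l (im f) ->
  (normsq l f <= c%:E)%E <-> forall N, sip l N (re f) (re f) + sip l N (im f) (im f) <= c.
Proof.
move=> L1 L2'; split=> [h N|h].
  rewrite -lee_fin -sum_normsq_itv //; apply: le_trans h.
  by apply: sum_edges_esum => e; exact: normsq_itv_ge0.
apply: esum_edges_le => [e|N]; first exact: normsq_itv_ge0.
by rewrite sum_normsq_itv // lee_fin.
Qed.

Lemma inL2_L2loc f : inL2 l f -> L2loc l (re f) /\ L2loc l (im f).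
Proof.
move=> [mf fin]; have h e : cmeasurable `[0, len e] (f e) /\ (normsq_itv (len e) (f e) < +oo)%E.
  split; first exact: mf.
  apply: le_lt_trans fin; apply: esum_ge; exists [set e] => //.
  by rewrite fsbig_set1.
by split=> e; have /L2_normsq_itv [] := h e.
Qed.

Lemma normsq_ge0 f : (0 <= normsq l f)%E.
Proof. by apply: esum_ge0 => e _; exact: normsq_itv_ge0. Qed.

Lemma inL2P f : inL2 l f <-> exists c, normsq_le l (re f) c /\ normsq_le l (im f) c.
Proof.
split=> [fL|[c [[L1 h1] [L2' h2]]]].
  have [L1 L2'] := inL2_L2loc fL; have [mf fin] := fL.
  have fn : normsq l f \is a fin_num by rewrite ge0_fin_numE // normsq_ge0.
  exists (fine (normsq l f)).
  have /(normsq_leP _ L1 L2') h : (normsq l f <= (fine (normsq l f))%:E)%E by rewrite fineK.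
  split; split => // N; apply: le_trans (h N); first by rewrite lerDl sip_ge0.
  by rewrite lerDr sip_ge0.
split.
  move=> e; have h : L2 (len e) (fun x => complex.Re (f e x)) /\
                    L2 (len e) (fun x => complex.Im (f e x)) by split; [exact: L1|exact: L2'].
  by have /L2_normsq_itv [] := h.
apply: (@le_lt_trans _ _ (c + c)%:E); last exact: ltry.
by apply/(normsq_leP _ L1 L2') => N; rewrite lerD.
Qed.

Lemma edge_originP n (i : 'I_(s n)) (e : edge s) :
  origin e = existT (fun n => 'I_(s n)) n i -> exists j, e = mk i j.
Proof.
case: e => m [i' j'] /= E; have nm : m = n by have := congr1 tag E.
by subst m; exists j'; move/vertex_inj: E => /= <-.
Qed.

Lemma edge_terminusP n (j : 'I_(s n.+1)) (e : edge s) :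
  terminus e = existT (fun n => 'I_(s n)) n.+1 j -> exists i, e = mk i j.
Proof.
case: e => m [i' j'] /= E; have nm : m = n by have [] := congr1 tag E.
by subst m; exists i'; move/vertex_inj: E => /= <-.
Qed.

Lemma vertex_continuityP f :
  (forall v, continuous_at_vertex l f v) <->
  (exists v, vertex_values l (re f) v) /\ (exists w, vertex_values l (im f) w).
Proof.
split=> [/choice [c hc]|[[v hv] [w hw]]].
  split.
    exists (fun n i => complex.Re (c (existT (fun n => 'I_(s n)) n i))) => n i j; split.
      by rewrite /re (proj1 (hc _) _ (erefl (origin (mk i j)))).
    by rewrite /re; have /= -> := proj2 (hc _) _ (erefl (terminus (mk i j))).
  exists (fun n i => complex.Im (c (existT (fun n => 'I_(s n)) n i))) => n i j; split.
    by rewrite /im (proj1 (hc _) _ (erefl (origin (mk i j)))).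
  by rewrite /im; have /= -> := proj2 (hc _) _ (erefl (terminus (mk i j))).
move=> [n i]; exists (Complex (v n i) (w n i)); split=> e.
  move=> /edge_originP [j ->]; have [<- _] := hv n i j; have [<- _] := hw n i j.
  by rewrite /re /im; case: (f _ _).
case: n i => [|n] i; first by move=> E; have := congr1 tag E.
move=> /edge_terminusP [j ->]; have [_ <-] := hv n j i; have [_ <-] := hw n j i.
by rewrite /re /im /elen /=; case: (f _ _).
Qed.

Lemma kirchhoffP f1 :
  (forall v, kirchhoff_at_vertex l f1 v) <-> kirchhoff l (re f1) /\ kirchhoff l (im f1).
Proof.
pose infl n : 'I_(s n) -> R[i] := match n with
  | 0%N => fun=> 0
  | m.+1 => fun j => \sum_(i < s m) f1 (mk i j) (l m) end.
have E n (i : 'I_(s n)) : kirchhoff_at_vertex l f1 (existT (fun n => 'I_(s n)) n i) <->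
    \sum_j f1 (mk i j) 0 = infl n i.
  rewrite /kirchhoff_at_vertex sum_origin.
  case: n i => [|n] i; first by rewrite sum_terminus0 addr0.
  rewrite sum_terminus sumrN.
  split=> [/eqP|->]; last exact: subrr.
  by rewrite subr_eq0 => /eqP.
have reE n (i : 'I_(s n)) : complex.Re (infl n i) = influx l (re f1) i.
  by case: n i => [|n] i //=; rewrite re_sum.
have imE n (i : 'I_(s n)) : complex.Im (infl n i) = influx l (im f1) i.
  by case: n i => [|n] i //=; rewrite im_sum.
split=> [h|[h1 h2]].
  split=> n i; have /E e := h (existT (fun n => 'I_(s n)) n i).
    by rewrite -reE -e re_sum.
  by rewrite -imE -e im_sum.
move=> [n i]; apply/E; apply/eqP; rewrite eq_complex reE imE re_sum im_sum.
by apply/andP; split; apply/eqP; [exact: h1|exact: h2].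
Qed.

Lemma sobolev2P a (u u1 u2 : R -> R[i]) : 0 <= a ->
  sobolev2 a u u1 u2 <->
  [/\ prim a (fun x => complex.Re (u x)) (fun x => complex.Re (u1 x)),
      prim a (fun x => complex.Re (u1 x)) (fun x => complex.Re (u2 x)) &
      L2 a (fun x => complex.Re (u2 x))] /\
  [/\ prim a (fun x => complex.Im (u x)) (fun x => complex.Im (u1 x)),
      prim a (fun x => complex.Im (u1 x)) (fun x => complex.Im (u2 x)) &
      L2 a (fun x => complex.Im (u2 x))].
Proof.
move=> a0; split.
  move=> [m fin h1 h]; have [L1 L2'] := (L2_normsq_itv a u2).1 (conj m fin).
  have pr : prim a (fun x => complex.Re (u1 x)) (fun x => complex.Re (u2 x)).
    split; first exact: L2_itg.
    by move=> x xa; rewrite h1 //; case: (u1 0).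
  have pi : prim a (fun x => complex.Im (u1 x)) (fun x => complex.Im (u2 x)).
    split; first exact: L2_itg.
    by move=> x xa; rewrite h1 //; case: (u1 0).
  split; split => //; split.
  - exact: (prim_itg a0 pr).
  - by move=> x xa; rewrite h //; case: (u 0).
  - exact: (prim_itg a0 pi).
  - by move=> x xa; rewrite h //; case: (u 0).
move=> [[p p1 L] [q q1 L']].
have [m fin] := (L2_normsq_itv a u2).2 (conj L L').
split => // x xa.
  apply/eqP; rewrite eq_complex; apply/andP; split; apply/eqP.
    by have [_ ->] := p1 => //; case: (u1 0).
  by have [_ ->] := q1 => //; case: (u1 0).
apply/eqP; rewrite eq_complex; apply/andP; split; apply/eqP.
  by have [_ ->] := p => //; case: (u 0).
by have [_ ->] := q => //; case: (u 0).
Qed.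

Lemma kirchhoff0_rdom f F : kirchhoff0 l f F ->
  exists N f1 f2, [/\ rdom l N (re f) (re f1) (re f2), rdom l N (im f) (im f1) (im f2) &
                      F = (fun e x => - f2 e x)].
Proof.
move=> [_ /finite_seqP [r hr] [f1 [f2 [H /vertex_continuityP [v w] /kirchhoffP [k1 k2] ->]]]].
pose N := (\max_(e <- r) (tag e).+1)%N.
have f0 e x : (N <= tag e)%N -> x \in `[0, len e] -> f e x = 0.
  move=> Ne xe; apply/eqP; apply/negPn/negP => fx.
  have er : e \in r by have : [set` r] e by rewrite -hr; exists x.
  have := @leq_bigmax_seq _ r xpredT (fun e : edge s => (tag e).+1) e er isT.
  by rewrite -/N => /(leq_ltn_trans Ne); rewrite ltnn.
exists N, f1, f2; split => //; split => //.
- by move=> e; have [] := (sobolev2P _ _ _ (len0 e)).1 (H e).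
- by move=> e x Ne xe; rewrite /re f0.
- by move=> e; have [] := (sobolev2P _ _ _ (len0 e)).1 (H e).
- by move=> e x Ne xe; rewrite /im f0.
Qed.

Lemma rdom_kirchhoff0 N u u1 u2 v v1 v2 : rdom l N u u1 u2 -> rdom l N v v1 v2 ->
  kirchhoff0 l (cplx u v) (cplx (fun e x => - u2 e x) (fun e x => - v2 e x)).
Proof.
move=> Du Dv; have [Hu wu ku u0] := Du; have [Hv wv kv v0] := Dv.
have [Lu _ _] := H2loc_L2 l_gt0 Hu; have [Lv _ _] := H2loc_L2 l_gt0 Hv.
have bound (w : edge s -> R -> R) : L2loc l w ->
    (forall e x, (N <= tag e)%N -> x \in `[0, len e] -> w e x = 0) ->
    normsq_le l w (sip l N w w).
  move=> Lw w0; split => // M; have [NM|/ltnW MN] := leqP N M; last exact: sip_mono.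
  by rewrite (@sip_supp _ _ _ N).
split.
- apply/inL2P; exists (sip l N u u + sip l N v v); rewrite re_cplx im_cplx.
  have [_ bu] := bound u Lu u0; have [_ bv] := bound v Lv v0.
  by split; split=> // M; [apply: le_trans (bu M) _|apply: le_trans (bv M) _];
    rewrite ?lerDl ?lerDr sip_ge0.
- apply: (@sub_finite_set _ _ [set` edges s N]) => // e [x xe /= fx].
  rewrite mem_edges ltnNge; apply/negP => Ne.
  by move: fx; rewrite /cplx u0 // v0 // eqxx.
- exists (cplx u1 v1), (cplx u2 v2); split.
  + by move=> e; apply/(sobolev2P _ _ _ (len0 e)); split; [exact: Hu|exact: Hv].
  + by apply/vertex_continuityP; rewrite re_cplx im_cplx.
  + by apply/kirchhoffP; rewrite re_cplx im_cplx.
  + by apply/funext => e; apply/funext => x.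
Qed.

Lemma re_gsub f g : re (gsub f g) = fun e x => re f e x - re g e x.
Proof. by apply/funext => e; apply/funext => x; rewrite /re /gsub; case: (f e x); case: (g e x). Qed.

Lemma im_gsub f g : im (gsub f g) = fun e x => im f e x - im g e x.
Proof. by apply/funext => e; apply/funext => x; rewrite /im /gsub; case: (f e x); case: (g e x). Qed.

Lemma re_gscale (c : R) f : re (gscale (real_complex R c) f) = fun e x => c * re f e x.
Proof.
by apply/funext => e; apply/funext => x; rewrite /re /gscale; case: (f e x) => a b /=; ring.
Qed.

Lemma im_gscale (c : R) f : im (gscale (real_complex R c) f) = fun e x => c * im f e x.
Proof.
by apply/funext => e; apply/funext => x; rewrite /im /gscale; case: (f e x) => a b /=; ring.
Qed.

Lemma re_opp f : re (fun e x => - f e x) = fun e x => - re f e x.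
Proof. by apply/funext => e; apply/funext => x; rewrite /re; case: (f e x). Qed.

Lemma im_opp f : im (fun e x => - f e x) = fun e x => - im f e x.
Proof. by apply/funext => e; apply/funext => x; rewrite /im; case: (f e x). Qed.

End ComplexGlue.

(** * Closure of the operator, its resolvent set and its spectral gap *)

Section Spectrum.
Variables (R : realType) (s : nat -> nat) (l : nat -> R).
Hypothesis s0 : s 0%N = 1%N.
Hypothesis s_gt0 : forall n, (0 < s n)%N.
Hypothesis l_gt0 : forall n, 0 < l n.
Hypothesis vol_infty : forall A : R, exists N, A <= vol_below s l N.
Implicit Types (u v w : edge s -> R -> R).

Local Notation len e := (l (tag e)).
Let len0 (e : edge s) : 0 <= len e. Proof. exact: ltW. Qed.

Lemma normsq_leD u v (a b : R) : normsq_le l u a -> normsq_le l v b ->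
  normsq_le l (fun e x => u e x + v e x) (2 * a + 2 * b).
Proof.
move=> [Lu hu] [Lv hv]; split; first exact: L2locD.
move=> N; apply: le_trans (sip_young N ltr01 Lu Lv) _.
by rewrite invr1 (_ : 1 + 1 = 2) //; apply: lerD; rewrite ler_pM2l.
Qed.

Lemma normsq_leZ (k : R) u (a : R) : normsq_le l u a ->
  normsq_le l (fun e x => k * u e x) (k ^+ 2 * a).
Proof.
move=> [Lu hu]; split; first exact: L2locZ.
move=> N; have LZ := L2locZ k Lu; rewrite sipZl // sipC sipZl // mulrA -expr2.
by rewrite ler_wpM2l // sqr_ge0.
Qed.

Lemma normsq_le_trans u (a b : R) : normsq_le l u a -> a <= b -> normsq_le l u b.
Proof. by move=> [Lu hu] ab; split=> // N; exact: le_trans (hu N) ab. Qed.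

Lemma eq_normsq_le u v (a : R) : (forall e x, x \in `[0, len e] -> u e x = v e x) ->
  normsq_le l u a -> normsq_le l v a.
Proof.
move=> uv [Lu hu]; split; first by move=> e; apply: eq_L2 (Lu e) => x; exact: uv.
move=> N; apply: le_trans (hu N); rewrite le_eqVlt; apply/orP; left; apply/eqP.
by apply: eq_sip => e x _ xe; rewrite uv.
Qed.

Lemma rdom_normsq_le N u u1 u2 : rdom l N u u1 u2 -> normsq_le l u (sip l N u u).
Proof.
move=> [Hu _ _ u0]; have [Lu _ _] := H2loc_L2 l_gt0 Hu; split=> // M.
have [NM|/ltnW MN] := leqP N M; last exact: sip_mono.
by rewrite (@sip_supp _ _ _ N).
Qed.

(** Real counterpart of [op_closure]. The approximating image is - f2, whence the plus sign in the
    last clause. *)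
Definition in_closure u U : Prop := forall eps : R, 0 < eps ->
  exists N f f1 f2, [/\ rdom l N f f1 f2, normsq_le l (fun e x => u e x - f e x) eps &
                        normsq_le l (fun e x => U e x + f2 e x) eps].

Lemma normsq_lt_parts (f : gfun R s) (c : R) : L2loc l (re f) -> L2loc l (im f) ->
  (normsq l f < c%:E)%E -> normsq_le l (re f) c /\ normsq_le l (im f) c.
Proof.
move=> L1 L2' /ltW /(normsq_leP _ L1 L2') h.
split; split=> // N; apply: le_trans (h N); first by rewrite lerDl sip_ge0.
by rewrite lerDr sip_ge0.
Qed.

Lemma laplacian_closure (f F : gfun R s) : kirchhoff_laplacian l f F ->
  in_closure (re f) (re F) /\ in_closure (im f) (im F).
Proof.
move=> [/(inL2_L2loc) [Lrf Lif] /(inL2_L2loc) [LrF LiF] app].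
suff key eps : 0 < eps -> exists N f0 f1 f2, [/\ rdom l N (re f0) (re f1) (re f2),
    rdom l N (im f0) (im f1) (im f2),
    normsq_le l (fun e x => re f e x - re f0 e x) eps /\
    normsq_le l (fun e x => re F e x + re f2 e x) eps &
    normsq_le l (fun e x => im f e x - im f0 e x) eps /\
    normsq_le l (fun e x => im F e x + im f2 e x) eps].
  split=> eps /key [N [f0 [f1 [f2 [Dr Di [a1 a2] [b1 b2]]]]]].
    by exists N, (re f0), (re f1), (re f2).
  by exists N, (im f0), (im f1), (im f2).
move=> eps0; have [f0 [F0 [K h1 h2]]] := app _ eps0.
have [N [f1 [f2 [Dr Di EF]]]] := kirchhoff0_rdom l_gt0 K.
have [Hr _ _ _] := Dr; have [Hi _ _ _] := Di.
have [Lr _ Lr2] := H2loc_L2 l_gt0 Hr; have [Li _ Li2] := H2loc_L2 l_gt0 Hi.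
have LrF0 : L2loc l (re F0) by rewrite EF re_opp; exact: L2locN.
have LiF0 : L2loc l (im F0) by rewrite EF im_opp; exact: L2locN.
have [] := normsq_lt_parts _ _ h1; rewrite ?re_gsub ?im_gsub; [exact: L2locB..|].
move=> a1 b1.
have [] := normsq_lt_parts _ _ h2; rewrite ?re_gsub ?im_gsub; [exact: L2locB..|].
rewrite EF re_opp im_opp => a2 b2.
exists N, f0, f1, f2; split => //; split => //.
- by apply: eq_normsq_le a2 => e x _; rewrite opprK.
- by apply: eq_normsq_le b2 => e x _; rewrite opprK.
Qed.

(** [apriori] carried to the closure. The factor 4 is the price of two applications of |x + y|^2 <=
    2 |x|^2 + 2 |y|^2; only boundedness matters later. *)
Lemma closure_apriori b lam u U c : form_bound s l b -> lam < b -> in_closure u U ->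
  L2loc l u -> normsq_le l (fun e x => U e x - lam * u e x) c ->
  normsq_le l u (4 / (b - lam) ^+ 2 * c).
Proof.
move=> fb lamb cl Lu hc; split => // N; apply/ler_addgt0Pr => d d0.
have q0 : 0 < (b - lam) ^+ 2 by rewrite exprn_gt0 // subr_gt0.
pose K := ((b - lam) ^+ 2)^-1; have K0 : 0 < K by rewrite invr_gt0.
(* The total coefficient with which the approximation error eps enters the final estimate; eps = d /
   Y then costs exactly d. *)
pose Y := 2 + 2 * K * (2 * (2 + 2 * lam ^+ 2)).
have Y0 : 0 < Y.
  rewrite /Y ltr_pwDl //; apply: mulr_ge0; first by apply: mulr_ge0 => //; exact: ltW.
  by have := sqr_ge0 lam; lra.
have [M [f [f1 [f2 [Df h1 h2]]]]] := cl _ (divr_gt0 d0 Y0).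
set eps := d / Y in h1 h2.
have hres : normsq_le l (residual lam f f2) (2 * c + 2 * (2 * eps + 2 * (lam ^+ 2 * eps))).
  have h3 := normsq_leD (normsq_leZ (-1) h2) (normsq_leZ lam h1).
  have := normsq_leD hc h3; rewrite sqrrN expr1n mul1r; apply: eq_normsq_le => e x _.
  by rewrite /residual; ring.
have hf : normsq_le l f (K * (2 * c + 2 * (2 * eps + 2 * (lam ^+ 2 * eps)))).
  apply: normsq_le_trans (rdom_normsq_le Df) _.
  rewrite ler_pdivlMl //; apply: le_trans (apriori s_gt0 l_gt0 fb lamb Df) _.
  by case: hres.
have [_ hu] := normsq_leD h1 hf.
have E : sip l N u u = sip l N (fun e x => u e x - f e x + f e x) (fun e x => u e x - f e x + f e x).
  by apply: eq_sip => e x _ _; rewrite subrK.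
rewrite E; apply: le_trans (hu N) _.
have -> : 4 / (b - lam) ^+ 2 * c + d = 4 * K * c + eps * Y.
  by rewrite /eps divfK // gt_eqF.
by rewrite le_eqVlt; apply/orP; left; apply/eqP; rewrite /Y; ring.
Qed.

(** The limit u of approximate solutions is in the domain of the closure, with image g + lam u.
    Explicit rates A / (n + 1) let the real and imaginary parts be approximated at the same n. *)
Lemma solve_real b lam g c : form_bound s l b -> lam < b -> normsq_le l g c ->
  exists u A, [/\ normsq_le l u A, normsq_le l (fun e x => g e x + lam * u e x) A &
    forall n : nat, exists N f f1 f2,
      [/\ rdom l N f f1 f2, normsq_le l (fun e x => u e x - f e x) (A / n.+1%:R) &
        normsq_le l (fun e x => g e x + lam * u e x + f2 e x) (A / n.+1%:R)]].
Proof.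
move=> fb lamb gc; have [Lg _] := gc.
pose T := (nat * (edge s -> R -> R) * (edge s -> R -> R) * (edge s -> R -> R))%type.
have : forall n : nat, exists t : T, rdom l t.1.1.1 t.1.1.2 t.1.2 t.2 /\
    normsq_le l (defect lam g t.1.1.2 t.2) n.+1%:R^-1.
  move=> n; have n0 : 0 < n.+1%:R^-1 :> R by rewrite invr_gt0.
  have [N [f [f1 [f2 h]]]] := dense_range s0 s_gt0 l_gt0 vol_infty fb lamb gc n0.
  by exists (N, f, f1, f2).
move=> /choice [t ht].
have [u [A [Lu hA]]] := limit_in_closure s_gt0 l_gt0 fb lamb Lg ht.
have hF n : normsq_le l (fun e x => g e x + lam * u e x + (t n).2 e x)
    ((2 + 2 * (lam ^+ 2 * A)) / n.+1%:R).
  have [_ hd] := ht n; have := normsq_leD hd (normsq_leZ lam (hA n)).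
  have -> : 2 / n.+1%:R + 2 * (lam ^+ 2 * (A / n.+1%:R)) =
    (2 + 2 * (lam ^+ 2 * A)) / n.+1%:R by ring.
  by apply: eq_normsq_le => e x _; rewrite /defect /residual; ring.
have A0 : 0 <= A.
  have [_ h] := hA 0%N; have := h 0%N; rewrite divr1; apply: le_trans.
  exact: sip_ge0.
have hu : normsq_le l u (2 * A + 2 * sip l (t 0%N).1.1.1 (t 0%N).1.1.2 (t 0%N).1.1.2).
  have [D _] := ht 0%N; have := normsq_leD (hA 0%N) (rdom_normsq_le D).
  by rewrite divr1; apply: eq_normsq_le => e x _; rewrite subrK.
have hgu := normsq_leD gc (normsq_leZ lam hu).
set B1 := (2 * A + _) in hu hgu; set B2 := (2 * c + _) in hgu.
pose B3 := 2 + 2 * (lam ^+ 2 * A).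
pose B := `|B1| + `|B2| + A + B3.
have B30 : 0 <= B3 by apply: addr_ge0 => //; do 2 apply: mulr_ge0 => //; exact: sqr_ge0.
have n1 := normr_ge0 B1; have n2 := normr_ge0 B2.
exists u, B; split.
- by apply: normsq_le_trans hu _; rewrite /B; have := ler_norm B1; lra.
- by apply: normsq_le_trans hgu _; rewrite /B; have := ler_norm B2; lra.
- move=> n; have [D _] := ht n.
  exists (t n).1.1.1, (t n).1.1.2, (t n).1.2, (t n).2; split=> //.
    apply: normsq_le_trans (hA n) _; rewrite ler_pM2r ?invr_gt0 // /B; lra.
  apply: normsq_le_trans (hF n) _; rewrite ler_pM2r ?invr_gt0 // /B -/B3; lra.
Qed.

Lemma normsq_le_normsq (f : gfun R s) (a b : R) :
  normsq_le l (re f) a -> normsq_le l (im f) b -> (normsq l f <= (a + b)%:E)%E.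
Proof. by move=> [L1 h1] [L2' h2]; apply/(normsq_leP _ L1 L2') => N; rewrite lerD. Qed.

Lemma resolvent_below b lam : form_bound s l b -> lam < b ->
  resolvent_set l (@kirchhoff_laplacian R s l) (real_complex R lam).
Proof.
move=> fb lamb; split.
  move=> g /inL2P [c [gr gi]].
  have [u [A [hu hU hn]]] := solve_real fb lamb gr.
  have [v [B [hv hV hm]]] := solve_real fb lamb gi.
  pose F := cplx (fun e x => re g e x + lam * u e x) (fun e x => im g e x + lam * v e x).
  have nnA w (a : R) : normsq_le l w a -> 0 <= a.
    by move=> [_ h]; apply: le_trans (h 0%N); exact: sip_ge0.
  have A0 := nnA _ _ hu; have B0 := nnA _ _ hv.
  exists (cplx u v), F; split.
    split.
    - apply/inL2P; exists (A + B); rewrite re_cplx im_cplx.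
      by split; [apply: normsq_le_trans hu _|apply: normsq_le_trans hv _]; rewrite ?lerDl ?lerDr.
    - apply/inL2P; exists (A + B); rewrite re_cplx im_cplx.
      by split; [apply: normsq_le_trans hU _|apply: normsq_le_trans hV _]; rewrite ?lerDl ?lerDr.
    - move=> eps eps0.
      have [n hn1] : exists n : nat, (A + B) / eps < n.+1%:R.
        exists (Num.bound ((A + B) / eps)); apply: lt_trans (archi_boundP _) _.
          by apply: divr_ge0; [apply: addr_ge0|exact: ltW].
        by rewrite ltr_nat.
      have small : A / n.+1%:R + B / n.+1%:R < eps.
        by rewrite -mulrDl ltr_pdivrMr // mulrC -ltr_pdivrMr.
      have [N [f [f1 [f2 [D h1 h2]]]]] := hn n.
      have [N' [f' [f1' [f2' [D' h1' h2']]]]] := hm n.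
      have D1 := rdom_widen (leq_maxl N N') D; have D2 := rdom_widen (leq_maxr N N') D'.
      exists (cplx f f'), (cplx (fun e x => - f2 e x) (fun e x => - f2' e x)); split.
      + exact: (rdom_kirchhoff0 l_gt0 D1 D2).
      + apply: le_lt_trans (_ : (_ <= (A / n.+1%:R + B / n.+1%:R)%:E)%E) _; last by rewrite lte_fin.
        by apply: normsq_le_normsq; rewrite ?re_gsub ?im_gsub.
      + apply: le_lt_trans (_ : (_ <= (A / n.+1%:R + B / n.+1%:R)%:E)%E) _; last by rewrite lte_fin.
        apply: normsq_le_normsq; rewrite ?re_gsub ?im_gsub ?re_cplx ?im_cplx.
          by apply: eq_normsq_le h2 => e x _; rewrite opprK.
        by apply: eq_normsq_le h2' => e x _; rewrite opprK.
  have Z w : (forall e x, w e x = 0) -> normsq_le l w 0.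
    move=> w0; split; first by move=> e; apply: eq_L2 (L2_cst _ 0) => x _; rewrite w0.
    by move=> N; rewrite /sip big1 // => e _; rewrite ip0l // => x _; rewrite w0.
  apply/eqP; rewrite eq_le normsq_ge0 andbT -[leRHS]/(0%:E) -[X in X%:E](addr0 0).
  apply: normsq_le_normsq; apply: Z => e x.
    by rewrite !re_gsub re_gscale /F !re_cplx; ring.
  by rewrite !im_gsub im_gscale /F !im_cplx; ring.
have d0 : 0 < b - lam by rewrite subr_gt0.
(* Real and imaginary parts each contribute 4 / (b - lam)^2, and 8 <= 3^2. *)
exists (3 / (b - lam)) => f F TfF; have [fL FL _] := TfF.
have [clr cli] := laplacian_closure TfF.
have [Lrf Lif] := inL2_L2loc fL.
have DL : inL2 l (gsub F (gscale (real_complex R lam) f)).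
  move: fL FL => /inL2P [c1 [a1 a2]] /inL2P [c2 [b1 b2]]; apply/inL2P.
  exists (2 * c2 + 2 * ((- lam) ^+ 2 * c1)); rewrite re_gsub im_gsub re_gscale im_gscale.
  split; [have := normsq_leD b1 (normsq_leZ (- lam) a1)|
          have := normsq_leD b2 (normsq_leZ (- lam) a2)];
    by apply: eq_normsq_le => e x _; rewrite mulNr.
set D := gsub F _ in DL *; have [LrD LiD] := inL2_L2loc DL.
have fin : normsq l D \is a fin_num by rewrite ge0_fin_numE ?normsq_ge0 //; case: DL.
set a := fine (normsq l D); have aE : normsq l D = a%:E by rewrite /a fineK.
have a0 : 0 <= a by rewrite -lee_fin -aE normsq_ge0.
have /(normsq_leP _ LrD LiD) ha : (normsq l D <= a%:E)%E by rewrite aE.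
have hr : normsq_le l (re f) (4 / (b - lam) ^+ 2 * a).
  apply: (closure_apriori fb lamb clr Lrf); split.
    by move: LrD; rewrite /D re_gsub re_gscale.
  move=> N; have := ha N; rewrite /D re_gsub re_gscale; apply: le_trans.
  by rewrite lerDl sip_ge0.
have hi : normsq_le l (im f) (4 / (b - lam) ^+ 2 * a).
  apply: (closure_apriori fb lamb cli Lif); split.
    by move: LiD; rewrite /D im_gsub im_gscale.
  move=> N; have := ha N; rewrite /D im_gsub im_gscale; apply: le_trans.
  by rewrite lerDr sip_ge0.
apply: le_trans (normsq_le_normsq hr hi) _; rewrite aE -EFinM lee_fin.
rewrite -subr_ge0 [leRHS](_ : _ = a / (b - lam) ^+ 2); last by field; rewrite gt_eqF.
by rewrite divr_ge0 // sqr_ge0.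
Qed.

(* If b lies in the resolvent set then some g0 in the domain nearly solves (H - b) g0 = f with
   |g0| <= const |f|; nonnegativity of the form of H - b at f - t g0 improves the bound b. *)
Lemma resolvent_gap b : form_bound s l b ->
  resolvent_set l (@kirchhoff_laplacian R s l) (real_complex R b) ->
  exists2 d : R, 0 < d & form_bound s l (b + d).
Proof.
move=> fb [surj [M bd]].
(* K a will bound the form of H - b at the approximate preimage u, whose square norm is at most (4
   M^2 + 1) a. *)
pose K := 4 * M ^+ 2 + 3; have K0 : 0 < K by rewrite /K ltr_wpDl // mulr_ge0 ?sqr_ge0.
exists (4 * K)^-1; first by rewrite invr_gt0 mulr_gt0.
move=> N f f1 f2 Df; set a := sip l N f f.
have : 0 <= a := sip_ge0 _ _ _; rewrite le_eqVlt => /predU1P[<-|a0].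
  by rewrite mulr0 sip_ge0.
have hf := rdom_normsq_le Df; rewrite -/a in hf; have [Lf _] := hf.
have Z : normsq_le l (fun (_ : edge s) (_ : R) => 0) (0 : R).
  split; first by move=> e; exact: L2_cst.
  by move=> P; rewrite /sip big1 // => e _; rewrite ip0l.
pose g := cplx f (fun _ _ => 0).
have gL : inL2 l g.
  apply/inL2P; exists a; rewrite re_cplx im_cplx; split=> //.
  by apply: normsq_le_trans Z _; exact: ltW.
have [h [H [T E]]] := surj _ gL.
have [hL HL _] := T; have [cl _] := laplacian_closure T.
have [Lrh Lih] := inL2_L2loc hL; have [LrH LiH] := inL2_L2loc HL.
set D := gsub H _ in E.
have LrD : L2loc l (re D) by rewrite re_gsub re_gscale; apply: L2locB => //; exact: L2locZ.
have LiD : L2loc l (im D) by rewrite im_gsub im_gscale; apply: L2locB => //; exact: L2locZ.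
have [Er Ei] : normsq_le l (re (gsub D g)) 0 /\ normsq_le l (im (gsub D g)) 0.
  have L1 : L2loc l (re (gsub D g)) by rewrite re_gsub; exact: L2locB.
  have L2' : L2loc l (im (gsub D g)).
    by rewrite im_gsub; apply: L2locB => //; case: Z.
  have /(normsq_leP _ L1 L2') e : (normsq l (gsub D g) <= 0%:E)%E by rewrite (E : normsq _ _ = _).
  by split; split=> // P; apply: le_trans (e P); rewrite ?lerDl ?lerDr sip_ge0.
have hD : (normsq l D <= (2 * a)%:E)%E.
  have -> : 2 * a = (2 * 0 + 2 * a) + (2 * 0 + 2 * 0) by ring.
  apply: normsq_le_normsq.
    have := normsq_leD Er hf; apply: eq_normsq_le => e x _.
    by rewrite re_gsub re_cplx subrK.
  have := normsq_leD Ei Z; apply: eq_normsq_le => e x _.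
  by rewrite im_gsub im_cplx subr0 addr0.
have hh : normsq_le l (re h) (M ^+ 2 * (2 * a)).
  have : (normsq l h <= (M ^+ 2 * (2 * a))%:E)%E.
    apply: le_trans (bd _ _ T) _; rewrite [leRHS]EFinM; apply: lee_wpmul2l => //.
    by rewrite lee_fin sqr_ge0.
  move=> /(normsq_leP _ Lrh Lih) e; split=> // P; apply: le_trans (e P).
  by rewrite lerDl sip_ge0.
(* The error of (H - b) u against f has square norm at most 4 (1 + b^2) eps, that is a / 8. *)
pose eps := a / (32 * (1 + b ^+ 2)).
have b1 : 0 < 1 + b ^+ 2 by rewrite ltr_pwDl // sqr_ge0.
have eps0 : 0 < eps by rewrite divr_gt0 // mulr_gt0.
have epsa : 32 * (1 + b ^+ 2) * eps = a by rewrite /eps mulrC divfK // gt_eqF // mulr_gt0.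
have epsa' : 2 * eps <= a.
  rewrite -epsa ler_pM2r //; have := sqr_ge0 b; lra.
have [N' [u [u1 [u2 [Du hu hU]]]]] := cl _ eps0.
pose rho e x := residual b u u2 e x - f e x.
have hrho : normsq_le l rho (a / 8).
  have := normsq_leD (normsq_leD (normsq_leZ (-1) hU) (normsq_leZ b hu)) Er.
  rewrite re_gsub re_gsub re_gscale re_cplx => h0.
  apply: normsq_le_trans (_ : normsq_le l rho _) _.
    by apply: eq_normsq_le h0 => e x _; rewrite /rho /residual; ring.
  by rewrite -epsa le_eqVlt; apply/orP; left; apply/eqP; field.
have [Hu _ _ _] := Du; have [Lu Lu1 Lu2] := H2loc_L2 l_gt0 Hu.
have [Lrho _] := hrho.
have gg : normsq_le l u (4 * M ^+ 2 * a + a).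
  have := normsq_leD hh (normsq_leZ (-1) hu) => h0.
  apply: normsq_le_trans (_ : normsq_le l u _) _.
    by apply: eq_normsq_le h0 => e x _; ring.
  rewrite sqrrN expr1n mul1r; lra.
pose P := maxn N N'.
have DfP := rdom_widen (leq_maxl N N') Df; have DuP := rdom_widen (leq_maxr N N') Du.
have [Hf _ _ f0] := Df; have [_ Lf1 Lf2] := H2loc_L2 l_gt0 Hf.
have [_ hrP] := hrho; have [_ hgP] := gg.
have aP : sip l P f f = a by rewrite (@sip_supp _ _ _ N) // leq_maxl.
have resE v : L2loc l v -> sip l P (residual b u u2) v = sip l P rho v + sip l P f v.
  by move=> Lv; rewrite -sipDl //; apply: eq_sip => e x _ _ //; rewrite /rho subrK.
have resf : sip l P (residual b u u2) f = sip l P u1 f1 - b * sip l P u f.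
  rewrite /residual sipDl //; [|exact: L2locN|by apply: L2locN; exact: L2locZ].
  rewrite sipNl // sipNl ?sipZl //; last exact: L2locZ.
  by rewrite (rdom_form s_gt0 l_gt0 DuP DfP) opprK.
have resu := rdom_residual s_gt0 l_gt0 b DuP.
have B1 : a / 2 <= sip l P u1 f1 - b * sip l P u f.
  rewrite -resf resE // aP.
  have Ln := L2locN Lrho.
  have nn : sip l P (fun e x => - rho e x) (fun e x => - rho e x) = sip l P rho rho.
    by rewrite sipNl // sipC sipNl // opprK.
  have h1 := sip_amgm P (ltr0Sn R 1) Ln Lf; rewrite nn sipNl // aP in h1.
  have := hrP P; lra.
have B2 : sip l P u1 u1 - b * sip l P u u <= K * a.
  rewrite -resu resE //.
  have h1 := sip_amgm P ltr01 Lrho Lu; have h2 := sip_amgm P ltr01 Lf Lu.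
  rewrite invr1 !mul1r in h1 h2; rewrite aP in h2.
  have := hrP P; have := hgP P; rewrite /K; lra.
(* With Q the form of H - b, 0 <= Q(f - t u) <= Q(f) - t a + t^2 K a by [B1] and [B2]. This t is
   optimal and leaves the gain a / (4 K). *)
pose t := (2 * K)^-1; have t0 : 0 < t by rewrite invr_gt0 mulr_gt0.
have Dw := rdomD (- t) DfP DuP.
have := fb _ _ _ _ Dw.
have expand p q : L2loc l p -> L2loc l q ->
    sip l P (fun e x => p e x + - t * q e x) (fun e x => p e x + - t * q e x) =
    sip l P p p - 2 * t * sip l P q p + t ^+ 2 * sip l P q q.
  move=> Lp Lq; have Lq' := L2locZ (- t) Lq; have Lpq := L2locD Lp Lq'.
  rewrite sipDl // sipZl // !(sipC _ _ _ (fun e x => p e x + _)) !sipDl // !sipZl //.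
  by rewrite (sipC _ _ p q); ring.
rewrite !expand // aP => h1.
(* [rdom] records only that f vanishes beyond N, so the equality of the two energies is obtained
   from the integration by parts in [rdom_form]. *)
have fE : sip l N f1 f1 = sip l P f1 f1.
  apply/eqP; rewrite -[_ == _]orbF -subr_eq0; apply/orP; left.
  have e1 := rdom_form s_gt0 l_gt0 Df Df; have e2 := rdom_form s_gt0 l_gt0 DfP DfP.
  rewrite (@sip_supp _ _ _ N) ?leq_maxl // in e2.
  by rewrite subr_eq0 -eqr_opp -e1 -e2.
rewrite fE.
have tK : t * K = 2^-1 by rewrite /t; field; rewrite gt_eqF.
have h2 : t * (a / 2) <= t * (sip l P u1 f1 - b * sip l P u f) by rewrite ler_pM2l.
have h3 : t ^+ 2 * (sip l P u1 u1 - b * sip l P u u) <= t ^+ 2 * (K * a).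
  by rewrite ler_pM2l // exprn_gt0.
have h4 : t ^+ 2 * (K * a) = t * (a / 2) by rewrite expr2 -mulrA (mulrA t K) tK; ring.
have h5 : (4 * K)^-1 = t / 2 by rewrite /t; field; rewrite gt_eqF.
rewrite h5 mulrDl; rewrite h4 in h3.
have -> : t / 2 * a = t * (a / 2) by ring.
lra.
Qed.

End Spectrum.

(** * The upper bound *)

Section TestFunctions.
Variable R : realType.
Notation mu := (@lebesgue_measure R).
Implicit Types (a x y z d : R).

Lemma rint_subset a x (u : R -> R) : x <= a -> itg a u ->
  (forall z, z \in `[0, a] -> 0 <= u z) -> rint x u <= rint a u.
Proof.
move=> xa iu u0; rewrite -lee_fin !fine_rint //; last exact: itgS iu.
apply: ge0_subset_integral => //=.
- by apply/measurable_EFinP; exact: itg_measurable.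

- by apply: subset_itvl; rewrite bnd_simp.
Qed.

Lemma mu_itv_fine (b0 b1 : bool) x y : x <= y ->
  mu [set` Interval (BSide b0 x) (BSide b1 y)] = (y - x)%:E.
Proof.
move=> xy; rewrite lebesgue_measure_itv /= lte_fin EFinB.
move: xy; rewrite le_eqVlt => /predU1P[->|-> //]; by rewrite ltxx subee.
Qed.

Lemma rint_indic_le a x y (b0 b1 : bool) : x <= y ->
  itg a \1_[set` Interval (BSide b0 x) (BSide b1 y)] /\
  rint a \1_[set` Interval (BSide b0 x) (BSide b1 y)] <= y - x.
Proof.
move=> xy; set A := [set` _]; have mA : measurable A by exact: measurable_itv.
have iA : itg a \1_A.
  apply: (@bounded_itg _ _ _ 1); first exact: measurable_indic.
  by move=> z _; rewrite indicE ger0_norm // lern1 leq_b1.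
split => //; rewrite -lee_fin fine_rint // integral_indic // -(mu_itv_fine b0 b1 xy).
by apply: le_measure; rewrite ?inE //; exact: measurableI.
Qed.

Lemma rint_indic a x y : 0 <= x -> x <= y -> y <= a -> rint a \1_`]x, y] = y - x.
Proof.
move=> x0 xy ya; have [iA _] := rint_indic_le a false false xy.
apply/EFin_inj; rewrite fine_rint // integral_indic // -(mu_itv_fine false false xy).
congr (mu _); apply/setIidl => z /=; rewrite !in_itv /= => /andP[xz zy].
by rewrite (le_trans x0 (ltW xz)) (le_trans zy ya).
Qed.

(** A jump of the flux would put a delta into the second derivative of the test function; spreading
    it over length d keeps that derivative square integrable. *)
Definition ramp' y d : R -> R := fun z => d^-1 * \1_`]y, y + d] z.
Definition ramp y d : R -> R := fun z => rint z (ramp' y d).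

Lemma itg_ramp' a y d : 0 < d -> itg a (ramp' y d).
Proof.
move=> d0; apply: itgZ; have yd : y <= y + d by rewrite lerDl ltW.
by have [] := rint_indic_le a false false yd.
Qed.

Lemma L2_ramp' a y d : 0 < d -> L2 a (ramp' y d).
Proof.
move=> d0; apply: L2Z; apply: (@bounded_L2 _ _ _ 1); first exact: measurable_indic.
by move=> z _; rewrite indicE ger0_norm // lern1 leq_b1.
Qed.

Lemma prim_ramp a y d : 0 < d -> prim a (ramp y d) (ramp' y d).
Proof. by move=> d0; apply: prim_rint; exact: itg_ramp'. Qed.

Lemma ramp_ge0 y d z : 0 < d -> 0 <= ramp y d z.
Proof. by move=> d0; apply: rint_ge0 => x _; rewrite /ramp' indicE mulr_ge0 // invr_ge0 ltW. Qed.

Lemma ramp_le1 y d z : 0 < d -> ramp y d z <= 1.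
Proof.
move=> d0; have yd : y <= y + d by rewrite lerDl ltW.
have [i h] := rint_indic_le z false false yd.
by rewrite /ramp rintZ // ler_pdivrMl // mulr1; apply: le_trans h _; rewrite addrC addKr.
Qed.

Lemma ramp_eq0 y d z : 0 <= z -> z <= y -> ramp y d z = 0.
Proof.
move=> z0 zy; rewrite /ramp (@eq_rint _ _ _ (fun=> 0)) ?rint_cst ?mul0r // => x.
rewrite in_itv /= => /andP[_ xz]; rewrite /ramp' indicE memNset ?mulr0 //=.
by rewrite in_itv /= => /andP[yx _]; have := lt_le_trans yx (le_trans xz zy); rewrite ltxx.
Qed.

Lemma ramp_eq1 y d z : 0 < d -> 0 <= y -> y + d <= z -> ramp y d z = 1.
Proof.
move=> d0 y0 yz; have yd : y <= y + d by rewrite lerDl ltW.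
have [i _] := rint_indic_le z false false yd.
rewrite /ramp rintZ // rint_indic //.
by rewrite addrAC subrr add0r mulVf // gt_eqF.
Qed.

Lemma rint_ramp_ge a y d : 0 < d -> 0 <= y -> 0 <= a -> a - (y + d) <= rint a (ramp y d).
Proof.
move=> d0 y0 a0; have yd : 0 <= y + d by rewrite addr_ge0 // ltW.
have [i h] := rint_indic_le a true false yd.
have ir := prim_itg a0 (prim_ramp a y d0).
apply: (@le_trans _ _ (rint a (fun z => 1 - \1_`[0, y + d] z))).
  rewrite rintB //; last exact: itg_cst.
  by rewrite rint_cst // mul1r lerD2l lerN2; apply: le_trans h _; rewrite subr0.
apply: le_rint => //; first by apply: itgB => //; exact: itg_cst.
move=> z; rewrite in_itv /= => /andP[z0 za]; rewrite indicE.
have [zyd|yz] := leP z (y + d).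
  by rewrite mem_set /= ?in_itv /= ?z0 // subrr ramp_ge0.
by rewrite ramp_eq1 ?(ltW yz) // gerBl.
Qed.

Variables (s : nat -> nat) (l : nat -> R).
Hypothesis s_gt0 : forall n, (0 < s n)%N.
Hypothesis l_gt0 : forall n, 0 < l n.
Local Notation mun := (sphere_prod R s).

Lemma sum_edges_tag (phi : nat -> R) N :
  \sum_(e <- edges s N) phi (tag e) = \sum_(0 <= k < N) mun k * phi k.
Proof.
elim: N => [|N IH]; first by rewrite sum_edges0 big_nil.
rewrite sum_edgesS big_nat_recr //= IH; congr (_ + _).
under eq_bigr do rewrite sumr_const card_ord.
by rewrite sumr_const card_ord -mulrnA -[LHS]mulr_natl mulnC.
Qed.

Section Flux.
Variables (n K : nat) (y d : R).
Hypotheses (nK : (n < K)%N) (y_ge0 : 0 <= y) (d_gt0 : 0 < d) (yd : y + d <= l n).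

(* The flux [p] of the radial test function [f], so that f' = - p / mu: it rises from 0 to 1
   right after the point t_n + y and returns to 0 on the K-th bundle.  Since [p] is continuous,
   f satisfies Kirchhoff's conditions. *)
Definition flux k : R -> R :=
  if (k < n)%N then fun=> 0 else if k == n then ramp y d else
  if (k < K)%N then fun=> 1 else if k == K then fun z => 1 - (l K)^-1 * z else fun=> 0.

Definition flux' k : R -> R :=
  if (k < n)%N then fun=> 0 else if k == n then ramp' y d else
  if (k < K)%N then fun=> 0 else if k == K then fun=> - (l K)^-1 else fun=> 0.

Definition flux_drop k : R := rint (l k) (flux k) / mun k.
Definition tf_level k : R := \sum_(k <= j < K.+1) flux_drop j.
Definition tf (e : edge s) z : R := tf_level (tag e) - (mun (tag e))^-1 * rint z (flux (tag e)).
Definition tf1 (e : edge s) z : R := - (mun (tag e))^-1 * flux (tag e) z.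
Definition tf2 (e : edge s) z : R := - (mun (tag e))^-1 * flux' (tag e) z.

Lemma flux_prim k : prim (l k) (flux k) (flux' k) /\ L2 (l k) (flux' k).
Proof.
rewrite /flux /flux'; case: ifP => _; first by split; [exact: prim_cst|exact: L2_cst].
case: ifP => _; first by split; [exact: prim_ramp|exact: L2_ramp'].
case: ifP => _; first by split; [exact: prim_cst|exact: L2_cst].
case: ifP => _; last by split; [exact: prim_cst|exact: L2_cst].
split; last exact: L2_cst.
have := primB (prim_cst (l k) 1) (primZ (l K)^-1 (prim_id (l k))).
by apply: eq_prim => z _ //; rewrite mulr1 sub0r.
Qed.

Lemma flux_itg k : itg (l k) (flux k).
Proof. by have [p _] := flux_prim k; apply: prim_itg p; exact: ltW. Qed.

Lemma flux01 k z : z \in `[0, l k] -> 0 <= flux k z <= 1.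
Proof.
rewrite in_itv /= => /andP[z0 zl]; rewrite /flux.
case: ifP => _; first by rewrite lexx ler01.
case: ifP => _; first by rewrite ramp_ge0 // ramp_le1.
case: ifP => _; first by rewrite lexx ler01.
case: ifP => [/eqP kK|_]; last by rewrite lexx ler01.
rewrite -kK gerBl mulr_ge0 ?invr_ge0 ?(ltW (l_gt0 k)) // subr_ge0 andbT.
by rewrite ler_pdivrMl // mulr1.
Qed.

Lemma flux_0 : flux 0 0 = 0.
Proof.
rewrite /flux; case: ifP => // /negbT; rewrite -leqNgt leqn0 => /eqP ->.
by rewrite eqxx ramp_eq0.
Qed.

Lemma flux_cont k : flux k.+1 0 = flux k (l k).
Proof.
have lK : l K != 0 by rewrite gt_eqF.
rewrite /flux; case: (ltngtP k.+1 n) => [kn|kn|kn].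
- by [].
- rewrite ltnS in kn.
  have -> : (k == n) = (n == k) by rewrite eq_sym.
  have [<-|nk] := eqVneq n k.
    rewrite ramp_eq1 //; case: (ltngtP n.+1 K) => [//|h|_].
      by move: h; rewrite ltnNge nK.
    by rewrite mulr0 subr0.
  case: (ltngtP k.+1 K) => [kK|kK|kK].
  + by [].
  + by case: eqP => // ->; rewrite mulVf // subrr.
  + by rewrite mulr0 subr0.
- by rewrite ramp_eq0.
Qed.

Lemma flux_big k : (K < k)%N -> flux k = fun=> 0.
Proof.
move=> Kk; rewrite /flux ltnNge (ltnW (ltn_trans nK Kk)) /=.
rewrite gtn_eqF ?(ltn_trans nK Kk) // ltnNge (ltnW Kk) /=.
by rewrite gtn_eqF.
Qed.

Lemma flux_small k z : (k < n)%N -> flux k z = 0.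
Proof. by move=> kn; rewrite /flux kn. Qed.

Lemma flux_drop_ge0 k : 0 <= flux_drop k.
Proof.
apply: divr_ge0; last exact/ltW/sphere_prod_gt0.
by apply: rint_ge0 => z /flux01 /andP[].
Qed.

Lemma rint_flux0 k z : 0 <= z -> (forall x, x \in `[0, z] -> flux k x = 0) -> rint z (flux k) = 0.
Proof.
by move=> z0 h; rewrite (@eq_rint _ _ _ (fun=> 0)) ?rint_cst ?mul0r // => x; exact: h.
Qed.

Lemma tf_levelE k : tf_level k = flux_drop k + tf_level k.+1.
Proof.
have [kK|Kk] := leqP k K; first by rewrite /tf_level big_ltn.
rewrite /tf_level /flux_drop big_geq // big_geq ?(leqW Kk) // rint_flux0 ?mul0r ?addr0 //.
  exact: ltW.
by move=> x _; rewrite flux_big.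
Qed.

Lemma tf_level_eq k : (k <= n)%N -> tf_level k = tf_level 0.
Proof.
elim: k => [//|k IH] kn; rewrite -IH; last exact: ltnW.
rewrite [RHS]tf_levelE /flux_drop rint_flux0 ?mul0r ?add0r //; first exact: ltW.
by move=> x _; rewrite flux_small.
Qed.

Lemma tf_rdom : rdom l K.+1 tf tf1 tf2.
Proof.
have m0 k : mun k != 0 by rewrite gt_eqF // sphere_prod_gt0.
split.
- move=> e; have [pf L] := flux_prim (tag e); split.
  + have := primB (prim_cst (l (tag e)) (tf_level (tag e)))
                  (primZ (mun (tag e))^-1 (prim_rint (flux_itg (tag e)))).
    by apply: eq_prim => z _ //; rewrite /tf1 sub0r mulNr.
  + exact: primZ pf.
  + exact: L2Z L.
- exists (fun k _ => tf_level k) => k i j; split; first by rewrite /tf /= rint0 mulr0 subr0.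
  by rewrite /tf /= tf_levelE /flux_drop mulrC addrAC subrr add0r.
- have sn k : (s k)%:R != 0 :> R by rewrite pnatr_eq0 -lt0n.
  move=> [|k] i; rewrite /outflux /tf1 /=.
    by rewrite flux_0 big1 // => j _; rewrite mulr0.
  rewrite !sumr_const !card_ord flux_cont -[LHS]mulr_natl -[RHS]mulr_natl.
  by rewrite /sphere_prod !natrM; field; rewrite !sn.
- move=> e z Ke; rewrite in_itv /= => /andP[z0 _]; rewrite /tf.
  rewrite /tf_level big_geq // rint_flux0 ?mulr0 ?subr0 //.
  by move=> x _; rewrite flux_big.
Qed.

(** Since 0 <= p <= 1, the energy, which is the integral of p^2 / mu, is at most that of p / mu, and
    the latter is the value of f at the root. *)
Lemma tf1_norm : sip l K.+1 tf1 tf1 <= tf_level 0.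
Proof.
rewrite /tf_level.
apply: (@le_trans _ _ (\sum_(e <- edges s K.+1) (mun (tag e))^-1 * flux_drop (tag e))).
  apply: ler_sum => e _; rewrite /flux_drop; set k := tag e.
  have [pf _] := flux_prim k; have Lf := prim_L2 (ltW (l_gt0 k)) pf.
  rewrite /tf1 -/k ipZl //; last exact: L2Z.
  rewrite ipC ipZl // mulrA mulrNN -mulrA.
  have im0 : 0 < (mun k)^-1 by rewrite invr_gt0 sphere_prod_gt0.
  rewrite ler_pM2l // mulrC ler_pM2r //.
  apply: le_rint; [exact: L2_mul_itg|exact: flux_itg|].
  by move=> z /flux01 /andP[h0 h1]; rewrite ler_piMl.
rewrite (sum_edges_tag (fun k => (mun k)^-1 * flux_drop k)) le_eqVlt; apply/orP; left; apply/eqP.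
by apply: eq_bigr => k _; rewrite mulrA divff ?mul1r // gt_eqF // sphere_prod_gt0.
Qed.

(** No flux passes before t_n + y, so f keeps its root value on that whole part of the antitree,
    whose volume is the second factor. *)
Lemma tf_norm : tf_level 0 ^+ 2 * (vol_below s l n + mun n * y) <= sip l K.+1 tf tf.
Proof.
have [Hf _ _ _] := tf_rdom; have [Lf _ _] := H2loc_L2 l_gt0 Hf.
pose phi k := tf_level 0 ^+ 2 * (if (k < n)%N then l k else if k == n then y else 0).
have yl : y <= l n by apply: le_trans yd; rewrite lerDl ltW.
apply: (@le_trans _ _ (\sum_(e <- edges s K.+1) phi (tag e))).
  rewrite sum_edges_tag le_eqVlt; apply/orP; left; apply/eqP.
  have n1K : (n.+1 <= K.+1)%N by exact: ltnW.
  rewrite (big_cat_nat (leq0n _) n1K) /= [X in _ = _ + X]big_nat [X in _ = _ + X]big1 ?addr0.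
    rewrite big_nat_recr //= /phi ltnn eqxx mulrDr; congr (_ + _); last by ring.
    rewrite /vol_below mulr_sumr.
    by apply: eq_big_nat => k /andP[_ kn]; rewrite kn; ring.
  move=> k /andP[nk _]; rewrite /phi ltnNge (ltnW nk) /= gtn_eqF // !mulr0 //.
apply: ler_sum => e _; rewrite /phi; set k := tag e.
case: ifP => [kn|_].
  rewrite -rint_cst; last exact: ltW.
  rewrite le_eqVlt; apply/orP; left; apply/eqP; apply: eq_rint => z.
  rewrite in_itv /= => /andP[z0 _].
  rewrite /tf -/k rint_flux0 // ?mulr0 ?subr0 ?tf_level_eq ?expr2 ?(ltnW kn) //.
  by move=> x _; rewrite flux_small.
case: ifP => [/eqP kn|_]; last by rewrite mulr0; exact: ip_ge0.
rewrite -rint_cst // /ip.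
apply: (@le_trans _ _ (rint y (fun z => tf e z * tf e z))); last first.
  apply: rint_subset; [by rewrite -/k kn|exact: (L2_mul_itg (Lf e) (Lf e))|].
  by move=> z _; rewrite -expr2 sqr_ge0.
rewrite le_eqVlt; apply/orP; left; apply/eqP; apply: eq_rint => z.
rewrite in_itv /= => /andP[z0 zy].
rewrite /tf -/k rint_flux0 // ?mulr0 ?subr0 ?tf_level_eq ?expr2 ?kn //.
move=> x; rewrite in_itv /= => /andP[x0 xz].
by rewrite /flux ltnn eqxx ramp_eq0 // (le_trans xz).
Qed.

(** The flux is 1 from t_n + y + d to t_K; the drops along the ramp and on the K-th bundle are
    discarded. *)
Lemma tf_level_ge : resistance s l n K - (y + d) / mun n <= tf_level 0.
Proof.
have -> : tf_level 0 = flux_drop n + (\sum_(n.+1 <= j < K) flux_drop j + flux_drop K).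
  by rewrite -(tf_level_eq (leqnn n)) /tf_level (big_ltn (leqW nK)) big_nat_recr.
rewrite resistance_ltn // addrAC -mulrBl.
have m0 := sphere_prod_gt0 R s_gt0 n; apply: lerD.
  rewrite /flux_drop ler_pM2r ?invr_gt0 // /flux ltnn eqxx.
  by apply: rint_ramp_ge => //; exact: ltW.
rewrite -[leLHS]addr0; apply: lerD; last exact: flux_drop_ge0.
rewrite /resistance big_nat [leRHS]big_nat; apply: ler_sum => k /andP[nk kK].
rewrite /flux_drop /flux ltnNge (ltnW nk) /= gtn_eqF // kK rint_cst ?mul1r //.
exact: ltW.
Qed.

End Flux.

(** The test function with root value c gives m c^2 M <= c, hence m M c <= 1, and c exceeds the
    truncated P up to an error proportional to d. Taking d = (l n - y) / (j + 1) and letting j grow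
    removes the error. *)
Lemma form_bound_weight_lt m n K y : form_bound s l m -> 0 <= m -> (n < K)%N ->
  0 <= y -> y < l n ->
  m * ((vol_below s l n + mun n * y) * (resistance s l n K - y / mun n)) <= 1.
Proof.
move=> fb m0 nK y0 yl; set A := vol_below s l n + _.
have p0 := sphere_prod_gt0 R s_gt0 n.
have A0 : 0 <= A by rewrite addr_ge0 ?vol_below_ge0 // mulr_ge0 // ltW.
apply: (@ler_add_invn _ _ _ (m * A * ((l n - y) / mun n))) => j.
have j1 : 1 <= j.+1%:R :> R by rewrite ler1n.
pose d := (l n - y) / j.+1%:R.
have ly : 0 < l n - y by rewrite subr_gt0.
have d0 : 0 < d by rewrite divr_gt0.
have yd : y + d <= l n.
  by rewrite -lerBrDl /d ler_pdivrMr // ler_peMr // ltW.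
have D := tf_rdom nK y0 d0 yd.
have h1 := tf1_norm n K y d0; have h2 := tf_norm nK y0 d0 yd.
have h3 := tf_level_ge nK y0 d0; have h4 := fb _ _ _ _ D.
set c := tf_level n K y d 0 in h1 h2 h3.
have c0 : 0 <= c by apply: sumr_ge0 => k _; exact: flux_drop_ge0.
have h5 : m * (c ^+ 2 * A) <= c.
  by apply: le_trans h1; apply: le_trans h4; rewrite ler_wpM2l.
have h6 : m * A * c <= 1.
  move: c0; rewrite le_eqVlt => /predU1P[<-|c0]; first by rewrite mulr0 ler01.
  by rewrite -(ler_pM2l c0) mulr1; apply: le_trans h5; rewrite le_eqVlt; apply/orP; left; apply/eqP; ring.
have mA : 0 <= m * A by rewrite mulr_ge0.
have := ler_wpM2l mA h3 => h7.
have E : (y + d) / mun n = y / mun n + (l n - y) / mun n / j.+1%:R by rewrite /d; ring.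
rewrite E in h7.
rewrite mulrA -lerBlDr; apply: le_trans h6; apply: le_trans h7.
by rewrite le_eqVlt; apply/orP; left; apply/eqP; ring.
Qed.

(** The ramp needs room to the right of y, so the endpoint y = l n is treated as the beginning of
    the next bundle; if K = n + 1 the truncated tail is empty there. *)
Lemma form_bound_weight m n K y : form_bound s l m -> 0 <= m -> (n < K)%N ->
  0 <= y <= l n ->
  m * ((vol_below s l n + mun n * y) * (resistance s l n K - y / mun n)) <= 1.
Proof.
move=> fb m0 nK /andP[y0]; rewrite le_eqVlt => /predU1P[->|yl]; last exact: form_bound_weight_lt.
rewrite -vol_belowS resistance_ltn // addrAC subrr add0r.
have [nK'|Kn] := ltnP n.+1 K; last by rewrite /resistance big_geq // !mulr0.
have := form_bound_weight_lt fb m0 nK' (lexx 0) (l_gt0 n.+1).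
by rewrite mulr0 addr0 mul0r subr0.
Qed.

End TestFunctions.

(** * The weight *)

Section Weights.
Variables (R : realType) (s : nat -> nat) (l : nat -> R).
Hypothesis s_gt0 : forall n, (0 < s n)%N.
Hypothesis l_gt0 : forall n, 0 < l n.
Notation mu := (@lebesgue_measure R).
Local Notation mun := (sphere_prod R s).

Lemma tpt0 : tpt l 0 = 0. Proof. by rewrite /tpt big_nil. Qed.

Lemma tptS n : tpt l n.+1 = tpt l n + l n. Proof. by rewrite /tpt big_nat_recr. Qed.

Lemma tpt_mono n m : (n <= m)%N -> tpt l n <= tpt l m.
Proof.
move=> /subnK <-; elim: (m - n)%N => [//|k IH].
by apply: le_trans IH _; rewrite addSn tptS lerDl ltW.
Qed.

Lemma tpt_uniq n m x : tpt l n <= x < tpt l n.+1 -> tpt l m <= x < tpt l m.+1 -> n = m.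
Proof.
move=> /andP[a1 a2] /andP[b1 b2]; apply/eqP; rewrite eqn_leq.
apply/andP; split; rewrite leqNgt; apply/negP => /tpt_mono h.
  by have := lt_le_trans b2 (le_trans h a1); rewrite ltxx.
by have := lt_le_trans a2 (le_trans h b1); rewrite ltxx.
Qed.

Lemma weightE n x : tpt l n <= x < tpt l n.+1 -> weight s l x = mun n.
Proof.
move=> nx; rewrite /weight /sphere_prod; case: xgetP => [m _ /= mx|h].
  by rewrite (tpt_uniq nx mx).
by case: (h n).
Qed.

Lemma tpt_find x K : 0 <= x -> x < tpt l K ->
  exists n y, [/\ 0 <= y, y < l n & x = tpt l n + y].
Proof.
move=> x0; elim: K => [|K IH]; first by rewrite tpt0 ltNge x0.
have [xK _|Kx] := ltP x (tpt l K); first exact: IH.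
rewrite tptS => h; exists K, (x - tpt l K); split; rewrite ?subr_ge0 ?ltrBlDl //.
by rewrite addrC subrK.
Qed.

Section Step.
Variables (c : nat -> R) (phi : R -> R).
Hypothesis c_ge0 : forall k, 0 <= c k.
Hypothesis phiE : forall k x, tpt l k <= x < tpt l k.+1 -> phi x = c k.

(** The step function phi stands for the weight and for its inverse alike. Half-open intervals match
    the intervals of constancy; [open_left] adjusts the left endpoint afterwards. *)
Lemma step_bundle n (a b : R) : tpt l n <= a -> a <= b -> b <= tpt l n.+1 ->
  measurable_fun `[a, b[ phi /\
  (\int[mu]_(x in `[a, b[) (phi x)%:E)%E = (c n * (b - a))%:E.
Proof.
move=> na ab bn; have E x : x \in `[a, b[ -> phi x = c n.
  rewrite in_itv /= => /andP[ax xb]; apply: phiE.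
  by rewrite (le_trans na ax) (lt_le_trans xb bn).
split.
  apply: (@eq_measurable_fun _ _ _ _ _ (fun=> c n)); last exact: measurable_cst.
  by move=> x; rewrite inE /= => xab; rewrite E.
rewrite (eq_integral (fun=> (c n)%:E)); last by move=> x; rewrite inE /= => xab; rewrite E.
by rewrite integral_cst // EFinM -(mu_itv_fine true true ab).
Qed.

Lemma phi_ge0 x K : 0 <= x -> x < tpt l K -> 0 <= phi x.
Proof.
move=> x0 xK; have [k [y [y0 yl ->]]] := tpt_find x0 xK; rewrite (@phiE k) //.
by rewrite lerDl y0 /= tptS ltrD2l.
Qed.

Lemma step_bundles n K : (n <= K)%N ->
  measurable_fun `[tpt l n, tpt l K[ phi /\
  (\int[mu]_(x in `[tpt l n, tpt l K[) (phi x)%:E)%E = (\sum_(n <= k < K) c k * l k)%:E.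
Proof.
move=> /subnK <-; elim: (K - n)%N => [|j [m IH]].
  rewrite add0n big_geq // set_itvco0 integral_set0; split=> //.
  exact: measurable_fun_set0.
set q := (j + n)%N in m IH *; rewrite addSn -/q.
have nq : tpt l n <= tpt l q by apply: tpt_mono; exact: leq_addl.
have qq : tpt l q <= tpt l q.+1 by exact: tpt_mono.
have U : `[tpt l n, tpt l q.+1[%classic = `[tpt l n, tpt l q[ `|` `[tpt l q, tpt l q.+1[.
  by rewrite -itv_bndbnd_setU // bnd_simp.
have [m1 I1] := step_bundle (lexx _) qq (lexx _).
rewrite U; split; first exact/measurable_funU.
rewrite ge0_integral_setU //=.
- rewrite IH I1 big_nat_recr ?leq_addl //= tptS addrAC subrr add0r.
  by rewrite -EFinD.
- by apply/measurable_EFinP/measurable_funU.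
- move=> x hx; have : `[tpt l n, tpt l q.+1[%classic x by rewrite U.
  rewrite /= in_itv /= => /andP[nx xq]; rewrite lee_fin.
  by apply: phi_ge0 xq; apply: le_trans nx; rewrite -tpt0 tpt_mono.
- by apply/disj_setPS => x [/=]; rewrite !in_itv /= => /andP[_ h] /andP[h' _];
    have := lt_le_trans h h'; rewrite ltxx.
Qed.

Lemma step_join (a b d : R) : 0 <= a -> a <= b -> b <= d -> (exists K, d <= tpt l K) ->
  measurable_fun `[a, b[ phi -> measurable_fun `[b, d[ phi ->
  measurable_fun `[a, d[ phi /\
  (\int[mu]_(x in `[a, d[) (phi x)%:E =
   \int[mu]_(x in `[a, b[) (phi x)%:E + \int[mu]_(x in `[b, d[) (phi x)%:E)%E.
Proof.
move=> a0 ab bd [K dK] m1 m2.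
have U : `[a, d[%classic = `[a, b[ `|` `[b, d[ by rewrite -itv_bndbnd_setU // bnd_simp.
rewrite U; split; first exact/measurable_funU.
rewrite ge0_integral_setU //=.
- by apply/measurable_EFinP/measurable_funU.
- move=> x hx; have : `[a, d[%classic x by rewrite U.
  rewrite /= in_itv /= => /andP[ax xd]; rewrite lee_fin.
  by apply: (@phi_ge0 _ K); [exact: le_trans ax|exact: lt_le_trans dK].
- by apply/disj_setPS => x [/=]; rewrite !in_itv /= => /andP[_ h] /andP[h' _];
    have := lt_le_trans h h'; rewrite ltxx.
Qed.

Lemma open_left (a b : R) : measurable_fun `[a, b[ phi ->
  (\int[mu]_(x in `]a, b[) (phi x)%:E = \int[mu]_(x in `[a, b[) (phi x)%:E)%E.
Proof.
move=> m; rewrite integral_itv_obnd_cbnd //.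
by apply/measurable_EFinP; apply: measurable_funS m => //; apply: subset_itvr; rewrite bnd_simp.
Qed.

Lemma step_from0 n (y : R) : 0 <= y <= l n ->
  (\int[mu]_(x in `]0%R, (tpt l n + y)%R[) (phi x)%:E =
   (\sum_(0 <= k < n) c k * l k + c n * y)%:E)%E.
Proof.
move=> /andP[y0 yl]; have [m1 I1] := step_bundles (leq0n n).
have [m2 I2] : measurable_fun `[tpt l n, tpt l n + y[ phi /\
    (\int[mu]_(x in `[tpt l n, (tpt l n + y)%R[) (phi x)%:E)%E = (c n * (tpt l n + y - tpt l n))%:E.
  by apply: step_bundle; rewrite ?lerDl // tptS lerD2l.
rewrite tpt0 in m1 I1.
have t0 : 0 <= tpt l n by rewrite -tpt0 tpt_mono.
have [m ->] : measurable_fun `[0, tpt l n + y[ phi /\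
    (\int[mu]_(x in `]0%R, (tpt l n + y)%R[) (phi x)%:E =
    (\sum_(0 <= k < n) c k * l k + c n * y)%:E)%E; last by [].
have [m I] : measurable_fun `[0, tpt l n + y[ phi /\
   (\int[mu]_(x in `[0%R, (tpt l n + y)%R[) (phi x)%:E =
   \int[mu]_(x in `[0%R, tpt l n[) (phi x)%:E + \int[mu]_(x in `[tpt l n, (tpt l n + y)%R[) (phi x)%:E)%E.
  apply: step_join; rewrite ?lerDl //.
  by exists n.+1; rewrite tptS lerD2l.
by split=> //; rewrite open_left // I I1 I2 addrAC subrr add0r EFinD.
Qed.

Lemma step_tail n (y : R) K : 0 <= y < l n -> (n < K)%N ->
  measurable_fun `]tpt l n + y, tpt l K[ phi /\
  (\int[mu]_(x in `](tpt l n + y)%R, tpt l K[) (phi x)%:E =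
   (\sum_(n <= k < K) c k * l k - c n * y)%:E)%E.
Proof.
move=> /andP[y0 yl] nK; have [m1 I1] := step_bundles nK.
have [m2 I2] : measurable_fun `[tpt l n + y, tpt l n.+1[ phi /\
    (\int[mu]_(x in `[(tpt l n + y)%R, tpt l n.+1[) (phi x)%:E)%E =
    (c n * (tpt l n.+1 - (tpt l n + y)))%:E.
  by apply: step_bundle; rewrite ?lerDl // tptS lerD2l ltW.
have t0 : 0 <= tpt l n by rewrite -tpt0 tpt_mono.
have [m I] : measurable_fun `[tpt l n + y, tpt l K[ phi /\
   (\int[mu]_(x in `[(tpt l n + y)%R, tpt l K[) (phi x)%:E =
   \int[mu]_(x in `[(tpt l n + y)%R, tpt l n.+1[) (phi x)%:E +
   \int[mu]_(x in `[tpt l n.+1, tpt l K[) (phi x)%:E)%E.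
  apply: step_join => //; first exact: addr_ge0.
  - by rewrite tptS lerD2l ltW.
  - exact: tpt_mono.
  - by exists K.
split; first by apply: measurable_funS m => //; apply: subset_itvr; rewrite bnd_simp.
rewrite open_left // I I1 I2 -EFinD [in RHS](big_ltn nK) tptS; congr (_%:E); ring.
Qed.

End Step.

Lemma height_ub K : ((tpt l K)%:E <= height l)%E.
Proof.
rewrite /tpt -sumEFin; apply: nneseries_lim_ge => k _ _.
by rewrite lee_fin ltW.
Qed.

Lemma lt_height x : (x%:E < height l)%E <-> exists K, x < tpt l K.
Proof.
split=> [h|[K xK]]; last by apply: lt_le_trans (height_ub K); rewrite lte_fin.
apply: contrapT => no; move: h; apply/negP; rewrite -leNgt /height.
apply: lime_le; first by apply: is_cvg_nneseries => k _ _; rewrite lee_fin ltW.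
apply: nearW => K; rewrite sumEFin lee_fin leNgt; apply/negP => xK.
by apply: no; exists K.
Qed.

Lemma inv_weightE k x : tpt l k <= x < tpt l k.+1 -> (weight s l x)^-1 = (mun k)^-1.
Proof. by move=> h; rewrite (weightE h). Qed.

Let mun_inv_ge0 k : 0 <= (mun k)^-1.
Proof. by rewrite invr_ge0 ltW // sphere_prod_gt0. Qed.

Let mun_ge0 k : 0 <= mun k.
Proof. by rewrite ltW // sphere_prod_gt0. Qed.

(** Monotone convergence along the truncations at t_K; it also covers an infinite height, since the
    points below [height] are exactly those below some t_K. *)
Lemma tail_inv_weight_cvg n y : 0 <= y < l n ->
  ((resistance s l n K - y / mun n)%:E @[K --> \oo] --> tail_inv_weight s l (tpt l n + y))%E.
Proof.
move=> hy; have /andP[y0 yl] := hy.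
have t0 : 0 <= tpt l n by rewrite -tpt0 tpt_mono.
(* The shift by n + 1 puts every truncation point beyond t_n + y, as [step_tail] requires. *)
pose F K : set R := `]tpt l n + y, tpt l (K + n.+1)[%classic.
have FK : [set x : R | (tpt l n + y < x)%R /\ (x%:E < height l)%E] = \bigcup_K F K.
  apply/seteqP; split=> x /=.
    move=> [nx /lt_height [K xK]]; exists K => //; rewrite /F /= in_itv /= nx /=.
    by apply: lt_le_trans xK (tpt_mono _); exact: leq_addr.
  move=> [K _]; rewrite /F /= in_itv /= => /andP[nx xK]; split=> //.
  by apply/lt_height; exists (K + n.+1)%N.
have st K := step_tail mun_inv_ge0 inv_weightE hy (leq_addl K n.+1).
have cv : (\int[mu]_(x in F K) ((weight s l x)^-1)%:E @[K --> \oo] -->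
    \int[mu]_(x in \bigcup_K F K) ((weight s l x)^-1)%:E)%E.
  apply: ge0_nondecreasing_set_cvg_integral.
  - move=> i j ij; apply/subsetPset; apply: subset_itvl; rewrite bnd_simp.
    by apply: tpt_mono; rewrite leq_add2r.
  - by move=> K; exact: measurable_itv.
  - by move=> K; apply/measurable_EFinP; case: (st K).
  - by move=> K x _; rewrite lee_fin invr_ge0 /weight ler0n.
rewrite /tail_inv_weight FK.
have E K : (\int[mu]_(x in F K) ((weight s l x)^-1)%:E)%E =
    (resistance s l n (K + n.+1) - y / mun n)%:E.
  rewrite (st K).2; congr ((_ - _)%:E); last by rewrite mulrC.
  by rewrite /resistance; apply: eq_bigr => k _; rewrite mulrC.
rewrite -(cvg_shiftn n.+1).
by under eq_fun do rewrite -E.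
Qed.

Lemma tail_inv_weight_ge n y K : 0 <= y < l n -> (n < K)%N ->
  ((resistance s l n K - y / mun n)%:E <= tail_inv_weight s l (tpt l n + y))%E.
Proof.
move=> hy nK; apply: (cvge_to_ge (tail_inv_weight_cvg hy)).
exists K => // M /= KM; rewrite lee_fin lerD2r.
rewrite /resistance (big_cat_nat (ltnW nK) KM) /= lerDl.
by apply: sumr_ge0 => k _; rewrite mulr_ge0 // ltW.
Qed.

Lemma tail_inv_weight_le n y (c : R) : 0 <= y < l n ->
  (forall K, (n < K)%N -> resistance s l n K - y / mun n <= c) ->
  (tail_inv_weight s l (tpt l n + y) <= c%:E)%E.
Proof.
move=> hy h; apply: (cvge_to_le (tail_inv_weight_cvg hy)).
by exists n.+1 => // K /= nK; rewrite lee_fin h.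
Qed.

Lemma Lmu_series :
  (Lmu s l = \sum_(0 <= n <oo) (l n / (s n * s n.+1)%:R)%:E)%E.
Proof.
have h0 : 0 <= (0 : R) < l 0%N by rewrite lexx l_gt0.
have := tail_inv_weight_cvg h0; rewrite tpt0 addr0 -/(Lmu s l) => h.
have E : (fun K => (resistance s l 0 K - 0 / mun 0)%:E) =
    (fun K => (\sum_(0 <= k < K) (l k / (s k * s k.+1)%:R)%:E)%E).
  by apply/funext => K; rewrite mul0r subr0 /resistance -sumEFin.
by rewrite E in h; apply/esym/cvg_lim.
Qed.

Lemma weight_int n y : 0 <= y <= l n ->
  (\int[mu]_(x in `]0%R, (tpt l n + y)%R[) (weight s l x)%:E =
   (vol_below s l n + mun n * y)%:E)%E.
Proof. by move=> hy; rewrite (step_from0 mun_ge0 weightE hy). Qed.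

(** Positivity makes the inverse of [Cheight] a genuine reciprocal when it is finite. The midpoint
    of the first edge is a witness. *)
Lemma Cheight_gt0 : (0 < Cheight s l)%E.
Proof.
have l0 := l_gt0 0%N; have p0 := sphere_prod_gt0 R s_gt0 0.
have hy : 0 <= l 0%N / 2 < l 0%N by lra.
have hy' : 0 <= l 0%N / 2 <= l 0%N by lra.
apply: (@lt_le_trans _ _ (((vol_below s l 0 + mun 0 * (l 0%N / 2))%:E) *
    tail_inv_weight s l (tpt l 0 + l 0%N / 2))%E); last first.
  apply: ereal_sup_ubound; exists (tpt l 0 + l 0%N / 2); last by rewrite weight_int.
  rewrite tpt0 add0r; split; first by lra.
  by apply/lt_height; exists 1%N; rewrite tptS tpt0; lra.
apply: mule_gt0; first by rewrite lte_fin /vol_below big_nil add0r mulr_gt0 // divr_gt0.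
apply: lt_le_trans (tail_inv_weight_ge hy (ltn0Sn 0)).
rewrite lte_fin /resistance big_nat1 -mulrBl divr_gt0 //; lra.
Qed.

(** Bridge between the supremum of the statement and the truncated products that appear in both the
    Hardy inequality and the test functions. *)
Lemma Cheight_leP (c : R) : (Cheight s l <= c%:E)%E <-> weight_bound s l c.
Proof.
split=> h.
  have c0 : 0 <= c by rewrite -lee_fin; apply: le_trans h; exact/ltW/Cheight_gt0.
  have main n K y : (n < K)%N -> 0 <= y < l n -> 0 < tpt l n + y ->
      (vol_below s l n + mun n * y) * (resistance s l n K - y / mun n) <= c.
    move=> nK hy x0; have /andP[y0 yl] := hy; have hy' : 0 <= y <= l n by rewrite y0 ltW.
    have A0 : 0 <= vol_below s l n + mun n * y by rewrite addr_ge0 ?vol_below_ge0 // mulr_ge0.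
    rewrite -lee_fin; apply: le_trans h; rewrite EFinM.
    apply: (@le_trans _ _ ((vol_below s l n + mun n * y)%:E * tail_inv_weight s l (tpt l n + y))%E).
      by apply: lee_wpmul2l; [rewrite lee_fin|exact: tail_inv_weight_ge].
    apply: ereal_sup_ubound; exists (tpt l n + y); last by rewrite weight_int.
    by split=> //; apply/lt_height; exists n.+1; rewrite tptS ltrD2l.
  (* Two boundary cases are missing from [main]: y = l n is the first point of the next bundle, and
     at the root, which the supremum excludes, the product is 0. *)
  move=> n K y nK /andP[y0]; rewrite le_eqVlt => /predU1P[->|yl].
    rewrite -vol_belowS resistance_ltn // addrAC subrr add0r.
    have [nK'|Kn] := ltnP n.+1 K; last by rewrite /resistance big_geq // mulr0.
    have := main n.+1 K 0 nK'; rewrite lexx l_gt0 => /(_ isT).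
    rewrite !addr0 mulr0 mul0r subr0 addr0; apply.
    by apply: lt_le_trans (tpt_mono (ltn0Sn n)); rewrite tptS tpt0 add0r.
  have [nz|n0] := posnP n.
    move: y0; rewrite le_eqVlt => /predU1P[<-|y0].
      by rewrite nz /vol_below big_nil mulr0 addr0 mul0r.
    by apply: main => //; rewrite ?(ltW y0) // nz tpt0 add0r.
  apply: main => //; rewrite ?y0 //; apply: ltr_wpDr => //.
  by apply: lt_le_trans (tpt_mono n0); rewrite tptS tpt0 add0r.
apply: ge_ereal_sup => _ [x [x0 /lt_height [K xK]] <-].
have [n [y [y0 yl xE]]] := tpt_find (ltW x0) xK; rewrite xE in x0 *.
have hy : 0 <= y < l n by rewrite y0.
rewrite weight_int; last by rewrite y0 ltW.
set A := vol_below s l n + mun n * y.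
have A0 : 0 < A.
  have p0 := sphere_prod_gt0 R s_gt0 n.
  case: n y0 yl xE hy x0 @A p0 => [|n] y0 yl xE hy x0 A p0.
    by rewrite tpt0 add0r in x0; rewrite /A /vol_below big_nil add0r mulr_gt0.
  rewrite /A vol_belowS -addrA ltr_wpDl ?vol_below_ge0 // ltr_pwDl ?mulr_ge0 //.
  by rewrite mulr_gt0 // sphere_prod_gt0.
(* Dividing by the positive volume A bounds every truncated tail by c / A, and this bound passes to
   the limit. *)
apply: (@le_trans _ _ (A%:E * (c / A)%:E)%E).
  apply: lee_wpmul2l; first by rewrite lee_fin ltW.
  apply: tail_inv_weight_le => // M nM; rewrite ler_pdivlMr // mulrC.
  by apply: h => //; rewrite y0 ltW.
by rewrite -EFinM lee_fin mulrC divfK // gt_eqF.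
Qed.

(** At the midpoint of an edge the product is at least l_n^2 / 4, and 4 c <= (c + 1)^2. *)
Lemma weight_bound_lstar (c : R) : weight_bound s l c -> (lstar l < +oo)%E.
Proof.
move=> h; apply: (@le_lt_trans _ _ (c + 1)%:E); last exact: ltry.
apply: ge_ereal_sup => _ [n _ <-]; rewrite lee_fin.
have ln := l_gt0 n; have p0 := sphere_prod_gt0 R s_gt0 n.
have hy : 0 <= l n / 2 <= l n by lra.
have := h n n.+1 (l n / 2) (ltnSn n) hy.
rewrite /resistance big_nat1 => h1.
have : l n ^+ 2 <= 4 * c.
  apply: (@le_trans _ _ (4 * ((vol_below s l n + mun n * (l n / 2)) *
    (l n / mun n - l n / 2 / mun n)))); last by rewrite ler_pM2l.
  have -> : 4 * ((vol_below s l n + mun n * (l n / 2)) * (l n / mun n - l n / 2 / mun n)) =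
    l n ^+ 2 + 2 * vol_below s l n * l n / mun n.
    by move: (mun n) p0 (vol_below s l n) => m p0 v; field; rewrite gt_eqF.
  by rewrite lerDl divr_ge0 // mulr_ge0 ?mulr_ge0 ?vol_below_ge0 // ltW.
have := sqr_ge0 (c - 1); nra.
Qed.

(** At the midpoint of the first edge the volume factor is a fixed positive number A, so the bound
    on the product bounds all truncated tails. *)
Lemma weight_bound_Lmu (c : R) : weight_bound s l c -> (Lmu s l < +oo)%E.
Proof.
move=> h; have l0 := l_gt0 0%N; have p0 := sphere_prod_gt0 R s_gt0 0.
have h0 : 0 <= (0 : R) < l 0%N by rewrite lexx l0.
have hy : 0 <= l 0%N / 2 <= l 0%N by lra.
pose A := mun 0 * (l 0%N / 2); have A0 : 0 < A by rewrite mulr_gt0 // divr_gt0.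
have := @tail_inv_weight_le 0 0 (c / A + l 0%N / 2 / mun 0) h0.
rewrite tpt0 addr0 -/(Lmu s l) => b; apply: le_lt_trans (b _) (ltry _) => K K0.
rewrite mul0r subr0 -lerBlDr ler_pdivlMr // mulrC.
by have := h 0%N K _ K0 hy; rewrite {1}/vol_below big_nil add0r.
Qed.

End Weights.

(** * The best form bound and the two-sided estimate *)

Lemma vol_below_infty (R : realType) (s : nat -> nat) (l : nat -> R) :
  (\sum_(0 <= n <oo) ((s n * s n.+1)%:R * l n)%:E = +oo)%E ->
  (forall n, 0 < l n) -> forall A : R, exists N, A <= vol_below s l N.
Proof.
move=> vol l_gt0 A; apply: contrapT => no.
suff : (+oo <= A%:E)%E by rewrite leye_eq.
rewrite -vol; apply: lime_le.
  by apply: is_cvg_nneseries => k _ _; rewrite lee_fin mulr_ge0 // ltW.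
apply: nearW => N; rewrite sumEFin lee_fin leNgt; apply/negP => AN.
by apply: no; exists N; exact: ltW.
Qed.

(** The form bounds include 0 and are bounded above by a single test product A; the inequality is
    closed in b, so their supremum is again a form bound. *)
Lemma form_bound_max (R : realType) (s : nat -> nat) (l : nat -> R) :
  (forall n, (0 < s n)%N) -> (forall n, 0 < l n) ->
  exists m : R, [/\ 0 <= m, form_bound s l m & forall b, form_bound s l b -> b <= m].
Proof.
move=> s_gt0 l_gt0; pose E := [set b : R | form_bound s l b].
have l0 := l_gt0 0%N; have p0 := sphere_prod_gt0 R s_gt0 0.
have hy : 0 <= l 0%N / 2 <= l 0%N by lra.
pose A := (vol_below s l 0 + sphere_prod R s 0 * (l 0%N / 2)) *
  (resistance s l 0 1 - l 0%N / 2 / sphere_prod R s 0).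
have A0 : 0 < A.
  rewrite /A /vol_below big_nil add0r /resistance big_nat1 -mulrBl.
  by rewrite mulr_gt0 ?divr_gt0 ?mulr_gt0 //; lra.
have E0 : E 0 by exact: form_bound0.
have Eb : has_ubound E.
  exists A^-1 => b fb; have [b0|b0] := leP 0 b; last by rewrite ltW // (lt_trans b0) // invr_gt0.
  have := form_bound_weight s_gt0 l_gt0 fb b0 (ltn0Sn 0) hy.
  by rewrite -/A -ler_pdivlMr // div1r.
exists (sup E); split.
- exact: ub_le_sup Eb _ E0.
- move=> N f f1 f2 Df; set a := sip l N f f.
  have : 0 <= a := sip_ge0 _ _ _; rewrite le_eqVlt => /predU1P[<-|a0].
    by rewrite mulr0 sip_ge0.
  rewrite -ler_pdivlMr //; apply: ge_sup; first by exists 0.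
  by move=> b fb; rewrite ler_pdivlMr //; exact: fb Df.
- by move=> b fb; exact: ub_le_sup Eb _ fb.
Qed.

Theorem theorem6p1 (R : realType) (s : nat -> nat) (l : nat -> R)
  (s0 : s 0%N = 1%N) (s_gt0 : forall n, (0 < s n)%N) (l_gt0 : forall n, 0 < l n)
  (vol_infty : (\sum_(0 <= n <oo) ((s n * s n.+1)%:R * l n)%:E = +oo)%E) :
  [/\ Lmu s l = (\sum_(0 <= n <oo) (l n / (s n * s n.+1)%:R)%:E)%E,
      (0 < lambda0 s l)%E <->
        [/\ (lstar l < +oo)%E, (Lmu s l < +oo)%E & (Cheight s l < +oo)%E],
      ((4%:R%:E * Cheight s l)^-1 <= lambda0 s l)%E &
      (lambda0 s l <= (Cheight s l)^-1)%E].
Proof.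
have vol := vol_below_infty vol_infty l_gt0.
have C0 := Cheight_gt0 s_gt0 l_gt0.
have CfinE : (Cheight s l < +oo)%E -> exists2 c : R, 0 < c & Cheight s l = c%:E.
  by case: (Cheight s l) C0 => [c| |] //; rewrite lte_fin => c0 _; exists c.
have specP b : form_bound s l b -> (b%:E <= lambda0 s l)%E.
  move=> fb; apply: le_ereal_inf_tmp => _ [x sx <-]; rewrite lee_fin leNgt; apply/negP => xb.
  by apply: sx; exact: resolvent_below fb xb.
have invE (c : R) : 0 < c -> (c%:E^-1 = (c^-1)%:E)%E by move=> c0; rewrite inver gt_eqF.
have lower : ((4%:R%:E * Cheight s l)^-1 <= lambda0 s l)%E.
  have [Cy|] := eqVneq (Cheight s l) +oo%E.
    (* For infinite C the claim is that the spectrum is nonnegative, which is the trivial form bound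
       0. *)
    rewrite Cy gt0_muley ?lte_fin // invey; apply: specP; exact: form_bound0.
  rewrite -ltey => /CfinE [c c0 CE].
  have cb : weight_bound s l c by apply/(Cheight_leP s_gt0 l_gt0); rewrite CE.
  rewrite CE -EFinM invE ?mulr_gt0 //; apply: specP.
  exact: hardy_antitree.
have upper : (lambda0 s l <= (Cheight s l)^-1)%E.
  have [m [m0 fm mmax]] := form_bound_max s_gt0 l_gt0.
  (* Were m in the resolvent set, [resolvent_gap] would give a larger form bound. *)
  have sm : spectrum l (@kirchhoff_laplacian R s l) (real_complex R m).
    move=> rm; have [d d0 /mmax] := resolvent_gap s_gt0 l_gt0 fm rm.
    by rewrite gerDl leNgt d0.
  apply: (@le_trans _ _ m%:E); first by apply: ereal_inf_lbound; exists m.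
  move: m0; rewrite le_eqVlt => /predU1P[<-|m0]; first by rewrite inve_ge0 ltW.
  have : (Cheight s l <= (m^-1)%:E)%E.
    apply/(Cheight_leP s_gt0 l_gt0) => n K y nK hy.
    by rewrite -[m^-1]mulr1 ler_pdivlMl //; exact: (form_bound_weight s_gt0 l_gt0 fm (ltW m0) nK hy).
  move=> Cm; have [c c0 CE] := CfinE (le_lt_trans Cm (ltry _)).
  by rewrite CE lee_fin in Cm; rewrite CE invE // lee_fin -[m]invrK lef_pV2 ?posrE ?invr_gt0.
split=> //; first exact: Lmu_series.
split=> [lam0|[_ _ /CfinE [c c0 CE]]].
  have /CfinE [c c0 CE] : (Cheight s l < +oo)%E.
    rewrite ltey; apply/eqP => Cy; move: (lt_le_trans lam0 upper).
    by rewrite Cy invey ltxx.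
  have cb : weight_bound s l c by apply/(Cheight_leP s_gt0 l_gt0); rewrite CE.
  split; last by rewrite CE ltry.
    exact: weight_bound_lstar cb.
  exact: weight_bound_Lmu cb.
apply: lt_le_trans lower; rewrite CE -EFinM invE ?mulr_gt0 //.
by rewrite lte_fin invr_gt0 mulr_gt0.
Qed.
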